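(* Let $\mathfrak{X}_{\mathcal{T}}$ ($\mathcal{T}$ a well-founded tree admitted by the construction) and $\mathfrak{X}_{\mathcal{U}}$ be the complex Argyros--Motakis spaces described in the context. Each of the spaces $\mathfrak{X}_{\mathcal{T}}$ and $\mathfrak{X}_{\mathcal{U}}$ is Lotz-saturated but is itself non-Lotz. Consequently: (i) every $\mathfrak{X}_{\mathcal{T}}$ contains an infinite-dimensional separable reflexive complex hereditarily indecomposable closed subspace with the Lotz property; (ii) $\mathfrak{X}_{\mathcal{U}}$ contains an infinite-dimensional separable complex hereditarily indecomposable closed subspace with the Lotz property and with no infinite-dimensional reflexive subspace. In both cases the Lotz subspace can be chosen to fail the compact approximation property.
   Context: For a complex Banach space $Y$, $\mathcal{L}(Y)$, $\mathcal{K}(Y)$, $\mathcal{SS}(Y)$ denote the bounded, compact, and strictly singular operators on $Y$ ($S$ is strictly singular if no restriction of $S$ to an infinite-dimensional closed subspace is an isomorphism onto its range). A $C_0$-semigroup on $Y$ is a family $(T(t))_{t\ge 0}\subset\mathcal{L}(Y)$ with $T(0)=I_Y$, $T(t+s)=T(t)T(s)$, and $\lim_{t\downarrow 0}\|T(t)x-x\|=0$ for all $x\in Y$; it is uniformly continuous if $\lim_{t\downarrow 0}\|T(t)-I_Y\|=0$. $Y$ has the Lotz property if every $C_0$-semigroup on $Y$ is uniformly continuous, and is non-Lotz otherwise. A Banach space $E$ is Lotz-saturated if every infinite-dimensional closed subspace of $E$ contains an infinite-dimensional closed subspace with the Lotz property. $Y$ has the compact approximation property (CAP) if for every compact $C\subset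 Y$ and $\varepsilon>0$ there is $K\in\mathcal{K}(Y)$ with $\sup_{x\in C}\|Kx-x\|<\varepsilon$. $Y$ is hereditarily indecomposable (HI) if no infinite-dimensional closed subspace of $Y$ is a topological direct sum of two infinite-dimensional closed subspaces. A bounded sequence $(x_n)$ generates a basic sequence $(e_n)$ as a spreading model if for every $k\in\mathbb{N}$, $\lim_{n_1\to\infty,\ n_1<\cdots<n_k}\|\sum_{j=1}^k a_jx_{n_j}\|=\|\sum_{j=1}^k a_je_j\|$, uniformly for $(a_1,\dots,a_k)\in[-1,1]^k$. The spaces are fixed infinite-dimensional Banach spaces with the following known properties (taken as given). For every well-founded tree $\mathcal{T}$ admitted by the Argyros--Motakis dual construction, $\mathfrak{X}_{\mathcal{T}}$ is a separable reflexive complex HI space with a Schauder basis. $\mathfrak{X}_{\mathcal{U}}$ is a separable complex HI space with a shrinking Schauder basis and no infinite-dimensional reflexive subspace. Every infinite-dimensional closed subspace $Y$ of any of these spaces contains a normalized sequence generating the unit vector basis of $\ell_1$ as a spreading model, every bounded operator on $Y$ has the form $\alpha I_Y+S$ with $\alpha\in\mathbb{C}$ and $S\in\mathcal{SS}(Y)$, and the product of any two strictly singular operators on $Y$ is compact. *)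

(* Defs.v *)
From HB Require Import structures.
From mathcomp Require Import all_boot all_order all_algebra.
From mathcomp Require Import all_classical all_reals all_analysis.
From mathcomp Require Import complex.

Set Implicit Arguments.
Unset Strict Implicit.
Unset Printing Implicit Defensive.

Import Order.TTheory GRing.Theory Num.Theory.
Import numFieldNormedType.Exports.

Local Open Scope classical_set_scope.
Local Open Scope ring_scope.
Local Open Scope complex_scope.

(* A complex Banach space is a [completeNormedModType R[i]] with [R : realType].
   The library norm takes values in [R[i]]; [nrm] is the same norm, read in [R]. *)

Definition nrm (R : realType) (V : normedZmodType R[i]) (x : V) : R :=
  complex.Re `|x|.

Section NormTheory.
Context (R : realType).

Lemma nrmE (V : normedZmodType R[i]) (x : V) : `|x| = (nrm x)%:C.
Proof. by rewrite /nrm (RRe_real (@normr_real _ _ x)). Qed.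

Lemma nrm_ge0 (V : normedZmodType R[i]) (x : V) : 0 <= nrm x.
Proof. by rewrite -lecR -nrmE; apply: normr_ge0. Qed.

Lemma nrm0 (V : normedZmodType R[i]) : nrm (0 : V) = 0.
Proof. by rewrite /nrm normr0. Qed.

Lemma nrm_triangle (V : normedZmodType R[i]) (x y : V) :
  nrm (x + y) <= nrm x + nrm y.
Proof. by rewrite -lecR rmorphD/= -!nrmE ler_normD. Qed.

Lemma nrm_eq0 (V : normedZmodType R[i]) (x : V) : nrm x = 0 -> x = 0.
Proof. by move=> h; apply/normr0_eq0; rewrite nrmE h. Qed.

Lemma nrmZ (V : normedModType R[i]) (a : R[i]) (x : V) :
  nrm (a *: x) = nrm a * nrm x.
Proof.
by have /(congr1 (@complex.Re R)) := normrZ a x; rewrite !nrmE -rmorphM.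
Qed.

Lemma nrmM (a b : R[i]) : nrm (a * b) = nrm a * nrm b.
Proof.
by have /(congr1 (@complex.Re R)) := normrM a b; rewrite !nrmE -rmorphM.
Qed.

Lemma nrm_real (r : R) : 0 <= r -> nrm (r%:C : R[i]) = r.
Proof. by move=> r0; rewrite /nrm ger0_norm ?lecR. Qed.

End NormTheory.

(* A closed subspace [W] coerces to the Banach space [cs_space W] it carries, so
   that every notion below applies to it; [cs_val] is the inclusion. *)

Record closedSubspace (R : realType) (V : completeNormedModType R[i]) :=
  ClosedSubspace {
    cs_set : set V;
    cs_submod : submod_closed (fun x : V => x \in cs_set);
    cs_closed : closed cs_set }.

Section ClosedSubspaceType.
Context (R : realType) (V : completeNormedModType R[i]) (W : closedSubspace V).

Definition cs_pred : {pred V} := fun x => x \in cs_set W.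

Lemma cs_pred_submod : submod_closed cs_pred.
Proof. exact: cs_submod. Qed.

HB.instance Definition _ :=
  GRing.isSubmodClosed.Build R[i] V cs_pred cs_pred_submod.

Record cs_sort := CsSort { cs_val : V; cs_valP : cs_val \in cs_pred }.

HB.instance Definition _ := [isSub for cs_val].
HB.instance Definition _ := [Choice of cs_sort by <:].
HB.instance Definition _ := [SubChoice_isSubLmodule of cs_sort by <:].

Definition cs_norm (x : cs_sort) : R[i] := `|val x|.

Lemma cs_normD (x y : cs_sort) : cs_norm (x + y) <= cs_norm x + cs_norm y.
Proof. by rewrite /cs_norm raddfD/= ler_normD. Qed.

Lemma cs_normZ (a : R[i]) (x : cs_sort) : cs_norm (a *: x) = `|a| * cs_norm x.
Proof. by rewrite /cs_norm linearZ/= normrZ. Qed.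

Lemma cs_norm_eq0 (x : cs_sort) : cs_norm x = 0 -> x = 0.
Proof. by move/normr0_eq0 => h; apply: val_inj; rewrite h raddf0. Qed.

HB.instance Definition _ :=
  Lmodule_isNormed.Build R[i] cs_sort cs_normD cs_normZ cs_norm_eq0.

Lemma cs_complete (F : set_system cs_sort) : ProperFilter F -> cauchy F -> cvg F.
Proof.
move=> FF /cauchy_ballP Fc.
have FP : ProperFilter (val @ F) by apply: fmap_proper_filter.
have : cauchy ((val : cs_sort -> V) @ F).
  apply/cauchy_ballP => e e0; have := Fc e e0.
  move=> [[P Q]] /= [FP1 FQ] PQ.
  exists (val @` P, val @` Q); first by split => /=; [move: FP1|move: FQ];
    apply: filterS => x Px; exists x.
  case=> _ _ [] /= [x Px <-] [y Qy <-].
  have := PQ (x, y) (conj Px Qy).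
  by rewrite -!ball_normE /ball_ /= /Num.norm/= /cs_norm raddfB.
move=> /cauchy_cvg/cvg_ex[l Fl].
have Wl : l \in cs_pred.
  apply/mem_set; apply: (closed_cvg _ (@cs_closed _ _ W) _ _ Fl) => //.
  by apply: nearW => x; have /set_mem := cs_valP x.
apply/cvg_ex; exists (CsSort Wl).
apply/cvgrPdist_lt => e e0.
have /cvgrPdist_lt/(_ e e0) := Fl.
apply: filterS => x /=.
by rewrite [in X in _ -> X]/Num.norm/= /cs_norm raddfB.
Qed.

HB.instance Definition _ := Uniform_isComplete.Build cs_sort cs_complete.

End ClosedSubspaceType.

Coercion cs_space (R : realType) (V : completeNormedModType R[i])
  (W : closedSubspace V) : completeNormedModType R[i] := cs_sort W.

Section Operators.
Context (R : realType) (V W : normedModType R[i]).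

Definition bounded_op (f : V -> W) : Prop :=
  exists M : R, forall x, nrm (f x) <= M * nrm x.

Definition op_norm (f : V -> W) : R :=
  sup [set nrm (f x) | x in [set x : V | nrm x <= 1]].

Lemma op_norm_has_sup (f : V -> W) : bounded_op f ->
  has_sup [set nrm (f x) | x in [set x : V | nrm x <= 1]].
Proof.
move=> [M fM]; split; first by exists (nrm (f 0)); exists 0; rewrite //= nrm0 ler01.
exists (Num.max M 0) => _ [x /= x1 <-].
apply: (le_trans (fM x)); apply: (@le_trans _ _ (Num.max M 0 * nrm x)).
  by rewrite ler_wpM2r ?nrm_ge0// le_max lexx.
by rewrite ler_piMr// le_max lexx orbT.
Qed.

Lemma op_norm_ge0 (f : V -> W) : bounded_op f -> 0 <= op_norm f.
Proof.
move=> bf; apply: (@le_trans _ _ (nrm (f 0))); first exact: nrm_ge0.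
by apply: (sup_upper_bound (op_norm_has_sup bf)); exists 0; rewrite //= nrm0 ler01.
Qed.

Lemma op_norm_le (f : V -> W) (M : R) : bounded_op f ->
  (forall x, nrm x <= 1 -> nrm (f x) <= M) -> op_norm f <= M.
Proof.
move=> /op_norm_has_sup [h _] fM; apply: ge_sup => // _ [x /= x1 <-].
exact: fM.
Qed.

Lemma op_norm_ball (f : V -> W) (x : V) : bounded_op f -> nrm x <= 1 ->
  nrm (f x) <= op_norm f.
Proof.
by move=> bf x1; apply: (sup_upper_bound (op_norm_has_sup bf)); exists x.
Qed.

End Operators.

Section Dual.
Context (R : realType) (V : normedModType R[i]).

Definition dual_pred : {pred (V -> R[i]^o)} :=
  fun f => `[< linear f /\ bounded_op f >].

Lemma dual_pred_submod : submod_closed dual_pred.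
Proof.
split; first apply/asboolP; first split.
- by move=> a x y; exact: (esym (etrans (addr0 _) (scaler0 _ a))).
- by exists 0 => x; rewrite mul0r (nrm0 R[i]^o).
move=> a f g /asboolP[lf [M fM]] /asboolP[lg [N gN]]; apply/asboolP; split.
  move=> b x y; rewrite !fctE lf lg !scalerDr !scalerA (mulrC a b).
  by rewrite addrACA.
exists (nrm a * M + N) => x; rewrite !fctE mulrDl.
rewrite (le_trans (nrm_triangle _ _))// lerD//.
by rewrite nrmZ -mulrA ler_wpM2l ?nrm_ge0.
Qed.

HB.instance Definition _ :=
  GRing.isSubmodClosed.Build R[i] (V -> R[i]^o) dual_pred dual_pred_submod.

Record dual := Dual { dual_fun :> V -> R[i]^o; dualP : dual_fun \in dual_pred }.

HB.instance Definition _ := [isSub for dual_fun].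
HB.instance Definition _ := [Choice of dual by <:].
HB.instance Definition _ := [SubChoice_isSubLmodule of dual by <:].

Lemma dual_linear (f : dual) : linear f.
Proof. by case: f => f /= /asboolP[]. Qed.

Lemma dual_bounded (f : dual) : bounded_op f.
Proof. by case: f => f /= /asboolP[]. Qed.

Definition dual_norm (f : dual) : R[i] := (op_norm f)%:C.

Lemma dual_normD (f g : dual) : dual_norm (f + g) <= dual_norm f + dual_norm g.
Proof.
rewrite /dual_norm -rmorphD/= lecR; apply: op_norm_le; first exact: (dual_bounded (f + g)).
move=> x x1; apply: (le_trans (nrm_triangle (f x) (g x))).
by apply: lerD; apply: op_norm_ball => //; exact: dual_bounded.
Qed.

Lemma dual_normZ (a : R[i]) (f : dual) : dual_norm (a *: f) = `|a| * dual_norm f.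
Proof.
have le b (g : dual) : op_norm (b *: g : dual) <= nrm b * op_norm g.
  apply: op_norm_le => [|x x1]; first exact: dual_bounded.
  rewrite (_ : (b *: g : dual) x = b *: g x)// nrmZ.
  by rewrite ler_wpM2l ?nrm_ge0 ?op_norm_ball//; exact: dual_bounded.
rewrite /dual_norm nrmE -rmorphM/=; congr (_%:C); apply/eqP.
rewrite eq_le le/=; have [->|a0] := eqVneq a 0.
  by rewrite nrm0 mul0r op_norm_ge0//; exact: (dual_bounded (0 *: f)).
have na : 0 < nrm a.
  by rewrite lt_neqAle nrm_ge0 andbT eq_sym; apply: contra a0 => /eqP/nrm_eq0 ->.
have := le a^-1 (a *: f); rewrite scalerA mulVf// scale1r => /(ler_wpM2l (ltW na)).
by rewrite mulrA -nrmM divff// {2}/nrm normr1 mul1r.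
Qed.

Lemma dual_norm_eq0 (f : dual) : dual_norm f = 0 -> f = 0.
Proof.
move=> /(congr1 (@complex.Re R))/= f0; apply: val_inj; apply/funext => x /=.
have lf := dual_linear f.
have fZ (a : R[i]) (y : V) : f (a *: y) = a *: f y.
  have f00 : f 0 = 0 by have := lf (-1) 0 0; rewrite scaleN1r oppr0 addr0 scaleN1r addNr.
  by have := lf a y 0; rewrite !addr0 f00 addr0.
apply: nrm_eq0; apply/eqP; rewrite eq_le nrm_ge0 andbT.
have [->|x0] := eqVneq x 0.
  by have := fZ 0 0; rewrite !scale0r => ->; rewrite nrm0.
have nx : 0 < nrm x.
  by rewrite lt_neqAle nrm_ge0 andbT eq_sym; apply: contra x0 => /eqP/nrm_eq0 ->.
pose c : R[i] := ((nrm x)^-1)%:C.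
have nc : nrm c = (nrm x)^-1 by rewrite nrm_real// invr_ge0 ltW.
have := @op_norm_ball _ _ _ f (c *: x) (dual_bounded f).
rewrite f0 fZ !nrmZ nc mulVf ?gt_eqF// => /(_ (lexx _)).
by rewrite pmulr_rle0// invr_gt0.
Qed.

HB.instance Definition _ :=
  Lmodule_isNormed.Build R[i] dual dual_normD dual_normZ dual_norm_eq0.

End Dual.

Section Ell1.
Context (R : realType).

Definition l1_pred : {pred (nat -> R[i]^o)} :=
  fun a => `[< cvgn (series (fun n => nrm (a n))) >].

Lemma l1_pred_submod : submod_closed l1_pred.
Proof.
split; first apply/asboolP.
  rewrite (_ : (fun n => _) = (fun=> 0)); last by apply/funext => n; exact: nrm0.
  by rewrite /series/=; under eq_fun do rewrite big1//; exact: is_cvg_cst.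
move=> c a b /asboolP ha /asboolP hb; apply/asboolP.
apply: (@series_le_cvg _ _ (fun n => nrm c * nrm (a n) + nrm (b n))).
- by move=> n; rewrite nrm_ge0.
- by move=> n; rewrite addr_ge0 ?mulr_ge0 ?nrm_ge0.
- by move=> n; rewrite !fctE (le_trans (nrm_triangle _ _))// nrmZ.
- exact: (is_cvg_seriesD (@is_cvg_seriesZ _ _ (nrm c) ha) hb).
Qed.

HB.instance Definition _ :=
  GRing.isSubmodClosed.Build R[i] (nat -> R[i]^o) l1_pred l1_pred_submod.

Record l1 := L1 { l1_seq :> nat -> R[i]^o; l1P : l1_seq \in l1_pred }.

HB.instance Definition _ := [isSub for l1_seq].
HB.instance Definition _ := [Choice of l1 by <:].
HB.instance Definition _ := [SubChoice_isSubLmodule of l1 by <:].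

Lemma l1_cvg (a : l1) : cvgn (series (fun n => nrm (a n))).
Proof. by case: a => a /= /asboolP. Qed.

Definition l1_norm (a : l1) : R[i] := (limn (series (fun n => nrm (a n))))%:C.

Lemma l1_normD (a b : l1) : l1_norm (a + b) <= l1_norm a + l1_norm b.
Proof.
have ha := @l1_cvg a; have hb := @l1_cvg b.
rewrite /l1_norm -rmorphD/= lecR -lim_seriesD//.
apply: (lim_series_le (@l1_cvg (a + b)) (is_cvg_seriesD ha hb)) => n.
exact: nrm_triangle.
Qed.

Lemma l1_normZ (c : R[i]) (a : l1) : l1_norm (c *: a) = `|c| * l1_norm a.
Proof.
have ha := @l1_cvg a.
rewrite /l1_norm nrmE -rmorphM/=; congr (_%:C).
rewrite -[RHS](@lim_seriesZ _ _ (nrm c) ha).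
by congr (limn (series _)); apply/funext => n; exact: nrmZ.
Qed.

Lemma l1_norm_eq0 (a : l1) : l1_norm a = 0 -> a = 0.
Proof.
move=> /(congr1 (@complex.Re R))/= a0; apply: val_inj; apply/funext => n /=.
apply: nrm_eq0; apply/eqP; rewrite eq_le nrm_ge0 andbT.
have nd : nondecreasing_seq (series (fun k => nrm (a k))).
  by apply/nondecreasing_seqP => k; rewrite seriesSr lerDl nrm_ge0.
have := nondecreasing_cvgn_le nd (@l1_cvg a) n.+1; rewrite a0.
apply: le_trans; rewrite seriesSr lerDr.
by rewrite /series/= sumr_ge0// => k _; exact: nrm_ge0.
Qed.

HB.instance Definition _ :=
  Lmodule_isNormed.Build R[i] l1 l1_normD l1_normZ l1_norm_eq0.

Lemma l1_unit_subproof (n : nat) :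
  (fun m => (m == n)%:R : R[i]^o) \in l1_pred.
Proof.
apply/asboolP/cvg_ex; exists 1; apply: cvg_near_cst; exists n.+1 => //= m /= nm.
rewrite /series/= (bigD1_seq n) ?mem_index_iota ?iota_uniq//= eqxx.
by rewrite big1 => [|k /negPf ->]; rewrite ?nrm0// addr0 /nrm normr1.
Qed.

Definition l1_unit (n : nat) : l1 := L1 (l1_unit_subproof n).

End Ell1.

Section Notions.
Context (R : realType).
Implicit Types V W : normedModType R[i].

Definition lin_span V (A : set V) : set V :=
  [set x | exists n (c : 'I_n -> R[i]) (v : 'I_n -> V),
    (forall i, A (v i)) /\ x = \sum_i c i *: v i].

Definition infinite_dimensional V : Prop :=
  ~ exists A : set V, finite_set A /\ lin_span A = setT.

Definition separable V : Prop := exists D : set V, countable D /\ dense D.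

Definition reflexive_space V : Prop :=
  forall F : dual (dual V), exists x : V, forall f : dual V, F f = f x.

Definition schauder_basis V (e : nat -> V) : Prop :=
  forall x : V, exists! a : nat -> R[i], series (fun n => a n *: e n) @ \oo --> x.

Definition basic_sequence V (e : nat -> V) : Prop :=
  forall x : V, closure (lin_span (range e)) x ->
    exists! a : nat -> R[i], series (fun n => a n *: e n) @ \oo --> x.

(* Lindenstrauss-Tzafriri: the norm of every functional on the tail spaces
   [e_n, e_{n+1}, ...] tends to 0. *)
Definition shrinking_basis V (e : nat -> V) : Prop :=
  schauder_basis e /\
  forall f : dual V,
    sup [set nrm (f x) | x in
      closure (lin_span [set e i | i in [set i | (n <= i)%N]])
        `&` [set x | nrm x <= 1]] @[n --> \oo] --> (0 : R).

(* The limit runs over n_0 < ... < n_(k-1) with n_0 -> oo, uniformly in the real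
   coefficients a_j of [-1, 1]. *)
Definition generates_spreading_model V W (x : nat -> V) (e : nat -> W) : Prop :=
  [/\ exists M : R, forall n, nrm (x n) <= M,
      basic_sequence e
    & forall (k : nat) (eps : R), 0 < eps ->
        exists N : nat, forall n : 'I_k -> nat,
          (forall i j : 'I_k, (i < j)%N -> (n i < n j)%N) ->
          (forall i, (N <= n i)%N) ->
          forall a : 'I_k -> R, (forall i, -1 <= a i <= 1) ->
            `| nrm (\sum_(j < k) (a j)%:C *: x (n j))
               - nrm (\sum_(j < k) (a j)%:C *: e j) | < eps].

Definition compact_op V W (T : {linear V -> W}) : Prop :=
  compact (closure [set T x | x in [set x : V | nrm x <= 1]]).

Definition isomorphism_onto_range V W (f : V -> W) : Prop :=
  continuous f /\
  exists g : W -> V, cancel f g /\ {within range f, continuous g}.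

Definition strictly_singular (X : completeNormedModType R[i])
    (S : {linear X -> X}) : Prop :=
  bounded_op S /\
  forall Y : closedSubspace X, infinite_dimensional Y ->
    ~ isomorphism_onto_range (fun y : Y => S (cs_val y)).

(* The values of [T] at negative times are irrelevant. *)
Definition C0_semigroup V (T : R -> {linear V -> V}) : Prop :=
  [/\ forall t, 0 <= t -> bounded_op (T t),
      forall x, T 0 x = x,
      forall t s, 0 <= t -> 0 <= s -> forall x, T (t + s) x = T t (T s x)
    & forall x, nrm (T t x - x) @[t --> 0^'+] --> (0 : R)].

Definition uniformly_continuous_semigroup V (T : R -> {linear V -> V}) : Prop :=
  op_norm (fun x => T t x - x) @[t --> 0^'+] --> (0 : R).

Definition lotz V : Prop :=
  forall T : R -> {linear V -> V},
    C0_semigroup T -> uniformly_continuous_semigroup T.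

Definition CAP V : Prop :=
  forall (C : set V) (eps : R), compact C -> 0 < eps ->
    exists K : {linear V -> V}, compact_op K /\
      (ereal_sup [set (nrm (K x - x)%R)%:E | x in C] < eps%:E)%E.

Definition lotz_saturated (E : completeNormedModType R[i]) : Prop :=
  forall Y : closedSubspace E, infinite_dimensional Y ->
    exists Z : closedSubspace Y, infinite_dimensional Z /\ lotz Z.

(* The addition map A x B -> X is a linear homeomorphism. *)
Definition topological_direct_sum (X : completeNormedModType R[i])
    (A B : closedSubspace X) : Prop :=
  let add (p : A * B) : X := cs_val p.1 + cs_val p.2 in
  exists g : X -> A * B, [/\ cancel add g, cancel g add & continuous g].

Definition hereditarily_indecomposable (X : completeNormedModType R[i]) : Prop :=
  ~ exists (Y : closedSubspace X) (A B : closedSubspace Y),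
      [/\ infinite_dimensional Y, infinite_dimensional A,
          infinite_dimensional B & topological_direct_sum A B].

Definition no_reflexive_subspace (X : completeNormedModType R[i]) : Prop :=
  forall Y : closedSubspace X, infinite_dimensional Y -> ~ reflexive_space Y.

(* The spaces enter only through the following properties of the Argyros-Motakis
   construction, which are taken as given; AM_subspace_properties are those
   inherited by every infinite-dimensional closed subspace. *)

Definition AM_subspace_properties (X : completeNormedModType R[i]) : Prop :=
  forall Y : closedSubspace X, infinite_dimensional Y ->
  [/\ exists x : nat -> Y, (forall n, nrm (x n) = 1) /\
        generates_spreading_model x (@l1_unit R),
      forall T : {linear Y -> Y}, bounded_op T ->
        exists (alpha : R[i]) (S : {linear Y -> Y}),
          strictly_singular S /\ forall y, T y = alpha *: y + S y
    & forall S1 S2 : {linear Y -> Y},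
        strictly_singular S1 -> strictly_singular S2 -> compact_op (S1 \o S2)].

Definition AM_tree_space (X : completeNormedModType R[i]) : Prop :=
  [/\ infinite_dimensional X, separable X, reflexive_space X,
      hereditarily_indecomposable X & exists e : nat -> X, schauder_basis e]
  /\ AM_subspace_properties X.

Definition AM_universal_space (X : completeNormedModType R[i]) : Prop :=
  [/\ infinite_dimensional X, separable X, hereditarily_indecomposable X,
      exists e : nat -> X, shrinking_basis e & no_reflexive_subspace X]
  /\ AM_subspace_properties X.

End Notions.

Definition is_tree (A : Type) (T : set (seq A)) : Prop :=
  forall s t : seq A, T (s ++ t) -> T s.

Definition well_founded_tree (A : Type) (T : set (seq A)) : Prop :=
  is_tree T /\ ~ exists b : nat -> A, forall n, T (mkseq b n).

(* Main.v *)
From HB Require Import structures.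
Require Import Defs.
From mathcomp Require Import all_boot all_order all_algebra.
From mathcomp Require Import all_classical all_reals all_analysis.
From mathcomp Require Import complex finmap.
From mathcomp Require Import ring lra.

(** Two facts make the spaces Lotz-saturated: a Banach space [Z] on which every
    operator is a scalar plus an operator with compact square has the Lotz
    property as soon as it fails the compact approximation property (CAP), and
    every infinite-dimensional subspace contains such a [Z] failing the CAP.

    For the first fact ([lotz_of_not_CAP]) let [T] be a strongly continuous
    semigroup and let [A_h] be the mean of its orbits over [0, h], so that
    [(T t - 1) A_h] tends to [0] in norm. Write [A_h = alpha + S] with [S S]
    compact. If [alpha] is nonzero for some [h], then
    [alpha^2 = A_h (alpha - S) + S S], and [T t - 1] tends to [0] in norm on both
    terms, because pointwise convergence is uniform on compact sets: the semigroup
    is uniformly continuous. If [alpha] vanishes for all small [h], the operators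
    [A_h A_h = S S] are compact and tend to the identity, which is the CAP.

    The second fact is a construction in the manner of Szankowski. The l1
    spreading models give, inside any infinite-dimensional subspace, blocks
    spanned by copies of l1^N of any size. Since the kernel of finitely many
    functionals again contains such blocks, they can be chosen so that every block
    lies in the kernel of a finite norming set for the preceding ones; the block
    projections are then uniformly bounded, and by Hahn-Banach each bounded
    assignment of values on one block, extended by zero, is a functional of norm
    at most 16 ([l1_blocks], [block_functional]). Block [n] is indexed by triples
    [(q, l, s)] where [q] is a binary string of length [n] and [l], [s] are bits.
    For each of the four pairs [(l, s)] a basis [e_(i, l, s)] is obtained from the
    unit vectors by a Walsh transform in all positions except those of one colour;
    the colours of the pairs, and those of neighbouring blocks, are distinct. The
    subspace is spanned by the vectors
    [z_(i, l) = e_(i, l, 0) - e_(i, l, 1) + sum_(l', s') e_((i, l), l', s')],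
    the last sum lying in the next block. The coordinate functional of a [z] can
    be read on either of the two blocks it meets. Comparing the two readings, the
    difference of the mean traces of an operator [T] on two consecutive blocks
    becomes an average of terms [e*_(i, l, s) (T y)] in which [y] does not involve
    [e_(i, l, s)]. A further Walsh transform, now in the positions of the colour
    of [(l, s)], keeps the functionals bounded and, as the colours are distinct,
    turns the [m] vectors [y] into vectors that are no larger than one of them.
    This gains a factor [1/m] ([mix_sum], [nrm_mix_yv]), and [m] grows
    exponentially with the block. Hence the mean traces converge to a functional
    that is controlled by a compact set, equals [1] at the identity and vanishes
    at compact operators, and the CAP fails ([not_CAP_of_trace]).

    That the whole spaces are not Lotz follows from their Schauder bases: Abel
    summation makes the diagonal semigroup with symbols [exp (- k t)] strongly
    continuous, and it is not uniformly continuous ([schauder_basis_not_lotz]).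
    Separability, reflexivity, indecomposability and the absence of reflexive
    subspaces pass from the spaces to all of their closed subspaces. *)

Set Implicit Arguments.
Unset Strict Implicit.
Unset Printing Implicit Defensive.

Import Order.TTheory GRing.Theory Num.Theory.
Import numFieldNormedType.Exports.

Local Open Scope classical_set_scope.
Local Open Scope ring_scope.
Local Open Scope complex_scope.

(** * The real-valued norm of a complex normed space *)

Section NrmBasics.
Context (R : realType).
Implicit Types V W : normedModType R[i].

Lemma nrmN V (x : V) : nrm (- x) = nrm x.
Proof. by rewrite /nrm normrN. Qed.

Lemma nrm_distC V (x y : V) : nrm (x - y) = nrm (y - x).
Proof. by rewrite -nrmN opprB. Qed.

Lemma nrm_triangleB V (x y : V) : nrm (x - y) <= nrm x + nrm y.
Proof. by rewrite -(nrmN y) nrm_triangle. Qed.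

Lemma nrm_triangle3 V (z x y : V) : nrm (x - y) <= nrm (x - z) + nrm (z - y).
Proof. by rewrite -[x - y](subrKA z) nrm_triangle. Qed.

Lemma nrm_subr V (x y : V) : nrm x - nrm y <= nrm (x - y).
Proof. by rewrite lerBlDr -{1}(subrK y x) nrm_triangle. Qed.

Lemma nrm_sum V (I : Type) (r : seq I) (P : pred I) (f : I -> V) :
  nrm (\sum_(i <- r | P i) f i) <= \sum_(i <- r | P i) nrm (f i).
Proof.
elim/big_ind2 : _ => [|x1 x2 y1 y2 h1 h2|//]; first by rewrite nrm0.
by rewrite (le_trans (nrm_triangle _ _))// lerD.
Qed.

Lemma nrm1 : nrm (1 : R[i]) = 1.
Proof. by rewrite /nrm normr1. Qed.

Lemma nrmC (r : R) : nrm (r%:C : R[i]) = `|r|.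
Proof. by rewrite /nrm normc_def /= expr0n addr0 sqrtr_sqr. Qed.

Lemma nrmi : nrm ('i : R[i]) = 1.
Proof. by rewrite /nrm normc_def/= expr0n expr1n add0r sqrtr1. Qed.

Lemma nrmNi : nrm (- 'i : R[i]) = 1.
Proof. by rewrite /nrm normrN -/(nrm _) nrmi. Qed.

Lemma nrm_gt0 V (x : V) : x != 0 -> 0 < nrm x.
Proof.
by move=> x0; rewrite lt_neqAle nrm_ge0 andbT eq_sym; apply: contra x0 => /eqP/nrm_eq0->.
Qed.

Lemma nrmV (a : R[i]) : a != 0 -> nrm a^-1 = (nrm a)^-1.
Proof.
move=> a0; have na := nrm_gt0 (a0 : (a : R[i]^o) != 0).
by apply: (mulfI (lt0r_neq0 na)); rewrite -nrmM !divff// ?nrm1// lt0r_neq0.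
Qed.

Lemma Re_le_nrm (a : R[i]) : `|complex.Re a| <= nrm a.
Proof. by rewrite -lecR -nrmE normc_ge_Re. Qed.

Lemma posC (e : R[i]) : 0 < e -> e = (complex.Re e)%:C /\ 0 < complex.Re e.
Proof. by case: e => a b /=; rewrite ltcE/= => /andP[/eqP-> ->]. Qed.

Lemma cvg_nrmP (T : Type) (F : set_system T) {FF : Filter F} V (f : T -> V) (l : V) :
  f @ F --> l <-> forall e : R, 0 < e -> \forall x \near F, nrm (l - f x) < e.
Proof.
split=> [/cvgrPdist_lt h e e0|h].
  by have := h e%:C; rewrite ltcR => /(_ e0); apply: filterS => x; rewrite nrmE ltcR.
apply/cvgrPdist_lt => e /posC[-> e0]; have := h _ e0.
by apply: filterS => x; rewrite nrmE ltcR.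
Qed.

Lemma cvg_nrm_lt (T : Type) (F : set_system T) {FF : Filter F} V (f : T -> V) (l : V)
  (e : R) : f @ F --> l -> 0 < e -> \forall x \near F, nrm (l - f x) < e.
Proof. by move=> /cvg_nrmP; apply. Qed.

Lemma nrm_lt_cvg (T : Type) (F : set_system T) {FF : Filter F} V (f : T -> V) (l : V) :
  (forall e : R, 0 < e -> \forall x \near F, nrm (l - f x) < e) -> f @ F --> l.
Proof. by move=> h; apply/cvg_nrmP. Qed.

Lemma nrm_lim_le (T : Type) (F : set_system T) {FF : ProperFilter F} V (f : T -> V)
    (l : V) (M : R) :
  f @ F --> l -> (\forall x \near F, nrm (f x) <= M) -> nrm l <= M.
Proof.
move=> /cvg_nrmP fl fM; apply/ler_addgt0Pr => e e0.
have [x [h1 h2]] := filter_ex (filterI fM (fl e e0)).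
by rewrite -(subrK (f x) l) (le_trans (nrm_triangle _ _))// addrC lerD// ltW.
Qed.

Lemma cvg_uniq (T : Type) (F : set_system T) {FF : ProperFilter F} V (f : T -> V)
  (l l' : V) : f @ F --> l -> f @ F --> l' -> l = l'.
Proof. exact: norm_cvg_unique. Qed.

Lemma cauchy_nrm (X : completeNormedModType R[i]) (u : nat -> X) :
  (forall e : R, 0 < e -> exists N, forall n, (N <= n)%N -> nrm (u n - u N) < e) ->
  exists l : X, u @ \oo --> l.
Proof.
move=> h; suff : cauchy (u @ \oo) by move=> /cauchy_cvg/cvg_ex.
apply: cauchy_exP => e /posC[-> e0].
have [N hN] := h _ e0; exists (u N); exists N => //= n /hN.
by rewrite -ball_normE/= nrmE ltcR nrm_distC.
Qed.

Lemma bounded_op_cvg (T : Type) (F : set_system T) {FF : Filter F} V W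
    (g : {linear V -> W}) (f : T -> V) l :
  bounded_op g -> f @ F --> l -> (fun t => g (f t)) @ F --> g l.
Proof.
move=> [M gM] /cvg_nrmP fl; apply/cvg_nrmP => e e0.
have M1 : 0 < `|M| + 1 by rewrite ltr_wpDl.
have := fl (e / (`|M| + 1)); rewrite divr_gt0// => /(_ isT).
apply: filterS => x h; rewrite -linearB (le_lt_trans (gM _))//.
rewrite ltr_pdivlMr// in h; apply: le_lt_trans h; rewrite mulrC ler_wpM2l ?nrm_ge0//.
by rewrite (le_trans (ler_norm M))// lerDl.
Qed.

Lemma bounded_op_ge0 V W (f : V -> W) : bounded_op f ->
  exists M : R, 0 < M /\ forall x, nrm (f x) <= M * nrm x.
Proof.
move=> [M fM]; exists (`|M| + 1); split; first by rewrite ltr_wpDl.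
move=> x; rewrite (le_trans (fM x))// ler_wpM2r ?nrm_ge0//.
by rewrite (le_trans (ler_norm M))// lerDl.
Qed.

Lemma nrm_closedP V (A : set V) (x : V) :
  closure A x <-> forall e : R, 0 < e -> exists y, A y /\ nrm (x - y) < e.
Proof.
split=> [clA e e0|h B].
  have /clA[y [Ay +]] : nbhs x (ball x e%:C) by apply: nbhsx_ballx; rewrite ltcR.
  by rewrite -ball_normE/= nrmE ltcR; exists y.
move=> /nbhs_ballP[e /= /posC[-> e0]] eB; have [y [Ay xy]] := h _ e0.
by exists y; split=> //; apply: eB; rewrite -ball_normE/= nrmE ltcR.
Qed.

Lemma nrm_op_norm V W (f : {linear V -> W}) x : bounded_op f ->
  nrm (f x) <= op_norm f * nrm x.
Proof.
move=> bf; have [->|x0] := eqVneq x 0.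
  by rewrite linear0 !nrm0 mulr0.
have nx := nrm_gt0 x0.
have nc : nrm (((nrm x)^-1)%:C : R[i]) = (nrm x)^-1.
  by rewrite nrm_real// invr_ge0 ltW.
have := @op_norm_ball _ _ _ f ((((nrm x)^-1)%:C) *: x) bf.
rewrite nrmZ nc mulVf ?lt0r_neq0// => /(_ (lexx _)).
by rewrite linearZ nrmZ nc ler_pdivrMl// mulrC.
Qed.

End NrmBasics.

(** * The complex Hahn-Banach theorem *)

Section RealHahnBanach.
Context (R : realType) (V : normedModType R[i]) (M : R).
Hypothesis M0 : 0 <= M.

Let good (G : set (V * R)) :=
  (forall a p q, G p -> G q -> G (a%:C *: p.1 + q.1, a * p.2 + q.2)) /\
  (forall p, G p -> p.2 <= M * nrm p.1).

(** One step of the extension: the value at the new vector is chosen between the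
    two families of bounds that the graph imposes on it. *)
Lemma good_graph_extend (G : set (V * R)) (x0 : V) : good G -> G (0, 0) ->
  exists G', [/\ good G', G `<=` G' & exists r, G' (x0, r)].
Proof.
move=> [Gl Gb] G0.
pose E := [set p.2 - M * nrm (p.1 - x0) | p in G].
have ub p q : G p -> G q -> p.2 - M * nrm (p.1 - x0) <= M * nrm (q.1 + x0) - q.2.
  move=> Gp Gq; rewrite lerBlDr addrAC lerBrDr.
  have := Gb _ (Gl 1 _ _ Gp Gq); rewrite scale1r mul1r /= => /le_trans -> //.
  rewrite -mulrDr ler_wpM2l// -[p.1 + q.1](subrKA x0) [x0 + q.1]addrC.
  by rewrite [leRHS]addrC nrm_triangle.
have hE : has_sup E.
  split; first by eexists; exists (0, 0).
  by eexists => _ [p Gp <-]; apply: (ub _ _ Gp G0).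
pose al := sup E.
have al1 p : G p -> p.2 - M * nrm (p.1 - x0) <= al.
  by move=> Gp; apply: (sup_upper_bound hE); exists p.
have al2 p : G p -> al <= M * nrm (p.1 + x0) - p.2.
  move=> Gp; apply: ge_sup; first exact: (proj1 hE).
  by move=> _ [q Gq <-]; exact: ub.
exists [set q | exists p t, G p /\ q = (p.1 + t%:C *: x0, p.2 + t * al)]; split; first split.
- move=> a _ _ [p [t [Gp ->]]] [q [s [Gq ->]]] /=.
  exists (a%:C *: p.1 + q.1, a * p.2 + q.2), (a * t + s); split; first exact: Gl.
  rewrite /= rmorphD rmorphM/= scalerDr !scalerDl !scalerA mulrDr mulrDl !mulrA.
  by congr pair; rewrite -!addrA; congr (_ + _); rewrite addrCA.
- move=> _ [p [t [Gp ->]]] /=.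
  have Gs a : G (a%:C *: p.1, a * p.2) by have := Gl a _ _ Gp G0; rewrite /= !addr0.
  have tV (s : R) (v : V) : 0 < s -> s%:C *: (s^-1%:C *: v) = v.
    by move=> s0; rewrite scalerA -rmorphM divff ?gt_eqF// rmorph1 scale1r.
  have [t0|t0|->] := ltgtP t 0; last by rewrite mul0r scale0r !addr0 Gb.
  + have nt0 : 0 < - t by rewrite oppr_gt0.
    have /= := al1 _ (Gs (- t)^-1).
    rewrite -(ler_pM2l nt0) mulrBr mulrA divff ?gt_eqF// mul1r mulrCA.
    rewrite -[X in M * (X * _)](@nrm_real R) ?(ltW nt0)// -nrmZ scalerBr tV//.
    rewrite rmorphN/= scaleNr opprK => h.
    by rewrite mulNr in h; lra.
  + have /= := al2 _ (Gs t^-1).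
    rewrite -(ler_pM2l t0) mulrBr mulrCA [t * (t^-1 * _)]mulrA divff ?gt_eqF// mul1r.
    rewrite -[X in M * (X * _)](@nrm_real R) ?(ltW t0)// -nrmZ scalerDr tV//.
    by lra.
- by move=> p Gp; exists p, 0; split=> //; rewrite scale0r mul0r !addr0; case: p {Gp}.
- by exists al; exists (0, 0), 1; split=> //=; rewrite scale1r mul1r !add0r.
Qed.

(** Partial functionals are handled as graphs that are closed under real linear
    combinations and bounded by the norm; such a graph is automatically
    single-valued, so Zorn's lemma applies to inclusion of graphs. *)
Lemma real_hahn_banach (G0 : set (V * R)) : good G0 -> G0 (0, 0) ->
  exists f : V -> R, [/\ forall a x y, f (a%:C *: x + y) = a * f x + f y,
    forall x, f x <= M * nrm x & forall p, G0 p -> f p.1 = p.2].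
Proof.
move=> gG0 G00.
have [|G [gG Gmax]] := @Zorn_bigcup _ (fun G => good (G `|` G0)).
  move=> F FP Ftot; split.
    move=> a p q [[X FX Xp]|G0p] [[Y FY Yq]|G0q].
    - have [XY|YX] := Ftot _ _ FX FY.
      + by have [|h] := (FP _ FY).1 a p q (or_introl (XY _ Xp)) (or_introl Yq);
          [left; exists Y|right].
      + by have [|h] := (FP _ FX).1 a p q (or_introl Xp) (or_introl (YX _ Yq));
          [left; exists X|right].
    - by have [|h] := (FP _ FX).1 a p q (or_introl Xp) (or_intror G0q);
          [left; exists X|right].
    - by have [|h] := (FP _ FY).1 a p q (or_intror G0p) (or_introl Yq);
          [left; exists Y|right].
    - by right; apply: gG0.1.
  move=> p [[X FX Xp]|]; last exact: gG0.2.
  by apply: (FP _ FX).2; left.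
set H := G `|` G0 in gG.
have H0 : H (0, 0) by right.
have tot x : exists r, H (x, r).
  apply: contrapT => nx; have [G' [gG' HG' [r G'x]]] := good_graph_extend x gG H0.
  apply: (Gmax G'); last by rewrite setUidl//; apply: subset_trans HG' => p; right.
  split; first by apply: subset_trans HG' => p; left.
  by move=> G'G; apply: nx; exists r; left; apply: G'G.
have [f fH] := choice tot.
have uniq x r s : H (x, r) -> H (x, s) -> r = s.
  move=> xr xs; apply/eqP; rewrite eq_le.
  have := gG.2 _ (gG.1 (-1) _ _ xr xs); have := gG.2 _ (gG.1 (-1) _ _ xs xr) => /=.
  rewrite rmorphN/= scaleN1r addNr nrm0 mulr0 !mulN1r => h1 h2.
  by apply/andP; split; lra.
exists f; split=> [a x y|x|[x r] h].
- by apply: (uniq (a%:C *: x + y)) => //; apply: (gG.1 a (x, f x) (y, f y)).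
- exact: (gG.2 (x, f x)).
- by apply: (uniq x) => //; right.
Qed.

End RealHahnBanach.

Section HahnBanach.
Context (R : realType).

Lemma dual_of (V : normedModType R[i]) (M : R) (f : V -> R[i]^o) :
  linear f -> (forall x, nrm (f x) <= M * nrm x) ->
  exists F : dual V, forall x, F x = f x.
Proof.
move=> lf bf.
have h : f \in @dual_pred R V by apply/asboolP; split=> //; exists M.
by exists (Dual h).
Qed.

Lemma dualZ (V : normedModType R[i]) (f : dual V) a x : f (a *: x) = a * f x.
Proof.
have f00 : f 0 = 0.
  by have := dual_linear f (-1) 0 0; rewrite scaleN1r oppr0 addr0 scaleN1r addNr.
by have := dual_linear f a x 0; rewrite !addr0 f00 addr0.
Qed.

Lemma dualD (V : normedModType R[i]) (f : dual V) x y : f (x + y) = f x + f y.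
Proof. by have := dual_linear f 1 x y; rewrite !scale1r. Qed.

(** The real part of the partial functional is extended first and determines the
    extension as [f x - i f (i x)]; a rotation carries the bound on the real
    part over to the modulus. *)
Theorem hahn_banach (V : normedModType R[i]) (M : R) (H : set (V * R[i])) :
  0 <= M -> H (0, 0) ->
  (forall a p q, H p -> H q -> H (a *: p.1 + q.1, a * p.2 + q.2)) ->
  (forall p, H p -> nrm p.2 <= M * nrm p.1) ->
  exists F : dual V, (forall p, H p -> F p.1 = p.2) /\
    forall x, nrm (F x) <= M * nrm x.
Proof.
move=> M0 H0 Hl Hb.
have [||f [flin fM fH]] := @real_hahn_banach R V M M0
    [set q | exists p, H p /\ q = (p.1, complex.Re p.2)].
- split=> [a _ _ [p [Hp ->]] [q [Hq ->]]|_ [p [Hp ->]]] /=.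
    exists (a%:C *: p.1 + q.1, a%:C * p.2 + q.2); split; first exact: Hl.
    by congr pair; case: (p.2) (q.2) => [u v] [u' v'] /=; rewrite mul0r subr0.
  by apply: le_trans (Hb _ Hp); apply: le_trans (ler_norm _) (Re_le_nrm _).
- by exists (0, 0).
have fD x y : f (x + y) = f x + f y.
  by have := flin 1 x y; rewrite scale1r mul1r.
have f0 : f 0 = 0 by have := fD 0 0; rewrite addr0; lra.
have fZ a x : f (a%:C *: x) = a * f x by have := flin a x 0; rewrite f0 !addr0.
pose g x : R[i]^o := (f x) +i* (- f ('i *: x)).
have iaE (a b : R) (x : V) : (a +i* b) *: x = a%:C *: x + b%:C *: ('i *: x).
  by rewrite scalerA -scalerDl; congr (_ *: _); simpc.
have gD x y : g (x + y) = g x + g y.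
  by rewrite /g scalerDr !fD opprD.
have gZ c x : g (c *: x) = c * g x.
  case: c => a b; rewrite /g; rewrite [in X in _ +i* X]scalerA.
  have -> : 'i * (a +i* b) = (- b) +i* a :> R[i] by simpc.
  rewrite (iaE a b) (iaE (- b) a) !fD !fZ; move: (f x) (f _) => u v.
  by apply/eqP; rewrite eq_complex /=; apply/andP; split; apply/eqP; ring.
have [F FE] : exists F : dual V, forall x, F x = g x.
  apply: (@dual_of V (M + M)) => [a x y|x]; first by rewrite gD gZ.
  have fabs y : `|f y| <= M * nrm y.
    rewrite ler_norml fM andbT lerNl.
    by have := fM (- y); rewrite nrmN -scaleN1r -[-1](rmorphN1 (real_complex R)) fZ mulN1r.
  have -> : g x = (f x)%:C + 'i * (- f ('i *: x))%:C by simpc.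
  rewrite (le_trans (nrm_triangle _ _))// mulrDl lerD// ?nrmM !nrmC//.
  rewrite nrmi mul1r normrN.
  have := fabs ('i *: x); rewrite nrmZ.
  by rewrite nrmi mul1r.
exists F; split=> [p Hp|x].
  rewrite FE /g.
  have -> : f p.1 = complex.Re p.2 by apply: (fH (p.1, _)); exists p.
  have -> : f ('i *: p.1) = complex.Re ('i * p.2).
    apply: (fH ('i *: p.1, _)); exists ('i *: p.1, 'i * p.2); split=> //.
    by have := Hl 'i _ _ Hp H0; rewrite !addr0.
  by case: (p.2) => u v /=; congr (_ +i* _); rewrite mul0r mul1r sub0r opprK.
have [Fx0|Fx0] := eqVneq (F x : R[i]) 0; first by rewrite Fx0 nrm0 mulr_ge0 ?nrm_ge0.
pose th : R[i] := (nrm (F x))%:C / F x.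
have nth : nrm th = 1.
  by rewrite /th nrmM nrmV// nrmC ger0_norm ?nrm_ge0// divff// lt0r_neq0// nrm_gt0.
have : F (th *: x) = (nrm (F x))%:C by rewrite dualZ /th divfK.
rewrite FE => /(congr1 (@complex.Re R)) /= h.
by rewrite -h (le_trans (fM _))// nrmZ nth mul1r.
Qed.

End HahnBanach.

(** * Norming, separation and extension; reflexivity of closed subspaces *)

Section HahnBanachCorollaries.
Context (R : realType).

Lemma dualB (V : normedModType R[i]) (f : dual V) x y : f (x - y) = f x - f y.
Proof. by rewrite -scaleN1r dualD dualZ mulN1r. Qed.

Lemma dual0 (V : normedModType R[i]) (f : dual V) : f 0 = 0.
Proof. by rewrite -(subrr 0) dualB subrr. Qed.

Lemma dual_sum (V : normedModType R[i]) (f : dual V) (I : Type) (r : seq I)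
  (P : pred I) (g : I -> V) : f (\sum_(i <- r | P i) g i) = \sum_(i <- r | P i) f (g i).
Proof. by apply: (big_morph f); [exact: dualD|exact: dual0]. Qed.

Lemma dual_ext (V : normedModType R[i]) (f g : dual V) :
  (forall x, f x = g x) -> f = g.
Proof. by move=> fg; apply: val_inj; apply/funext => x; exact: fg. Qed.

Lemma norming_functional (V : normedModType R[i]) (x : V) :
  exists f : dual V, f x = (nrm x)%:C /\ forall y, nrm (f y) <= nrm y.
Proof.
have [||||f [fH fb]] := @hahn_banach R V 1 [set q | exists c, q = (c *: x, c * (nrm x)%:C)].
- exact: ler01.
- by exists 0; rewrite scale0r mul0r.
- move=> a _ _ [c ->] [d ->]; exists (a * c + d).
  by rewrite /= scalerDl mulrDl scalerA mulrA.
- by move=> _ [c ->] /=; rewrite nrmZ nrmM nrmC mul1r ger0_norm ?nrm_ge0.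
exists f; split=> [|y]; last by rewrite -[leRHS]mul1r.
by apply: (fH (x, _)); exists 1; rewrite scale1r mul1r.
Qed.

Context (X : completeNormedModType R[i]) (W : closedSubspace X).

Lemma cs0 : cs_set W 0.
Proof. exact/set_mem/(proj1 (cs_submod W)). Qed.

Lemma csP a x y : cs_set W x -> cs_set W y -> cs_set W (a *: x + y).
Proof. by move=> /mem_set Wx /mem_set Wy; exact/set_mem/(proj2 (cs_submod W)). Qed.

Lemma csD x y : cs_set W x -> cs_set W y -> cs_set W (x + y).
Proof. by move=> Wx Wy; have := csP 1 Wx Wy; rewrite scale1r. Qed.

Lemma csZ a x : cs_set W x -> cs_set W (a *: x).
Proof. by move=> Wx; have := csP a Wx cs0; rewrite addr0. Qed.

Lemma cs_sum (I : Type) (r : seq I) (P : pred I) (f : I -> X) :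
  (forall i, P i -> cs_set W (f i)) -> cs_set W (\sum_(i <- r | P i) f i).
Proof. by move=> h; elim/big_ind : _ => //; [exact: cs0|exact: csD]. Qed.

Lemma cs_val_set (w : W) : cs_set W (cs_val w).
Proof. exact/set_mem/cs_valP. Qed.

Definition cs_mk x (Wx : cs_set W x) : W := @CsSort R X W x (mem_set Wx).

Lemma nrm_cs (w : W) : nrm (cs_val w) = nrm w.
Proof. by []. Qed.

Lemma cs_inj (u v : W) : cs_val u = cs_val v -> u = v.
Proof. exact: val_inj. Qed.

Lemma cs_valD (u v : W) : cs_val (u + v) = cs_val u + cs_val v.
Proof. exact: (raddfD (val : W -> X)). Qed.

Lemma cs_valZ a (v : W) : cs_val (a *: v) = a *: cs_val v.
Proof. by []. Qed.

Lemma cs_valB (u v : W) : cs_val (u - v) = cs_val u - cs_val v.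
Proof. exact: (raddfB (val : W -> X)). Qed.

Lemma cs_val0 : cs_val (0 : W) = 0.
Proof. exact: (raddf0 (val : W -> X)). Qed.

Lemma cs_val_sum (I : Type) (r : seq I) (P : pred I) (f : I -> W) :
  cs_val (\sum_(i <- r | P i) f i) = \sum_(i <- r | P i) cs_val (f i).
Proof. exact: (raddf_sum (val : W -> X)). Qed.

Lemma separate_closed_subspace (x : X) : ~ cs_set W x ->
  exists f : dual X, (forall w, cs_set W w -> f w = 0) /\ f x = 1.
Proof.
move=> Wx; have [d [d0 dW]] : exists d : R, 0 < d /\ forall w, cs_set W w -> d <= nrm (x - w).
  apply: contrapT => h; apply: Wx; apply: (@cs_closed _ _ W); apply/nrm_closedP => e e0.
  apply: contrapT => h'; apply: h; exists e; split=> // w Ww.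
  by rewrite leNgt; apply/negP => xw; apply: h'; exists w.
have [||||f [fH fb]] := @hahn_banach R X d^-1
    [set q | exists w c, cs_set W w /\ q = (w + c *: x, c)].
- by rewrite invr_ge0 ltW.
- by exists 0, 0; split; [exact: cs0|rewrite scale0r addr0].
- move=> a _ _ [w [c [Ww ->]]] [v [e [Wv ->]]]; exists (a *: w + v), (a * c + e).
  split; first exact: csP.
  by rewrite /= scalerDr scalerDl scalerA addrACA.
- move=> _ [w [c [Ww ->]]] /=; have [->|c0] := eqVneq c 0.
    by rewrite nrm0 mulr_ge0 ?nrm_ge0 ?invr_ge0 ?ltW.
  rewrite ler_pdivlMl// mulrC.
  have -> : w + c *: x = c *: (x - (- c^-1) *: w).
    by rewrite scaleNr opprK scalerDr scalerA divff// scale1r addrC.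
  by rewrite nrmZ ler_wpM2l ?nrm_ge0// dW//; exact: csZ.
exists f; split=> [w Ww|].
  by apply: (fH (w, _)); exists w, 0; rewrite scale0r addr0.
by apply: (fH (x, _)); exists 0, 1; split; [exact: cs0|rewrite scale1r add0r].
Qed.

Lemma extend_functional (g : dual W) :
  exists f : dual X, forall w : W, f (cs_val w) = g w.
Proof.
have [M [M0 gM]] := bounded_op_ge0 (dual_bounded g).
have [||||f [fH fb]] := @hahn_banach R X M
    [set q | exists w : W, q = (cs_val w, g w)].
- exact: ltW.
- by exists 0; rewrite cs_val0 -[X in g X](scale0r 0) dualZ mul0r.
- move=> a _ _ [w ->] [v ->]; exists (a *: w + v).
  by rewrite cs_valD cs_valZ dualD dualZ.
- by move=> _ [w ->] /=; rewrite nrm_cs.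
by exists f => w; apply: (fH (cs_val w, _)); exists w.
Qed.

(** A functional on the dual of [W] is pulled back along restriction to one on the
    dual of [X]. The vector of [X] that represents it lies in [W], as otherwise a
    functional vanishing on [W] would separate it from [W]. *)
Lemma reflexive_closed_subspace : reflexive_space X -> reflexive_space W.
Proof.
move=> rX F.
have res (f : dual X) : exists g : dual W, forall w, g w = f (cs_val w).
  have [M [_ fM]] := bounded_op_ge0 (dual_bounded f).
  apply: (@dual_of R W M) => [a x y|x]; last exact: fM.
  by rewrite cs_valD cs_valZ dualD dualZ.
have [r rE] := choice res.
have [M [M0 FM]] := bounded_op_ge0 (dual_bounded F).
have opE (V : normedModType R[i]) (f : dual V) : nrm f = op_norm f by [].
have [G GE] : exists G : dual (dual X), forall f, G f = F (r f).
  apply: (@dual_of R _ M) => [a f g|f].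
    rewrite -dual_linear; congr (F _); apply: dual_ext => w.
    by rewrite rE (_ : (a *: r f + r g : dual W) w = a *: r f w + r g w)// !rE.
  apply: (le_trans (FM _)); rewrite ler_wpM2l ?(ltW M0)// !opE.
  apply: op_norm_le => [|w w1]; first exact: dual_bounded.
  by rewrite rE op_norm_ball//; exact: dual_bounded.
have [x xE] := rX G.
have [Wx|Wx] := pselect (cs_set W x).
  exists (cs_mk Wx) => g; have [f fE] := extend_functional g.
  have -> : g = r f by apply: dual_ext => w; rewrite rE fE.
  by rewrite rE -GE xE.
have [f [f0 f1]] := separate_closed_subspace Wx.
have : G f = 1 by rewrite xE.
have -> : G f = 0.
  rewrite GE; have -> : r f = 0.
    by apply: dual_ext => w; rewrite rE f0//; exact: cs_val_set.
  by rewrite -[X in F X](scale0r 0) dualZ mul0r.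
by move=> /eqP; rewrite eq_sym oner_eq0.
Qed.

End HahnBanachCorollaries.

(** * Isometries and subspaces of subspaces *)

Section Isometries.
Context (R : realType).

Lemma linear_of (V W : lmodType R[i]) (f : V -> W) : linear f ->
  exists F : {linear V -> W}, forall x, F x = f x.
Proof.
move=> lf; pose F : {linear V -> W} := HB.pack f (GRing.isLinear.Build _ _ _ _ _ lf).
by exists F.
Qed.

Definition isometric (V W : normedModType R[i]) : Prop :=
  exists (f : {linear V -> W}) (g : {linear W -> V}),
    [/\ cancel f g, cancel g f & forall x, nrm (f x) = nrm x].

Lemma isometric_sym (V W : normedModType R[i]) : isometric V W -> isometric W V.
Proof. by move=> [f [g [fK gK fN]]]; exists g, f; split=> // y; rewrite -fN gK. Qed.

Lemma dist_preserving_continuous (V W : normedModType R[i]) (f : V -> W) :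
  (forall x y, nrm (f x - f y) = nrm (x - y)) -> continuous f.
Proof.
move=> fN x; apply/cvg_nrmP => e e0.
have /cvg_nrmP/(_ e e0) : (x' : V) @[x' --> x] --> x by [].
by apply: filterS => y; rewrite fN.
Qed.

Lemma isometry_continuous (V W : normedModType R[i]) (f : {linear V -> W}) :
  (forall x, nrm (f x) = nrm x) -> continuous f.
Proof. by move=> fN; apply: dist_preserving_continuous => x y; rewrite -linearB fN. Qed.

Lemma infinite_dimensional_isometric (V W : normedModType R[i]) :
  isometric V W -> infinite_dimensional V -> infinite_dimensional W.
Proof.
move=> [f [g [fK gK fN]]] iV [A [Afin Aspan]]; apply: iV.
exists (g @` A); split; first exact: finite_image.
apply/seteqP; split=> // x _.
have : lin_span A (f x) by rewrite Aspan.
move=> [n [c [v [Av fx]]]]; exists n, c, (g \o v); split; first by move=> i; exists (v i).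
rewrite -[x]fK fx linear_sum; apply: eq_bigr => i _.
by rewrite linearZ.
Qed.

Lemma reflexive_isometric (V W : normedModType R[i]) :
  isometric V W -> reflexive_space V -> reflexive_space W.
Proof.
move=> [f [g [fK gK fN]]] rV F.
have gN x : nrm (g x) = nrm x by rewrite -fN gK.
have pull (h : dual V) : exists k : dual W, forall w, k w = h (g w).
  have [M [_ hM]] := bounded_op_ge0 (dual_bounded h).
  apply: (@dual_of R W M) => [a x y|x]; last by rewrite -gN.
  by rewrite linearP dualD dualZ.
have [r rE] := choice pull.
have [M [M0 FM]] := bounded_op_ge0 (dual_bounded F).
have opE (U : normedModType R[i]) (h : dual U) : nrm h = op_norm h by [].
have [G GE] : exists G : dual (dual V), forall h, G h = F (r h).
  apply: (@dual_of R _ M) => [a h k|h].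
    rewrite -dual_linear; congr (F _); apply: dual_ext => w.
    by rewrite rE (_ : (a *: r h + r k : dual W) w = a *: r h w + r k w)// !rE.
  apply: (le_trans (FM _)); rewrite ler_wpM2l ?(ltW M0)// !opE.
  apply: op_norm_le => [|w w1]; first exact: dual_bounded.
  by rewrite rE op_norm_ball ?gN//; exact: dual_bounded.
have [x xE] := rV G.
exists (f x) => k.
have [h hE] : exists h : dual V, forall v, h v = k (f v).
  have [N [_ kN]] := bounded_op_ge0 (dual_bounded k).
  apply: (@dual_of R V N) => [a u v|v]; last by rewrite -(fN v).
  by rewrite linearP dualD dualZ.
rewrite -hE -xE GE; congr (F _); apply: dual_ext => w.
by rewrite rE hE gK.
Qed.

Lemma lotz_isometric (V W : normedModType R[i]) : isometric V W -> lotz V -> lotz W.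
Proof.
move=> [f [g [fK gK fN]]] lV T [Tb T0 TD Tc].
have gN x : nrm (g x) = nrm x by rewrite -fN gK.
have conj t : exists S : {linear V -> V}, forall x, S x = g (T t (f x)).
  by apply: linear_of => a x y; rewrite !linearP.
have [S SE] := choice conj.
have : C0_semigroup S.
  split.
  - move=> t /Tb[M TM]; exists M => x.
    by rewrite SE gN (le_trans (TM _))// fN.
  - by move=> x; rewrite SE T0 fK.
  - by move=> t s t0 s0 x; rewrite !SE TD// gK.
  - move=> x; rewrite (_ : (fun t => _) = (fun t => nrm (T t (f x) - f x))) //.
    by apply/funext => t; rewrite SE -{2}(fK x) -linearB gN.
move=> /lV; rewrite /uniformly_continuous_semigroup.
rewrite (_ : (fun t => op_norm _) = (fun t => op_norm (fun x => T t x - x)))//.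
apply/funext => t; rewrite /op_norm; congr (sup _).
apply/seteqP; split=> _ [x /= x1 <-].
  by exists (f x); rewrite /= ?fN// SE -[X in _ = nrm (_ - X)](fK x) -linearB gN.
by exists (g x); rewrite /= ?gN// SE gK -linearB gN.
Qed.

End Isometries.

Section Subspaces.
Context (R : realType).

Lemma preimage_closedSubspace (V W : completeNormedModType R[i])
    (g : {linear V -> W}) (A : closedSubspace W) : continuous g ->
  exists B : closedSubspace V, forall v, cs_set B v <-> cs_set A (g v).
Proof.
move=> gc.
have sm : submod_closed (fun x : V => x \in [set v | cs_set A (g v)]).
  split; first by apply/mem_set; rewrite /= linear0; exact: cs0.
  move=> a x y /set_mem/= Ax /set_mem/= Ay; apply/mem_set => /=.
  by rewrite linearP; exact: csP.
have cl : closed [set v | cs_set A (g v)].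
  by apply: (@closed_comp _ _ g (cs_set A)) => [x _|]; [exact: gc|exact: cs_closed].
by exists (ClosedSubspace sm cl).
Qed.

Lemma isometric_subspaces (V W : completeNormedModType R[i])
    (f : {linear V -> W}) (A : closedSubspace V) (B : closedSubspace W) :
  (forall x, nrm (f x) = nrm x) ->
  (forall v, cs_set A v -> cs_set B (f v)) ->
  (forall w, cs_set B w -> exists v, cs_set A v /\ f v = w) -> isometric A B.
Proof.
move=> fN fA fB.
have f_inj x y : f x = f y -> x = y.
  by move=> fxy; apply/eqP; rewrite -subr_eq0; apply/eqP/nrm_eq0; rewrite -fN linearB fxy subrr nrm0.
have [F FE] : exists F : {linear A -> B}, forall x, cs_val (F x) = f (cs_val x).
  have lF : linear (fun x : A => cs_mk (fA _ (cs_val_set x)) : B).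
    by move=> a x y; apply: cs_inj; rewrite [RHS]cs_valD cs_valZ; exact: linearP.
  have [F FE] := linear_of lF.
  by exists F => x; rewrite FE.
have inv (w : B) : exists v : A, f (cs_val v) = cs_val w.
  by have [v [Av fv]] := fB _ (cs_val_set w); exists (cs_mk Av).
have [g gE] := choice inv.
have lg : linear g.
  move=> a x y; apply: cs_inj; apply: f_inj; rewrite gE !cs_valD !cs_valZ.
  by rewrite linearP !gE.
have [G GE] := linear_of lg.
exists F, G; split=> [x|y|x].
- by apply: cs_inj; apply: f_inj; rewrite GE gE FE.
- by apply: cs_inj; rewrite /= FE GE gE.
- by rewrite -!nrm_cs FE fN.
Qed.

Lemma cs_val_linear (X : completeNormedModType R[i]) (Z : closedSubspace X) :
  exists f : {linear Z -> X}, forall z, f z = cs_val z.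
Proof. by apply: linear_of => a x y; rewrite cs_valD cs_valZ. Qed.

(** A closed subspace of a closed subspace is, up to isometry, a closed subspace
    of the whole space; hereditary properties are passed down along this lemma. *)
Lemma push_closedSubspace (X : completeNormedModType R[i]) (Z : closedSubspace X)
    (Y : closedSubspace Z) :
  exists Y' : closedSubspace X, isometric Y Y'.
Proof.
pose A := [set x | exists y : Z, cs_set Y y /\ cs_val y = x].
have sm : submod_closed (fun x : X => x \in A).
  split; first by apply/mem_set; exists 0; split; [exact: cs0|rewrite cs_val0].
  move=> a _ _ /set_mem[x [Yx <-]] /set_mem[y [Yy <-]]; apply/mem_set.
  by exists (a *: x + y); split; [exact: csP|rewrite cs_valD cs_valZ].
have cl : closed A.
  move=> x /nrm_closedP xA.
  have Zx : cs_set Z x.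
    apply: (@cs_closed _ _ Z); apply/nrm_closedP => e /xA[_ [[y [_ <-]] xy]].
    by exists (cs_val y); split=> //; exact: cs_val_set.
  exists (cs_mk Zx); split=> //; apply: (@cs_closed _ _ Y); apply/nrm_closedP => e.
  by move=> /xA[_ [[y [Yy <-]] xy]]; exists y.
have [f fE] := cs_val_linear Z.
exists (ClosedSubspace sm cl); apply: (@isometric_subspaces _ _ f).
- by move=> z; rewrite fE nrm_cs.
- by move=> z Yz; exists z; rewrite fE.
- by move=> _ [y [Yy <-]]; exists y; rewrite fE.
Qed.

Lemma no_reflexive_closed_subspace (X : completeNormedModType R[i])
    (Z : closedSubspace X) : no_reflexive_subspace X -> no_reflexive_subspace Z.
Proof.
move=> nX Y iY rY; have [Y' YY'] := push_closedSubspace Y.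
apply: (nX Y'); first exact: infinite_dimensional_isometric YY' iY.
exact: reflexive_isometric YY' rY.
Qed.

Lemma topological_direct_sum_isometric (V W : completeNormedModType R[i])
    (A B : closedSubspace V) : isometric V W -> topological_direct_sum A B ->
  exists A' B' : closedSubspace W,
    [/\ isometric A A', isometric B B' & topological_direct_sum A' B'].
Proof.
move=> [f [g [fK gK fN]]] [s [sK Ks sc]].
have gN x : nrm (g x) = nrm x by rewrite -fN gK.
have gc := isometry_continuous gN.
have [A' A'E] := preimage_closedSubspace A gc.
have [B' B'E] := preimage_closedSubspace B gc.
have isoAB (C : closedSubspace V) (C' : closedSubspace W) :
    (forall v, cs_set C' v <-> cs_set C (g v)) ->
    exists2 h : C -> C', (forall c, cs_val (h c) = f (cs_val c)) &
      continuous h /\ isometric C C'.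
  move=> C'E; have fC v : cs_set C v -> cs_set C' (f v) by rewrite C'E fK.
  exists (fun c => cs_mk (fC _ (cs_val_set c))) => //; split.
    apply: dist_preserving_continuous => x y.
    by rewrite -nrm_cs cs_valB/= -linearB fN -cs_valB nrm_cs.
  apply: (@isometric_subspaces _ _ f) => // w; rewrite C'E => Cgw.
  by exists (g w); rewrite gK.
have [h hE [hc AA']] := isoAB _ _ A'E; have [k kE [kc BB']] := isoAB _ _ B'E.
exists A', B'; split=> //.
exists (fun w => (h (s (g w)).1, k (s (g w)).2)); split=> [[a b]|w|w] /=.
- have gA : cs_set A (g (cs_val a)) by rewrite -A'E; exact: cs_val_set.
  have gB : cs_set B (g (cs_val b)) by rewrite -B'E; exact: cs_val_set.
  have := sK (cs_mk gA, cs_mk gB); rewrite /= -linearD => -> /=.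
  by congr pair; apply: cs_inj; rewrite /= ?hE ?kE gK.
- by rewrite hE kE -linearD; have /= -> := Ks (g w); rewrite gK.
- apply: (@cvg_pair _ _ _ _ (nbhs (h (s (g w)).1)) (nbhs (k (s (g w)).2))).
    apply: (@continuous_comp _ _ _ (fun w => (s (g w)).1) h); last exact: hc.
    apply: (@continuous_comp _ _ _ (fun w => s (g w)) fst); last exact: cvg_fst.
    by apply: (@continuous_comp _ _ _ g s); [exact: gc|exact: sc].
  apply: (@continuous_comp _ _ _ (fun w => (s (g w)).2) k); last exact: kc.
  apply: (@continuous_comp _ _ _ (fun w => s (g w)) snd); last exact: cvg_snd.
  by apply: (@continuous_comp _ _ _ g s); [exact: gc|exact: sc].
Qed.

Lemma hereditarily_indecomposable_closed_subspace (X : completeNormedModType R[i])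
    (Z : closedSubspace X) :
  hereditarily_indecomposable X -> hereditarily_indecomposable Z.
Proof.
move=> hX [Y [A [B [iY iA iB ds]]]]; apply: hX.
have [Y' YY'] := push_closedSubspace Y.
have [A' [B' [AA' BB' ds']]] := topological_direct_sum_isometric YY' ds.
exists Y', A', B'; split=> //; [exact: infinite_dimensional_isometric YY' iY|
  exact: infinite_dimensional_isometric AA' iA|exact: infinite_dimensional_isometric BB' iB].
Qed.

Lemma separable_closed_subspace (X : completeNormedModType R[i])
    (Z : closedSubspace X) : separable X -> separable Z.
Proof.
move=> [D [cD dD]].
have pick (p : X * nat) : exists z : Z,
    (exists z' : Z, nrm (p.1 - cs_val z') < p.2.+1%:R^-1) ->
    nrm (p.1 - cs_val z) < p.2.+1%:R^-1.
  have [[z hz]|nz] := pselect (exists z' : Z, nrm (p.1 - cs_val z') < p.2.+1%:R^-1).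
    by exists z.
  by exists 0 => /nz.
have [r rE] := choice pick.
exists (r @` (D `*` setT)); split.
  apply: (sub_countable (card_image_le _ _)); apply: countableX => //; exact: countableP.
move=> O [z Oz] oO.
have /nbhs_ballP[e /= /posC[-> e0] eO] : nbhs z O by exact: open_nbhs_nbhs.
have e20 : 0 < complex.Re e / 2 by rewrite divr_gt0.
have [n n1] := filter_ex (near_infty_natSinv_lt (PosNum e20)); rewrite /= in n1.
have [d [zd Dd]] : (ball (cs_val z) (n.+1%:R^-1)%:C `&` D) !=set0.
  apply: dD; last by apply: ball_open; rewrite ltcR invr_gt0.
  by exists (cs_val z); apply: ballxx; rewrite ltcR invr_gt0.
rewrite -ball_normE /= nrmE ltcR in zd.
have dr : nrm (d - cs_val (r (d, n))) < n.+1%:R^-1.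
  by apply: (rE (d, n)); exists z; rewrite nrm_distC.
exists (r (d, n)); split; last by exists (d, n).
apply: eO; rewrite -ball_normE/= nrmE ltcR -nrm_cs cs_valB.
rewrite (le_lt_trans (nrm_triangle3 d _ _))// [ltRHS]splitr ltrD//.
  exact: lt_trans zd n1.
exact: lt_trans dr n1.
Qed.

End Subspaces.

(** * Baire category and uniform boundedness *)

(** [V] with scalars restricted to [R], which makes Baire's theorem for real
    Banach spaces applicable to it. *)
Definition realify (R : realType) (V : completeNormedModType R[i]) : Type := V.

Section Realification.
Context (R : realType) (V : completeNormedModType R[i]).

HB.instance Definition _ := GRing.Zmodule.on (realify V).

Definition real_scale (a : R) (x : realify V) : realify V := a%:C *: (x : V).

Lemma real_scaleA a b v : real_scale a (real_scale b v) = real_scale (a * b) v.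
Proof. by rewrite /real_scale scalerA rmorphM. Qed.
Lemma real_scale1 : left_id 1 real_scale.
Proof. by move=> x; rewrite /real_scale scale1r. Qed.
Lemma real_scaleDr : right_distributive real_scale +%R.
Proof. by move=> a x y; rewrite /real_scale scalerDr. Qed.
Lemma real_scaleDl v : {morph real_scale^~ v : a b / a + b}.
Proof. by move=> a b; rewrite /real_scale rmorphD scalerDl. Qed.

HB.instance Definition _ := GRing.Zmodule_isLmodule.Build R (realify V)
  real_scaleA real_scale1 real_scaleDr real_scaleDl.

Definition real_norm (x : realify V) : R := nrm (x : V).

Lemma real_normD (x y : realify V) : real_norm (x + y) <= real_norm x + real_norm y.
Proof. exact: nrm_triangle. Qed.
Lemma real_normZ (a : R) (x : realify V) : real_norm (a *: x) = `|a| * real_norm x.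
Proof. by rewrite /real_norm nrmZ nrmC. Qed.
Lemma real_norm_eq0 (x : realify V) : real_norm x = 0 -> x = 0.
Proof. exact: nrm_eq0. Qed.

HB.instance Definition _ :=
  Lmodule_isNormed.Build R (realify V) real_normD real_normZ real_norm_eq0.

Lemma realify_complete (F : set_system (realify V)) : ProperFilter F -> cauchy F -> cvg F.
Proof.
move=> FF /cauchy_ballP Fc.
have FP : ProperFilter ((id : realify V -> V) @ F) by apply: fmap_proper_filter.
have : cauchy ((id : realify V -> V) @ F).
  apply/cauchy_ballP => e /posC[-> e0]; have := Fc _ e0.
  apply: filterS => -[x y] /=.
  by rewrite -!ball_normE /ball_ /= nrmE ltcR.
move=> /cauchy_cvg/cvg_ex[l Fl].
apply/cvg_ex; exists l; apply/cvgrPdist_lt => e e0.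
by have /cvg_nrmP/(_ e e0) := Fl.
Qed.

HB.instance Definition _ := Uniform_isComplete.Build (realify V) realify_complete.

Lemma baire_cover (A : nat -> set V) : (forall x, exists n, A n x) ->
  exists n x (e : R), 0 < e /\ forall y, nrm (x - y) < e -> closure (A n) y.
Proof.
move=> cov; apply: contrapT => h.
pose F n : set (realify V) := [set x | ~ closure (A n) (x : V)].
have oF n : open (F n) /\ dense (F n).
  split.
    rewrite openE => x /= xA; rewrite /interior.
    have [e [e0 eA]] : exists e : R, 0 < e /\ forall y : V, A n y -> e <= nrm ((x : V) - y).
      apply: contrapT => h'; apply: xA; apply/nrm_closedP => e e0.
      apply: contrapT => h2; apply: h'; exists e; split=> // y Ay.
      by rewrite leNgt; apply/negP => xy; apply: h2; exists y.
    apply/nbhs_ballP; exists (e / 2); first by rewrite /= divr_gt0.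
    move=> y; rewrite -ball_normE /ball_ /= => xy /nrm_closedP/(_ (e / 2)).
    rewrite divr_gt0// => /(_ isT)[z [Az yz]].
    have := eA _ Az; rewrite leNgt => /negP; apply.
    by rewrite (le_lt_trans (nrm_triangle3 (y : V) _ _))// [ltRHS]splitr ltrD.
  move=> O [x Ox] oO.
  have /nbhs_ballP[e /= e0 eO] : nbhs x O by exact: open_nbhs_nbhs.
  apply: contrapT => h'; apply: h; exists n, x, e; split=> // y xy.
  apply: contrapT => yA; apply: h'; exists y; split=> //.
  by apply: eO; rewrite -ball_normE.
have [|x [_ xF]] := @Baire R (realify V) F oF setT _ openT; first by exists 0.
by have [n xn] := cov x; apply: (xF n Logic.I); exact: subset_closure.
Qed.

End Realification.

Section UniformBoundedness.
Context (R : realType) (V : completeNormedModType R[i]) (W : normedModType R[i]).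

Theorem uniform_boundedness (f : nat -> {linear V -> W}) :
  (forall k, bounded_op (f k)) ->
  (forall x, exists M : R, forall k, nrm (f k x) <= M) ->
  exists M : R, 0 < M /\ forall k x, nrm (f k x) <= M * nrm x.
Proof.
move=> fb fp.
have [|n [x0 [e [e0 eA]]]] :=
    @baire_cover R V (fun n => [set x | forall k, nrm (f k x) <= n%:R]).
  move=> x; have [M xM] := fp x; exists (Num.bound `|M|) => k /=.
  apply: (le_trans (xM k)); apply: (le_trans (ler_norm M)).
  exact/ltW/Num.Theory.archi_boundP.
have fn k y : nrm (x0 - y) < e -> nrm (f k y) <= n%:R.
  move=> /eA/nrm_closedP yA; apply/ler_addgt0Pr => d d0.
  have [M [M0 fM]] := bounded_op_ge0 (fb k).
  have [z [zn yz]] := yA (d / M) (divr_gt0 d0 M0).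
  rewrite -(subrK (f k z) (f k y)) (le_trans (nrm_triangle _ _))// addrC lerD//.
  by rewrite -linearB (le_trans (fM _))// mulrC -ler_pdivlMr// ltW.
exists ((n%:R + n%:R) * (2 / e) + 1); split.
  by rewrite ltr_wpDl// mulr_ge0// ?addr_ge0// ltW// divr_gt0.
move=> k x; have [->|x0'] := eqVneq x 0; first by rewrite linear0 !nrm0 mulr0.
have nx := nrm_gt0 x0'.
pose c : R := e / 2 / nrm x; have c0 : 0 < c by rewrite /c !divr_gt0.
have ncx : nrm (c%:C *: x) = e / 2 by rewrite nrmZ nrmC gtr0_norm// divfK// gt_eqF.
have h1 := fn k x0; rewrite subrr nrm0 in h1.
have h2 := fn k (x0 + c%:C *: x).
rewrite opprD addNKr nrmN ncx ltr_pdivrMr// ltr_pMr// ltr1n in h2.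
have : nrm (f k (c%:C *: x)) <= n%:R + n%:R.
  have -> : c%:C *: x = x0 + c%:C *: x - x0 by rewrite addrC addKr.
  by rewrite linearB (le_trans (nrm_triangleB _ _))// lerD ?h1 ?h2.
rewrite linearZ/= nrmZ nrmC gtr0_norm// => h3.
apply: (@le_trans _ _ ((n%:R + n%:R) * (2 / e) * nrm x)); last first.
  by rewrite ler_wpM2r ?nrm_ge0// lerDl.
rewrite -(ler_pM2l c0); apply: (le_trans h3); rewrite /c.
by rewrite le_eqVlt; apply/orP; left; apply/eqP; field; rewrite !gt_eqF.
Qed.

End UniformBoundedness.

(** * A space with a Schauder basis is not Lotz *)

Section AbelSummation.
Context (R : realType) (V : normedModType R[i]).

(** Summation by parts: the sum is a combination of the partial sums of [u] with
    nonnegative weights of total [lam 0]. *)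
Lemma nrm_abel_sum (lam : nat -> R) (u : nat -> V) (B : R) (n : nat) :
  (forall k, 0 <= lam k.+1 <= lam k) ->
  (forall m, nrm (\sum_(0 <= k < m) u k) <= B) ->
  nrm (\sum_(0 <= k < n) (lam k)%:C *: u k) <= lam 0%N * B.
Proof.
move=> lam01 uB.
have l0 k : 0 <= lam k.
  by case: k => [|k]; have /andP[] := lam01 0%N; [exact: le_trans|];
    have /andP[] := lam01 k.
have -> : \sum_(0 <= k < n) (lam k)%:C *: u k =
    \sum_(0 <= k < n) (lam k - lam k.+1)%:C *: (\sum_(0 <= j < k.+1) u j)
    + (lam n)%:C *: \sum_(0 <= j < n) u j.
  elim: n => [|n IH]; first by rewrite !big_geq// scaler0 addr0.
  rewrite big_nat_recr//= IH [in RHS]big_nat_recr//= -!addrA; congr (_ + _).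
  rewrite -scalerDl -rmorphD/= subrK -scalerDr; congr (_ *: _).
  by rewrite big_nat_recr.
apply: (le_trans (nrm_triangle _ _)).
have : lam n * B + \sum_(0 <= k < n) (lam k - lam k.+1) * B <= lam 0%N * B.
  elim: n => [|n IH]; first by rewrite big_geq// addr0.
  by rewrite big_nat_recr//= mulrBl; lra.
apply: le_trans; rewrite addrC lerD//.
  by rewrite nrmZ nrmC ger0_norm// ler_wpM2l.
apply: (le_trans (nrm_sum _ _ _)); apply: ler_sum => k _.
have /andP[_ h] := lam01 k.
by rewrite nrmZ nrmC ger0_norm ?subr_ge0// ler_wpM2l ?subr_ge0.
Qed.

End AbelSummation.

Section SchauderBases.
Context (R : realType) (X : completeNormedModType R[i]) (e : nat -> X).
Hypothesis basis : schauder_basis e.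

Let expansion x := cid (basis x).
Let a x : nat -> R[i] := sval (expansion x).
Let P n x := series (fun k => a x k *: e k) n.

Let aE x : series (fun k => a x k *: e k) @ \oo --> x.
Proof. by have [] := svalP (expansion x). Qed.

Let aU x b : series (fun k => b k *: e k) @ \oo --> x -> a x = b.
Proof. by have [_] := svalP (expansion x); apply. Qed.

Let aP c x y : a (c *: x + y) = (fun k => c * a x k + a y k).
Proof.
apply: aU; rewrite (_ : series _ =
    (fun n => c *: series (fun k => a x k *: e k) n + series (fun k => a y k *: e k) n)).
  by apply: cvgD; [apply: cvgZr; exact: aE|exact: aE].
apply/funext => n; rewrite /series /= scaler_sumr -big_split/=.
by apply: eq_bigr => k _; rewrite scalerDl scalerA.
Qed.

Let PP n c x y : P n (c *: x + y) = c *: P n x + P n y.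
Proof.
rewrite /P aP /series /= scaler_sumr -big_split/=.
by apply: eq_bigr => k _; rewrite scalerDl scalerA.
Qed.

Let P0 n : P n 0 = 0.
Proof. by have := PP n (-1) 0 0; rewrite !scaleN1r oppr0 addr0 addNr. Qed.

Let PD n x y : P n (x + y) = P n x + P n y.
Proof. by have := PP n 1 x y; rewrite !scale1r. Qed.

Let PZ n c x : P n (c *: x) = c *: P n x.
Proof. by have := PP n c x 0; rewrite !addr0 P0 addr0. Qed.

Let PB n x y : P n (x - y) = P n x - P n y.
Proof. by rewrite -scaleN1r PD PZ scaleN1r. Qed.

Let a_delta k : a (e k) = (fun j => (j == k)%:R).
Proof.
apply: aU; apply: cvg_near_cst; exists k.+1 => //= n /= kn.
rewrite /series/= (bigD1_seq k) ?mem_index_iota ?iota_uniq//= eqxx scale1r.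
by rewrite big1 ?addr0// => j /negPf ->; rewrite scale0r.
Qed.

Let e_neq0 k : e k != 0.
Proof.
apply/eqP => ek; have := a_delta k; rewrite ek.
have -> : a 0 = fun=> 0.
  apply: aU; rewrite (_ : series _ = fun=> 0); first exact: cvg_cst.
  by apply/funext => n; rewrite /series/= big1// => j _; rewrite scale0r.
by move=> /(congr1 (fun f => f k)) /eqP; rewrite eqxx eq_sym oner_eq0.
Qed.

Let P_bounded x : exists M : R, forall n, nrm (P n x) <= M.
Proof.
have [N _ NP] := cvg_nrm_lt (@aE x) ltr01.
exists (nrm x + 1 + \sum_(k < N) nrm (P k x)) => n.
have sge0 : 0 <= \sum_(k < N) nrm (P k x) by rewrite sumr_ge0// => k _; rewrite nrm_ge0.
have [nN|Nn] := ltnP n N.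
  rewrite (bigD1 (Ordinal nN))//= addrCA lerDl addr_ge0 ?addr_ge0 ?nrm_ge0 ?ler01//.
  by rewrite sumr_ge0// => k _; rewrite nrm_ge0.
have := NP n Nn; rewrite nrm_distC => h.
have := le_trans (nrm_subr _ _) (ltW h); rewrite -/(P n x); lra.
Qed.

Let P_approx : exists K : R, 0 < K /\ forall y, exists z,
  nrm (y - z) <= nrm y / 2 /\ forall n, nrm (P n z) <= K * nrm y.
Proof.
have [|m [x0 [r [r0 rA]]]] :=
    @baire_cover R X (fun m => [set x | forall n, nrm (P n x) <= m%:R]).
  move=> x; have [M xM] := P_bounded x; exists (Num.bound `|M|) => n /=.
  apply: (le_trans (xM n)); apply: (le_trans (ler_norm M)).
  exact/ltW/Num.Theory.archi_boundP.
exists ((m%:R + m%:R) * (2 / r) + 1); split.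
  by rewrite ltr_wpDl// mulr_ge0// ?addr_ge0// ltW// divr_gt0.
move=> y; have [->|y0] := eqVneq y 0.
  by exists 0; rewrite subrr nrm0 mul0r mulr0; split=> // n; rewrite P0 nrm0.
have ny := nrm_gt0 y0.
pose c : R := r / 2 / nrm y; have c0 : 0 < c by rewrite /c !divr_gt0.
have ncy : nrm (c%:C *: y) = r / 2 by rewrite nrmZ nrmC gtr0_norm// divfK// gt_eqF.
have r8 : 0 < r / 8 by rewrite divr_gt0.
have /nrm_closedP/(_ _ r8)[z1 [z1A yz1]] : closure [set x | forall n, nrm (P n x) <= m%:R] x0.
  by apply: rA; rewrite subrr nrm0.
have /nrm_closedP/(_ _ r8)[z2 [z2A yz2]] :
    closure [set x | forall n, nrm (P n x) <= m%:R] (x0 + c%:C *: y).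
  by apply: rA; rewrite opprD addNKr nrmN ncy ltr_pdivrMr// ltr_pMr// ltr1n.
exists (c^-1%:C *: (z2 - z1)); split.
  have -> : y - c^-1%:C *: (z2 - z1) = c^-1%:C *: (c%:C *: y - (z2 - z1)).
    by rewrite [RHS]scalerBr scalerA -rmorphM mulVf ?gt_eqF// rmorph1 scale1r.
  rewrite nrmZ nrmC ger0_norm ?invr_ge0 ?(ltW c0)// ler_pdivrMl//.
  have -> : c * (nrm y / 2) = r / 8 + r / 8.
    by rewrite /c; field; rewrite gt_eqF.
  have -> : c%:C *: y - (z2 - z1) = (x0 + c%:C *: y - z2) - (x0 - z1).
    rewrite !opprB [x0 + _]addrC -!addrA; congr (_ + _).
    by rewrite [RHS]addrCA [x0 + _]addrC subrK addrC.
  by rewrite (le_trans (nrm_triangleB _ _))// lerD// ltW.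
move=> n; rewrite PZ PB nrmZ nrmC ger0_norm ?invr_ge0 ?(ltW c0)// ler_pdivrMl//.
apply: (@le_trans _ _ (m%:R + m%:R)).
  by rewrite (le_trans (nrm_triangleB _ _))// lerD.
apply: (@le_trans _ _ (c * ((m%:R + m%:R) * (2 / r) * nrm y))); last first.
  by rewrite ler_pM2l// ler_wpM2r ?nrm_ge0// lerDl.
rewrite le_eqVlt; apply/orP; left; apply/eqP; rewrite /c; field.
by rewrite !gt_eqF.
Qed.

(** By Baire's theorem every [y] is approximated up to half its norm by a [z]
    whose partial sums are bounded by [K * nrm y]. Iterating, [y] is the sum of
    such vectors [z_j] with geometrically decreasing bounds; the sums over [j] of
    the partial sums of the [z_j] are the partial sums of an expansion of [y],
    which is the only one. *)
Lemma schauder_projections_bounded : exists C : R, 0 < C /\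
  forall n x, nrm (P n x) <= C * nrm x.
Proof.
have [K [K0 /choice[zeta zetaE]]] := P_approx.
exists (2 * K); split; first by rewrite mulr_gt0.
move=> n0 y; pose yy J := iter J (fun y => y - zeta y) y.
pose s J := y - yy J.
have yyJ J : nrm (yy J) <= 2^-1 ^+ J * nrm y.
  elim: J => [|J IH]; first by rewrite expr0 mul1r.
  have [h _] := zetaE (yy J); apply: (le_trans h).
  by rewrite exprS; lra.
have sS J : s J.+1 = s J + zeta (yy J).
  by rewrite /s /yy iterS -/(yy J) opprB addrCA addrC.
have s0 : s 0%N = 0 by rewrite /s subrr.
have PsB n J m : nrm (P n (s (J + m)%N) - P n (s J)) <=
    K * nrm y * (2 * 2^-1 ^+ J - 2 * 2^-1 ^+ (J + m)).
  elim: m => [|m IH]; first by rewrite addn0 !subrr nrm0 mulr0.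
  rewrite addnS sS PD addrAC (le_trans (nrm_triangle _ _))//.
  have [_ h] := zetaE (yy (J + m)%N).
  have h2 := le_trans (h n) (ler_wpM2l (ltW K0) (yyJ (J + m)%N)).
  rewrite (le_trans (lerD IH h2))// exprS; lra.
have PsB2 n J m : nrm (P n (s (J + m)%N) - P n (s J)) <= 2 * K * nrm y * 2^-1 ^+ J.
  apply: (le_trans (PsB n J m)).
  have : 0 <= K * nrm y * 2^-1 ^+ (J + m) by rewrite !mulr_ge0 ?nrm_ge0 ?exprn_ge0// ltW.
  lra.
have small d : 0 < d -> exists J, 2 * K * nrm y * 2^-1 ^+ J < d.
  move=> d0.
  have : (fun J => 2 * K * nrm y * 2^-1 ^+ J) @ \oo --> 2 * K * nrm y * (0 : R).
    by apply: cvgMr; apply: cvg_expr; rewrite ger0_norm// invf_lt1// ltr1n.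
  rewrite mulr0 => /cvgrPdist_lt/(_ d d0)/filter_ex[J].
  rewrite sub0r normrN ger0_norm; first by exists J.
  by rewrite !mulr_ge0 ?nrm_ge0 ?exprn_ge0// ltW.
have Qex n : exists l : X, (fun J => P n (s J)) @ \oo --> l.
  apply: cauchy_nrm => d /small[J hJ]; exists J => m Jm.
  by rewrite -(subnKC Jm) (le_lt_trans (PsB2 n J _)).
have [Q QE] := choice Qex.
have QP n J : nrm (Q n - P n (s J)) <= 2 * K * nrm y * 2^-1 ^+ J.
  apply: (@nrm_lim_le R _ \oo _ _ (fun j => P n (s j) - P n (s J))).
    by apply: cvgB; [exact: QE|exact: cvg_cst].
  by exists J => // m /= Jm; rewrite -(subnKC Jm).
(* The limit of multiples of e n is a multiple of e n: a functional norming e n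
   gives a bounded projection onto its line. *)
have Qline n : exists c : R[i], Q n.+1 - Q n = c *: e n.
  have [f [fe fb]] := norming_functional (e n).
  have fbd : bounded_op f by exact: dual_bounded.
  pose c0 : R[i] := (nrm (e n))%:C.
  have c00 : c0 != 0 by rewrite /c0 (fmorph_eq0 (real_complex R)) gt_eqF// nrm_gt0.
  exists (f (Q n.+1 - Q n) / c0).
  have [pi piE] : exists pi : {linear X -> X}, forall x, pi x = (f x / c0) *: e n.
    apply: linear_of => c x z; rewrite dualD dualZ mulrDl scalerDl.
    by rewrite -mulrA scalerA.
  have pib : bounded_op pi.
    exists (nrm c0^-1 * nrm (e n)) => x; rewrite piE nrmZ nrmM.
    by rewrite -mulrA mulrC ler_wpM2l ?fb// mulr_ge0 ?nrm_ge0.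
  rewrite -piE.
  have dcvg : (fun J => P n.+1 (s J) - P n (s J)) @ \oo --> Q n.+1 - Q n.
    by apply: cvgB; exact: QE.
  have := bounded_op_cvg pib dcvg.
  rewrite (_ : (fun J => pi _) = (fun J => P n.+1 (s J) - P n (s J))).
    by move=> h; exact: cvg_uniq dcvg (h _).
  apply/funext => J; have -> : P n.+1 (s J) - P n (s J) = a (s J) n *: e n.
    by rewrite /P seriesSr addrAC subrr add0r.
  by rewrite piE dualZ fe mulfK.
have [b bE] := choice Qline.
have Q0 : Q 0%N = 0.
  apply: (cvg_uniq (QE 0%N)).
  by rewrite (_ : (fun J => _) = fun=> 0); [exact: cvg_cst|
    apply/funext => J; rewrite /P /series/= big_geq].
have QS n : series (fun k => b k *: e k) n = Q n.
  elim: n => [|n IH]; first by rewrite /series/= big_geq.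
  by rewrite seriesSr IH -bE addrC subrK.
have : series (fun k => b k *: e k) @ \oo --> y.
  rewrite (funext QS); apply: nrm_lt_cvg => d d0.
  have d4 : 0 < d / 4 by rewrite divr_gt0.
  have [J hJ] := small _ d4.
  have yJ : exists J', (J <= J')%N /\ nrm (yy J') < d / 4.
    have : (fun J => nrm y * 2^-1 ^+ J) @ \oo --> nrm y * (0 : R).
      by apply: cvgMr; apply: cvg_expr; rewrite ger0_norm// invf_lt1// ltr1n.
    rewrite mulr0 => /cvgrPdist_lt/(_ _ d4) h.
    have [J' [JJ' h']] := filter_ex (filterI (nbhs_infty_ge J) h).
    exists J'; split=> //; apply: (le_lt_trans (yyJ J')); rewrite mulrC.
    by rewrite sub0r normrN ger0_norm// mulr_ge0 ?nrm_ge0// in h'.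
  have [J' [JJ' hJ']] := yJ.
  apply: filterS (cvg_nrm_lt (@aE (s J')) d4) => n hn; rewrite -/(P n (s J')) in hn.
  have h1 := QP n J'.
  have h2 : 2 * K * nrm y * 2^-1 ^+ J' < d / 4.
    apply: le_lt_trans hJ; rewrite ler_wpM2l ?mulr_ge0 ?nrm_ge0 ?(ltW K0)//.
    by rewrite ler_wiXn2l// invf_le1// ler1n.
  have e1 := nrm_triangle3 (s J') y (Q n).
  have e2 := nrm_triangle3 (P n (s J')) (s J') (Q n).
  rewrite {1}/s opprB addrCA subrr addr0 in e1.
  by rewrite [nrm (P _ _ - Q _)]nrm_distC in e2; lra.
move=> /aU ay.
have -> : P n0 y = Q n0 by rewrite -QS /P ay.
by have := QP n0 0%N; rewrite s0 P0 subr0 expr0 mulr1.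
Qed.
Lemma schauder_multiplier : exists C : R, 0 < C /\
  forall (lam : nat -> R) x, (forall k, 0 <= lam k.+1 <= lam k) -> exists y : X,
    series (fun k => (lam k)%:C *: (a x k *: e k)) @ \oo --> y /\
    nrm y <= C * lam 0%N * nrm x.
Proof.
have [C [C0 CP]] := schauder_projections_bounded.
exists C; split=> // lam x lamd.
have l0 k : 0 <= lam k.
  by case: k => [|k]; have /andP[] := lamd 0%N; [exact: le_trans|];
    have /andP[] := lamd k.
have lam_le k : lam k <= lam 0%N.
  by elim: k => // k; apply: le_trans; have /andP[] := lamd k.
set u := fun k => a x k *: e k.
have [y yE] : exists y : X, series (fun k => (lam k)%:C *: u k) @ \oo --> y.
  apply: cauchy_nrm => d d0.
  have l1 : 0 < lam 0%N + 1 by rewrite ltr_wpDl.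
  pose d' := d / (lam 0%N + 1) / 3; have d'0 : 0 < d' by rewrite !divr_gt0.
  have [N _ NP] := cvg_nrm_lt (@aE x) d'0.
  exists N => n Nn; rewrite sub_series_geq//.
  rewrite -{1}[N]add0n big_addn.
  under eq_bigr do rewrite addnC.
  apply: (@le_lt_trans _ _ (lam (N + 0)%N * (2 * d'))); last first.
    rewrite addn0; apply: (@le_lt_trans _ _ (lam 0%N * (2 * d'))).
      by rewrite ler_wpM2r// mulr_ge0// ltW.
    have -> : d = d' * (lam 0%N + 1) * 3 by rewrite /d'; field; rewrite gt_eqF.
    have := mulr_ge0 (ltW d'0) (l0 0%N); lra.
  apply: (@nrm_abel_sum _ _ (fun k => lam (N + k)%N) (fun k => u (N + k)%N)).
    by move=> k; rewrite addnS.
  move=> m; have h1 := NP N (leqnn N); have h2 := NP (m + N)%N (leq_addl m N).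
  have -> : \sum_(0 <= k < m) u (N + k)%N = series u (m + N)%N - series u N.
    rewrite sub_series_geq ?leq_addl// -{2}[N]add0n big_addn addnK.
    by under [RHS]eq_bigr do rewrite addnC.
  have := nrm_triangle3 x (series u (m + N)%N) (series u N).
  by rewrite /= in h1 h2; rewrite [nrm (series u (m + N)%N - x)]nrm_distC; lra.
exists y; split=> //.
apply: (nrm_lim_le yE); apply: nearW => n; rewrite mulrAC -mulrA mulrC -mulrA.
rewrite mulrCA [_ * C]mulrC; apply: nrm_abel_sum => // m.
exact: CP.
Qed.

(** The diagonal semigroup with symbols [exp (- k t)] is strongly continuous by
    Abel summation, while [T t - 1] has norm at least [1 - exp (- k t)] for
    every [k]. *)
Theorem schauder_basis_not_lotz : ~ lotz X.
Proof.
have [C [C0 CM]] := schauder_multiplier.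
pose lam (t : R) (k : nat) : R := expR (- (k%:R * t)).
have lamd t : 0 <= t -> forall k, 0 <= lam t k.+1 <= lam t k.
  move=> t0 k; rewrite expR_ge0 ler_expR lerN2 ler_wpM2r// ler_nat.
  by rewrite leqnSn.
have lam0 t : lam t 0%N = 1 by rewrite /lam mul0r oppr0 expR0.
pose ser t x := series (fun k => (lam t k)%:C *: (a x k *: e k)).
have Tex t : exists T : {linear X -> X}, 0 <= t -> forall x, ser t x @ \oo --> T x.
  have [t0|t0] := leP 0 t; last by exists idfun.
  have fex x : exists y : X, ser t x @ \oo --> y.
    have [y [yE _]] := CM _ x (lamd t t0); by exists y.
  have [f fE] := choice fex.
  have lf : linear f.
    move=> c x y; apply: (cvg_uniq (fE _)).
    rewrite (_ : ser t _ = fun n => c *: ser t x n + ser t y n).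
      by apply: cvgD; [apply: cvgZr; exact: fE|exact: fE].
    apply/funext => n; rewrite /ser /series /= scaler_sumr -big_split/=.
    apply: eq_bigr => k _; rewrite aP scalerDl scalerDr; congr (_ + _).
    by rewrite !scalerA; congr (_ *: _); rewrite mulrCA.
  by have [F FE] := linear_of lf; exists F => _ x; rewrite FE; exact: fE.
have [T TE] := choice Tex.
have TC t : 0 <= t -> forall x, nrm (T t x) <= C * nrm x.
  move=> t0 x; have [y [yE yC]] := CM _ x (lamd t t0).
  by rewrite lam0 mulr1 in yC; rewrite (cvg_uniq (TE t t0 x) yE).
have Te t k : 0 <= t -> T t (e k) = (lam t k)%:C *: e k.
  move=> t0; apply: (cvg_uniq (TE t t0 _)); apply: cvg_near_cst.
  exists k.+1 => //= n /= kn.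
  rewrite /ser /series/= (bigD1_seq k) ?mem_index_iota ?iota_uniq//= a_delta eqxx scale1r.
  by rewrite big1 ?addr0// => j /negPf ->; rewrite scale0r scaler0.
have TC0 : C0_semigroup T.
  split.
  - by move=> t t0; exists C; exact: TC.
  - move=> x; apply: (cvg_uniq (TE 0 (lexx 0) x)).
    rewrite (_ : ser 0 x = series (fun k => a x k *: e k)); first exact: aE.
    by congr series; apply/funext => k; rewrite /lam mulr0 oppr0 expR0 scale1r.
  - move=> t s t0 s0 x; apply: (cvg_uniq (TE _ (addr_ge0 t0 s0) x)).
    have aT : a (T s x) = fun k => (lam s k)%:C * a x k.
      apply: aU; have := TE s s0 x; rewrite /ser.
      rewrite (_ : (fun k => _ *: (_ *: _)) = fun k => ((lam s k)%:C * a x k) *: e k)//.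
      by apply/funext => k; rewrite scalerA.
    rewrite (_ : ser (t + s) x = ser t (T s x)); first exact: TE.
    congr series; apply/funext => k; rewrite aT !scalerA mulrA; congr (_ * _ *: _).
    by rewrite -rmorphM /lam -expRD mulrDr opprD.
  move=> x; apply/cvgrPdist_lt => d d0.
  have C1 : 0 < C + 1 by rewrite ltr_wpDl// ltW.
  have d2 : 0 < d / (C + 1) / 2 by rewrite !divr_gt0.
  have [N _ NP] := cvg_nrm_lt (@aE x) d2.
  have {NP} := NP N (leqnn N); set p := series _ N => xp.
  pose D := \sum_(0 <= k < N) k%:R * nrm (a x k *: e k).
  have D0 : 0 <= D by rewrite sumr_ge0// => k _; rewrite mulr_ge0// nrm_ge0.
  have D1 : 0 < D + 1 by rewrite ltr_wpDl.
  have Tp t : 0 <= t -> nrm (T t p - p) <= t * D.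
    move=> t0; rewrite /p /series/= linear_sum -sumrB /D mulr_sumr.
    apply: (le_trans (nrm_sum _ _ _)); apply: ler_sum => k _.
    rewrite linearZ /= Te// !scalerA mulrC -!scalerA -{2}[a x k *: e k]scale1r -scalerBl.
    rewrite nrmZ mulrA ler_wpM2r ?nrm_ge0//.
    rewrite -[1](rmorph1 (real_complex R)) -rmorphB nrmC ler0_norm.
      rewrite opprB lerBlDr addrC -lerBlDr.
      have := expR_ge1Dx (- (k%:R * t)); rewrite /lam; lra.
    rewrite subr_le0 -expR0 ler_expR oppr_le0 mulr_ge0//.
  near=> t; have t0 : 0 < t by near: t; exact: nbhs_right_gt.
  rewrite sub0r normrN ger0_norm ?nrm_ge0//.
  have -> : T t x - x = T t (x - p) - (x - p) + (T t p - p).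
    by rewrite linearB opprB addrAC !subrKA.
  have h1 := nrm_triangle (T t (x - p) - (x - p)) (T t p - p).
  have h2 := nrm_triangleB (T t (x - p)) (x - p).
  have h3 := TC t (ltW t0) (x - p); have h4 := Tp t (ltW t0).
  have h5 : t < d / (D + 1) / 2 by near: t; apply: nbhs_right_lt; rewrite !divr_gt0.
  have h6 : t * D < d / 2.
    move: h5; rewrite ltr_pdivlMr// ltr_pdivlMr// => h5.
    by have := mulr_ge0 (ltW t0) D0; lra.
  have h7 : C * nrm (x - p) + nrm (x - p) < d / 2.
    move: xp; rewrite ltr_pdivlMr// ltr_pdivlMr// => xp; lra.
  lra.
move=> /(_ T TC0) /cvgrPdist_lt/(_ (1/2)); rewrite divr_gt0// => /(_ isT).
move=> /(filterI (nbhs_right_gt 0))/filter_ex[t [t0]].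
have t0' := ltW t0.
have [S SE] : exists S : {linear X -> X}, forall x, S x = T t x - x.
  by apply: linear_of => c x y; rewrite linearP scalerBr opprD addrACA.
rewrite (_ : (fun x => _) = S); last by apply/funext => x; rewrite SE.
have Sb : bounded_op S.
  exists (C + 1) => x; rewrite SE mulrDl mul1r (le_trans (nrm_triangleB _ _))// lerD//.
  exact: TC.
rewrite sub0r normrN ger0_norm ?op_norm_ge0// => S12.
pose k := Num.bound (1 / t).
have kt : 1 < k%:R * t.
  by rewrite -ltr_pdivrMr//; apply: Num.Theory.archi_boundP; rewrite divr_ge0.
have lk : lam t k < 1 / 2.
  have := expR_ge1Dx (k%:R * t); rewrite /lam expRN => h.
  have h2 : 2 < expR (k%:R * t) by lra.
  rewrite mul1r ltf_pV2 ?posrE// ?expR_gt0//.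
have := nrm_op_norm (e k) Sb.
rewrite SE Te// -{2}[e k]scale1r -scalerBl nrmZ ler_pM2r ?nrm_gt0//.
rewrite -[1](rmorph1 (real_complex R)) -rmorphB nrmC ler0_norm; lra.
Unshelve. all: by end_near. Qed.

End SchauderBases.

(** * Means of strongly continuous semigroups *)

Section CompactUniform.
Context (R : realType) (V W : normedModType R[i]).

(** A finite net of the compact set reduces uniform to pointwise convergence, the
    common Lipschitz constant controlling the rest. *)
Lemma equilipschitz_cvg_compact (C : set V) (T : Type) (F : set_system T)
    {FF : Filter F} (A : T -> V -> W) (M : R) : compact C ->
  (\forall t \near F, forall x y, nrm (A t x - A t y) <= M * nrm (x - y)) ->
  (forall x (e : R), 0 < e -> \forall t \near F, nrm (A t x) < e) ->
  forall e : R, 0 < e -> \forall t \near F, forall x, C x -> nrm (A t x) < e.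
Proof.
move=> cC AM A0 e e0.
pose M' := `|M| + 1; have M'0 : 0 < M' by rewrite ltr_wpDl.
have d0 : 0 < e / 2 / M' by rewrite !divr_gt0.
have dC : 0 < ((e / 2 / M')%:C : R[i]) by rewrite ltcR.
move: cC; rewrite compact_cover => /(_ V setT (fun x => ball x ((e / 2 / M')%:C : R[i]))).
case=> [x _||D _ DC]; first exact: ball_open.
  by move=> x Cx; exists x => //; exact: ballxx.
have e20 : 0 < e / 2 by rewrite divr_gt0.
have Dn : F (\bigcap_(x in [set` D]) [set t | nrm (A t x) < e / 2]).
  by apply: filter_bigI => x _; exact: A0.
apply: filterS2 AM Dn => t tM tD x Cx.
have [y yD] := DC x Cx; rewrite -ball_normE /= nrmE ltcR => yx.
have h1 := tD y yD; rewrite /= in h1.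
have h2 : nrm (A t x - A t y) < e / 2.
  apply: (le_lt_trans (tM x y)); rewrite ltr_pdivlMr// in yx.
  apply: le_lt_trans yx; rewrite nrm_distC mulrC ler_wpM2l ?nrm_ge0//.
  by rewrite /M' (le_trans (ler_norm M))// lerDl.
by rewrite -(subrK (A t y) (A t x)) (le_lt_trans (nrm_triangle _ _))// [ltRHS]splitr ltrD.
Qed.

End CompactUniform.

(** What the Lotz criterion retains of the structure of the operators on the
    Argyros-Motakis spaces. *)
Definition scalar_plus_square_compact (R : realType) (V : normedModType R[i]) : Prop :=
  forall T : {linear V -> V}, bounded_op T ->
    exists (alpha : R[i]) (S : {linear V -> V}),
      [/\ bounded_op S, compact_op (S \o S) & forall y, T y = alpha *: y + S y].

Section Averages.
Context (R : realType) (V : completeNormedModType R[i]) (T : R -> {linear V -> V}).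
Hypothesis TC0 : C0_semigroup T.

Lemma C0_cont x (e : R) : 0 < e -> exists d : R, 0 < d /\
  forall t, 0 <= t -> t <= d -> nrm (T t x - x) < e.
Proof.
move=> e0; have [_ T0 _ Tc] := TC0.
have /cvgrPdist_lt/(_ e e0)/nbhs_ballP[d /= d0 dP] := Tc x.
exists (d / 2); split; first by rewrite divr_gt0.
move=> t; rewrite le_eqVlt => /predU1P[<- _|t0 td]; first by rewrite T0 subrr nrm0.
have := dP t; rewrite /= sub0r normrN ger0_norm ?nrm_ge0//; apply=> //.
rewrite -ball_normE /= sub0r normrN gtr0_norm//; lra.
Qed.

(** Otherwise there would be times tending to [0] along which the norms of the
    operators are unbounded although all orbits converge, against uniform
    boundedness. *)
Lemma C0_semigroup_locally_bounded : exists (M d : R), [/\ 1 <= M, 0 < d &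
  forall t x, 0 <= t -> t <= d -> nrm (T t x) <= M * nrm x].
Proof.
have [Tb T0 _ _] := TC0.
apply: contrapT => h.
have bad k : exists t : R, [/\ 0 <= t, t <= k.+1%:R^-1 &
    exists x, k.+1%:R * nrm x < nrm (T t x)].
  apply: contrapT => h'; apply: h; exists k.+1%:R, k.+1%:R^-1; split.
  - by rewrite ler1n.
  - by rewrite invr_gt0.
  move=> t x t0 tk; rewrite leNgt; apply/negP => h2; apply: h'.
  by exists t; split=> //; exists x.
have [t tE] := choice bad.
have [||M [M0 TM]] := @uniform_boundedness R V V (fun k => T (t k)).
- by move=> k; have [t0 _ _] := tE k; exact: Tb.
- move=> x; have [d [d0 dx]] := C0_cont x ltr01.
  pose N := Num.bound d^-1.
  exists (\sum_(k < N) nrm (T (t k) x) + (nrm x + 1)) => k.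
  have sge0 : 0 <= \sum_(k < N) nrm (T (t k) x).
    by rewrite sumr_ge0// => j _; rewrite nrm_ge0.
  have [kN|Nk] := ltnP k N.
    rewrite (bigD1 (Ordinal kN))//= -addrA lerDl addr_ge0 ?addr_ge0 ?nrm_ge0 ?ler01//.
    by rewrite sumr_ge0// => j _; rewrite nrm_ge0.
  have [t0 tk _] := tE k.
  have td : t k <= d.
    apply: (le_trans tk); rewrite -[d]invrK lef_pV2 ?posrE ?invr_gt0//.
    apply: (@le_trans _ _ N%:R); last by rewrite ler_nat (leq_trans Nk).
    by apply/ltW/Num.Theory.archi_boundP; rewrite invr_ge0 ltW.
  have := dx _ t0 td; have := nrm_subr (T (t k) x) x; lra.
pose k := Num.bound M.
have [t0 _ [x xk]] := tE k.
have := TM k x; rewrite leNgt => /negP; apply; apply: le_lt_trans xk.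
rewrite ler_wpM2r ?nrm_ge0// ltW//.
apply: lt_le_trans (Num.Theory.archi_boundP (ltW M0)) _.
by rewrite ler_nat.
Qed.

(** The Riemann sum with [N] steps of length [tau] for the mean of the orbit of
    [x] over [0, N tau]. *)
Definition avg (tau : R) (N : nat) (x : V) : V :=
  (N%:R^-1)%:C *: \sum_(0 <= k < N) T (k%:R * tau) x.

Lemma avg_linear tau N c x y : avg tau N (c *: x + y) = c *: avg tau N x + avg tau N y.
Proof.
rewrite /avg !scalerA mulrC -scalerA -scalerDr; congr (_ *: _).
by rewrite scaler_sumr -big_split/=; apply: eq_bigr => k _; rewrite linearP.
Qed.

(** A Riemann sum of Riemann sums is a Riemann sum; this compares a subdivision
    with its refinements. *)
Lemma avg_mul tau N K x : 0 <= tau ->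
  avg (K%:R * tau) N (avg tau K x) = avg tau (N * K) x.
Proof.
move=> t0; have [_ _ TD _] := TC0; rewrite /avg natrM invfM rmorphM -scalerA.
congr (_ *: _); under eq_bigr do rewrite linearZ /=.
rewrite -scaler_sumr; congr (_ *: _).
elim: N => [|N IH]; first by rewrite [LHS]big_geq// [RHS]big_geq.
have -> : (N.+1 * K)%N = (N * K + K)%N by rewrite mulSn addnC.
rewrite big_nat_recr//= IH [RHS](@big_cat_nat _ _ _ (N * K)%N) ?leq_addr//=; congr (_ + _).
rewrite -{1}[(N * K)%N]add0n big_addn addKn linear_sum; apply: eq_bigr => k _.
by rewrite -TD ?mulr_ge0//; congr (T _ _); rewrite natrD natrM; ring.
Qed.

Context (M d : R).
Hypothesis M1 : 1 <= M.
Hypothesis TM : forall t x, 0 <= t -> t <= d -> nrm (T t x) <= M * nrm x.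

Lemma avg_le (tau B : R) N (x : V) (f : nat -> V) : (0 < N)%N ->
  (forall k, (k < N)%N -> nrm (f k) <= B) ->
  nrm ((N%:R^-1)%:C *: \sum_(0 <= k < N) f k) <= B.
Proof.
move=> N0 fB; rewrite nrmZ nrmC ger0_norm ?invr_ge0// ler_pdivrMl ?ltr0n//.
apply: (le_trans (nrm_sum _ _ _)); rewrite big_mkord.
apply: (@le_trans _ _ (\sum_(i < N) B)); first by apply: ler_sum => k _; exact: fB.
by rewrite sumr_const card_ord mulr_natl.
Qed.

Lemma avg_bounded tau N x : 0 <= tau -> N%:R * tau <= d -> (0 < N)%N ->
  nrm (avg tau N x) <= M * nrm x.
Proof.
move=> t0 Nd N0; apply: avg_le => // k kN; apply: TM; first by rewrite mulr_ge0 ?ler0n.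
by apply: le_trans Nd; rewrite ler_wpM2r// ler_nat ltnW.
Qed.

Lemma avg_sub_le tau N x (w : R) : 0 <= tau -> (0 < N)%N ->
  (forall t, 0 <= t -> t <= N%:R * tau -> nrm (T t x - x) <= w) ->
  nrm (avg tau N x - x) <= w.
Proof.
move=> t0 N0 h.
have -> : avg tau N x - x = (N%:R^-1)%:C *: \sum_(0 <= k < N) (T (k%:R * tau) x - x).
  rewrite sumrB scalerBr /avg; congr (_ - _).
  rewrite big_mkord sumr_const card_ord -[x *+ N]scaler_nat scalerA.
  by rewrite -(rmorph_nat (real_complex R)) -rmorphM mulVf ?rmorph1 ?scale1r// pnatr_eq0 -lt0n.
apply: avg_le => // k kN; apply: h; first by rewrite mulr_ge0 ?ler0n.
by rewrite ler_wpM2r// ler_nat ltnW.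
Qed.

Lemma avg_shift tau N j x : 0 <= tau ->
  T (j%:R * tau) (avg tau N x) - avg tau N x =
  (N%:R^-1)%:C *: \sum_(0 <= k < j) (T ((N + k)%:R * tau) x - T (k%:R * tau) x).
Proof.
move=> t0; have [_ T0 TD _] := TC0.
rewrite /avg linearZ /= -scalerBr; congr (_ *: _); rewrite linear_sum.
elim: j => [|j IH].
  rewrite [RHS]big_geq// mul0r -sumrB big1// => k _; by rewrite T0 subrr.
rewrite [RHS]big_nat_recr//= -IH.
have sh i : T (i%:R * tau) (\sum_(0 <= k < N) T (k%:R * tau) x) =
    \sum_(0 <= k < N) T ((k + i)%:R * tau) x.
  rewrite linear_sum; apply: eq_bigr => k _; rewrite -TD ?mulr_ge0//.
  by congr (T _ _); rewrite natrD; ring.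
rewrite -!linear_sum !sh.
have : \sum_(0 <= k < N) T ((k + j.+1)%:R * tau) x + T (j%:R * tau) x =
    \sum_(0 <= k < N) T ((k + j)%:R * tau) x + T ((N + j)%:R * tau) x.
  rewrite -(@big_nat_recr _ _ _ N 0 (fun k => T ((k + j)%:R * tau) x))//=.
  rewrite big_nat_recl//= add0n addrC; congr (_ + _).
  by apply: eq_bigr => k _; rewrite addnS addSn.
set s1 := \sum_(_ <= _ < _) _; set s2 := \sum_(_ <= _ < _) _.
set s3 := \sum_(_ <= _ < _) _ => h.
by rewrite -[s1](addrK (T (j%:R * tau) x)) h addrAC [RHS]addrAC -!addrA; congr (_ + _);
   rewrite addrCA addrC addrA addrC.
Qed.

End Averages.

Section SemigroupAverages.
Context (R : realType) (V : completeNormedModType R[i]) (T : R -> {linear V -> V}).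
Hypothesis TC0 : C0_semigroup T.
Context (M d : R).
Hypothesis M1 : 1 <= M.
Hypothesis TM : forall t x, 0 <= t -> t <= d -> nrm (T t x) <= M * nrm x.

(** The mean of the orbits over [0, h], as the limit of dyadic Riemann sums. The
    last clause is the estimate behind the fact that the range of the mean lies
    in the domain of the generator. *)
Lemma semigroup_mean (h : R) : 0 < h -> 2 * h <= d ->
  exists A : {linear V -> V},
  [/\ forall x, nrm (A x) <= M * nrm x,
      forall x (w : R), (forall t, 0 <= t -> t <= h -> nrm (T t x - x) <= w) ->
        nrm (A x - x) <= w
    & forall t x, 0 <= t -> t <= h ->
        nrm (T t (A x) - A x) <= 2 * M / h * t * nrm x].
Proof.
move=> h0 hd; have M0 : 0 < M by exact: lt_le_trans M1.
have [_ T0 TD _] := TC0.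
pose N n := (2 ^ n)%N; have N0 n : (0 < N n)%N by rewrite /N expn_gt0.
pose tau n := h / (N n)%:R.
have tau0 n : 0 < tau n by rewrite /tau divr_gt0// ltr0n.
have Ntau n : (N n)%:R * tau n = h by rewrite /tau mulrC divfK// pnatr_eq0 -lt0n.
pose r n x := avg T (tau n) (N n) x.
have hd' : h <= d by lra.
have rM n x : nrm (r n x) <= M * nrm x.
  by apply: (avg_bounded TM) => //; [exact: ltW|rewrite Ntau].
have tau_small e : 0 < e -> exists n0, forall n, (n0 <= n)%N -> tau n < e.
  move=> e0; have /cvgrPdist_lt/(_ (e / h)) :
      (fun n => (2^-1 : R) ^+ n) @ \oo --> (0 : R).
    by apply: cvg_expr; rewrite ger0_norm// invf_lt1// ltr1n.
  rewrite divr_gt0// => /(_ isT)[n0 _ hn0]; exists n0 => n /hn0.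
  rewrite /= sub0r normrN ger0_norm ?exprn_ge0// ltr_pdivlMr// mulrC.
  by rewrite /tau /N natrX exprVn.
have rE n p x : r (n + p)%N x = r n (avg T (tau (n + p)%N) (N p) x).
  rewrite /r; have -> : tau n = (N p)%:R * tau (n + p)%N.
    rewrite /tau /N expnD natrM; field.
    by rewrite !pnatr_eq0 -!lt0n !expn_gt0.
  rewrite (avg_mul TC0) ?ltW//; congr (avg _ _ _ _).
  by rewrite /N expnD.
have rcvg x : exists y : V, r ^~ x @ \oo --> y.
  apply: cauchy_nrm => e e0.
  have eM : 0 < e / M / 2 by rewrite !divr_gt0.
  have [dl [dl0 dlx]] := C0_cont TC0 x eM.
  have [n hn] := tau_small _ dl0.
  exists n => m nm; rewrite -(subnKC nm) rE.
  set y := avg _ _ _ x.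
  have -> : r n y - r n x = r n (y - x).
    have := avg_linear T (tau n) (N n) (-1) x y.
    by rewrite !scaleN1r addrC [in RHS]addrC => <-.
  apply: (le_lt_trans (rM n _)).
  have : nrm (y - x) <= e / M / 2.
    apply: avg_sub_le => //; first exact: ltW.
    move=> t t0 tn; apply/ltW/dlx => //; apply: (le_trans tn).
    apply/ltW; apply: le_lt_trans (hn n (leqnn n)).
    rewrite (_ : tau n = (N (m - n)%N)%:R * tau (n + (m - n))%N)//.
    rewrite /tau /N expnD natrM; field.
    by rewrite !pnatr_eq0 -!lt0n !expn_gt0.
  rewrite -(ler_pM2l M0) => /le_lt_trans; apply.
  have -> : M * (e / M / 2) = e / 2 by field; rewrite gt_eqF.
  lra.
have [f fE] := choice rcvg.
have lf : linear f.
  move=> c x y; apply: (cvg_uniq (fE _)).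
  rewrite (_ : r ^~ (c *: x + y) = fun n => c *: r n x + r n y).
    by apply: cvgD; [apply: cvgZr; exact: fE|exact: fE].
  by apply/funext => n; exact: avg_linear.
have [A AE] := linear_of lf.
have AM x : nrm (A x) <= M * nrm x.
  by rewrite AE; apply: (nrm_lim_le (fE x)); apply: nearW => n; exact: rM.
exists A; split=> // [x w hw|t x t0 th].
  have : (fun n => r n x - x) @ \oo --> A x - x.
    by rewrite AE; apply: cvgB; [exact: fE|exact: cvg_cst].
  move=> /nrm_lim_le; apply; apply: nearW => n; apply: avg_sub_le => //.
    exact: ltW.
  by rewrite Ntau.
(* If the step divides t, the shifted sum and the sum differ only near the ends
   of the interval; the fractional part rho of t in units of the step contributes
   an error that vanishes with the step. *)
apply/ler_addgt0Pr => e e0.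
pose K := M * (M + 1) + M + (M + 1).
have K0 : 0 < K by rewrite /K; have := mulr_gt0 M0 M0; lra.
have eK : 0 < e / K by rewrite divr_gt0.
have [dl [dl0 dlx]] := C0_cont TC0 (A x) eK.
have [n1 hn1] := tau_small _ dl0.
have := cvg_nrm_lt (fE x) eK; rewrite -AE => /(_ _)[n2 _ hn2].
pose n := maxn n1 n2.
have := hn2 n (leq_maxr _ _); have := hn1 n (leq_maxl _ _).
rewrite /=; set y := r n x => tn Ay.
pose j := Num.truncn (t / tau n).
have [j1 j2] : j%:R * tau n <= t /\ t < j.+1%:R * tau n.
  have tt : 0 <= t / tau n by rewrite divr_ge0// ltW.
  by rewrite -ler_pdivlMr// -ltr_pdivrMr// truncn_le// truncnS_gt.
pose rho := t - j%:R * tau n.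
have rho0 : 0 <= rho by rewrite subr_ge0.
have rho1 : rho <= tau n by rewrite /rho -natr1 in j2 *; lra.
have jt0 : 0 <= j%:R * tau n by rewrite mulr_ge0// ltW.
have tE : t = j%:R * tau n + rho by rewrite /rho addrC subrK.
have jN : j%:R <= (N n)%:R * t / h.
  rewrite ler_pdivlMr// -[h](Ntau n) mulrCA ler_wpM2l// ?ler0n//.
have step : nrm (T (j%:R * tau n) y - y) <= 2 * M / h * t * nrm x.
  rewrite /y /r (avg_shift TC0 _ _ _ (ltW (tau0 n))).
  rewrite nrmZ nrmC ger0_norm ?invr_ge0// ler_pdivrMl ?ltr0n//.
  apply: (le_trans (nrm_sum _ _ _)); rewrite big_mkord.
  apply: (@le_trans _ _ (\sum_(i < j) (2 * M * nrm x))).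
    apply: ler_sum => i _; rewrite (le_trans (nrm_triangleB _ _))//.
    have ij : i%:R * tau n <= t.
      by apply: le_trans j1; rewrite ler_wpM2r ?ltW// ltr_nat.
    have it0 : 0 <= i%:R * tau n by rewrite mulr_ge0// ltW.
    have iN : (N n + i)%:R * tau n = h + i%:R * tau n by rewrite natrD mulrDl Ntau.
    have a1 : nrm (T ((N n + i)%:R * tau n) x) <= M * nrm x by apply: TM; rewrite iN; lra.
    have a2 : nrm (T (i%:R * tau n) x) <= M * nrm x by apply: TM => //; lra.
    lra.
  rewrite sumr_const card_ord -[_ *+ j]mulr_natl.
  apply: (@le_trans _ _ ((N n)%:R * t / h * (2 * M * nrm x))).
    by rewrite ler_wpM2r// !mulr_ge0 ?nrm_ge0// ltW.
  by rewrite le_eqVlt; apply/orP; left; apply/eqP; field; rewrite gt_eqF.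
have e1 : nrm (T t y - y) <= M * ((M + 1) * (e / K) + e / K) + 2 * M / h * t * nrm x.
  rewrite {1}tE TD// -(subrK (T (j%:R * tau n) y) (T _ (T _ _))) -addrA.
  rewrite (le_trans (nrm_triangle _ _))// lerD//.
  rewrite -linearB (le_trans (TM _ _ _))//; first by lra.
  rewrite ler_wpM2l ?(ltW M0)//.
  have -> : T rho y - y = (T rho (A x) - A x) - (T rho (A x - y) - (A x - y)).
    rewrite [T rho (A x - y)]linearB opprB -[A x - y - _]addrA subrKA opprB addrCA.
    by rewrite [T rho (A x) + _]addrC subrK addrC.
  rewrite (le_trans (nrm_triangleB _ _))// addrC lerD//.
    rewrite (le_trans (nrm_triangleB _ _))// mulrDl mul1r lerD//; last exact: ltW.
    rewrite (le_trans (TM _ _ _))//; first by lra.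
    by rewrite ler_wpM2l ?(ltW M0)// ltW.
  apply/ltW/dlx => //; lra.
have -> : T t (A x) - A x = T t (A x - y) + (T t y - y) - (A x - y).
  by rewrite linearB subrKA opprB subrKA.
have h1 : nrm (T t (A x - y)) <= M * (e / K).
  by rewrite (le_trans (TM _ _ _))//; [lra|rewrite ler_wpM2l ?(ltW M0) ?(ltW Ay)].
have h2 := nrm_triangleB (T t (A x - y) + (T t y - y)) (A x - y).
have h3 := nrm_triangle (T t (A x - y)) (T t y - y).
have h4 : e = K * (e / K) by rewrite mulrC divfK// gt_eqF.
rewrite h4 [in leRHS]/K; move: (e / K) h1 e1 Ay => q h1 e1 Ay; lra.
Qed.

End SemigroupAverages.

(** * The Lotz property from the failure of the CAP *)

(** With [A h = al + S], either some [al] is nonzero, and the identity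
    [al^2 = A h (al - S) + S S] spreads the norm convergence of
    [(T t - 1) (A h)] to the whole space, or all [al] vanish and the compact
    operators [A h (A h)] approximate the identity. *)
Theorem lotz_of_not_CAP (R : realType) (V : completeNormedModType R[i]) :
  scalar_plus_square_compact V -> ~ CAP V -> lotz V.
Proof.
move=> spsc nCAP T TC0.
have [M [d0 [M1 dd0 TM]]] := C0_semigroup_locally_bounded TC0.
have M0 : 0 < M by exact: lt_le_trans M1.
pose d := d0 / 2; have dp : 0 < d by rewrite divr_gt0.
have mean h : exists A : {linear V -> V}, 0 < h -> h <= d ->
  [/\ forall x, nrm (A x) <= M * nrm x,
      forall x (w : R), (forall t, 0 <= t -> t <= h -> nrm (T t x - x) <= w) ->
        nrm (A x - x) <= w
    & forall t x, 0 <= t -> t <= h ->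
        nrm (T t (A x) - A x) <= 2 * M / h * t * nrm x].
  have [/andP[h0 hd]|nh] := boolP ((0 < h) && (h <= d)); last first.
    by exists idfun => h0 hd; move: nh; rewrite h0 hd.
  have [|A AP] := semigroup_mean TC0 M1 TM h0; first by rewrite /d in hd; lra.
  by exists A.
have [A AP] := choice mean.
have dec h : exists p : R[i] * {linear V -> V}, 0 < h -> h <= d ->
    [/\ bounded_op p.2, compact_op (p.2 \o p.2) & forall y, A h y = p.1 *: y + p.2 y].
  have [/andP[h0 hd]|nh] := boolP ((0 < h) && (h <= d)); last first.
    by exists (0, (idfun : {linear V -> V})) => h0 hd; move: nh; rewrite h0 hd.
  have [AM _ _] := AP h h0 hd.
  have [|al [S SP]] := spsc (A h); first by exists M.
  by exists (al, S).
have [p pP] := choice dec.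
have T1lip t x y : 0 <= t -> t <= d0 ->
    nrm ((T t x - x) - (T t y - y)) <= (M + 1) * nrm (x - y).
  move=> t0 td; have -> : (T t x - x) - (T t y - y) = T t (x - y) - (x - y).
    by rewrite (linearB (T t)) !opprB addrACA [- x - _]addrC [RHS]addrACA.
  have := nrm_triangleB (T t (x - y)) (x - y); have := TM t (x - y) t0 td; lra.
have [[h [h0 hd nz]]|allz] :=
    pselect (exists h, [/\ 0 < h, h <= d & (p h).1 != 0]); last first.
  exfalso; apply: nCAP => C eps cC eps0.
  have e20 : 0 < eps / 2 by rewrite divr_gt0.
  have /nbhs_ballP[r /= r0 rE] : \forall h \near (0 : R)^'+,
      forall x, C x -> nrm (A h (A h x) - x) < eps / 2.
    apply: (@equilipschitz_cvg_compact R V V C R _ _ _ (M * M + 1) cC) => //.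
  - near=> h => x y.
    have h0 : 0 < h by near: h; exact: nbhs_right_gt.
    have hd : h <= d by apply/ltW; near: h; exact: nbhs_right_lt.
    have [AM _ _] := AP h h0 hd.
    have -> : A h (A h x) - x - (A h (A h y) - y) = A h (A h (x - y)) - (x - y).
      by rewrite !(linearB (A h)) !opprB addrACA [- x - _]addrC [RHS]addrACA.
    have h1 := nrm_triangleB (A h (A h (x - y))) (x - y).
    have h2 := AM (A h (x - y)).
    have := ler_wpM2l (ltW M0) (AM (x - y)); lra.
  - move=> x e e0.
    have eM : 0 < e / (M + 2) by rewrite divr_gt0// addr_gt0.
    have [dl [dl0 dlx]] := C0_cont TC0 x eM.
    near=> h.
    have h0 : 0 < h by near: h; exact: nbhs_right_gt.
    have hd : h <= d by apply/ltW; near: h; exact: nbhs_right_lt.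
    have hdl : h <= dl by apply/ltW; near: h; exact: nbhs_right_lt.
    have [AM Aosc _] := AP h h0 hd.
    have h1 : nrm (A h x - x) <= e / (M + 2).
      by apply: Aosc => t t0 th; apply/ltW/dlx => //; exact: le_trans hdl.
    have -> : A h (A h x) - x = A h (A h x - x) + (A h x - x) by rewrite linearB addrA subrK.
    have h2 := AM (A h x - x).
    have h3 := ler_wpM2l (ltW M0) h1.
    have h4 := nrm_triangle (A h (A h x - x)) (A h x - x).
    have h5 : e = (M + 2) * (e / (M + 2)) by rewrite mulrC divfK// gt_eqF// addr_gt0.
    rewrite [ltRHS]h5; move: (e / _) eM h1 h2 h3 h4 => q *; lra.
  pose h := Num.min (r / 2) d.
  have h0 : 0 < h by rewrite lt_min divr_gt0.
  have hd : h <= d by rewrite ge_min lexx orbT.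
  exists (A h \o A h); have [Sb Sc AE] := pP h h0 hd; split.
    have A2 x : (A h \o A h) x = ((p h).2 \o (p h).2) x.
      have a0 : (p h).1 = 0 by apply/eqP; apply: contrapT => /negP nz; apply: allz; exists h.
      by rewrite /= !AE a0 !scale0r !add0r.
    by rewrite /compact_op (eq_imagel (fun x _ => A2 x)).
  apply: (@le_lt_trans _ _ (eps / 2)%:E); last by rewrite lte_fin; lra.
  apply: ge_ereal_sup => _ [x Cx <-]; rewrite lee_fin; apply/ltW.
  apply: rE => //; rewrite /ball /= sub0r normrN gtr0_norm//.
  by rewrite gt_min; apply/orP; left; lra.
have [Sb Sc AE] := pP h h0 hd; have [AM _ AT] := AP h h0 hd.
set al := (p h).1 in nz AE; set S := (p h).2 in Sb Sc AE.
have [B [B0 SB]] := bounded_op_ge0 Sb.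
have na : 0 < nrm al := nrm_gt0 (nz : (al : R[i]^o) != 0).
have a2 : 0 < nrm al ^+ 2 by rewrite exprn_gt0.
apply/cvgrPdist_lt => e e0.
have e20 : 0 < e / 4 * nrm al ^+ 2 by rewrite mulr_gt0// divr_gt0.
pose D := 2 * M / h * (nrm al + B).
have D0 : 0 < D by rewrite /D mulr_gt0 ?addr_gt0 ?divr_gt0 ?mulr_gt0.
have /nbhs_ballP[r /= r0 rE] : \forall t \near (0 : R)^'+, forall x,
    closure [set (S \o S) x | x in [set x : V | nrm x <= 1]] x ->
    nrm (T t x - x) < e / 4 * nrm al ^+ 2.
  apply: (@equilipschitz_cvg_compact R V V _ R _ _ _ (M + 1) Sc) => //.
- near=> t => x y; apply: T1lip; first by apply/ltW; near: t; exact: nbhs_right_gt.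
  by apply/ltW; near: t; exact: nbhs_right_lt.
- move=> x e' e'0; have [dl [dl0 dlx]] := C0_cont TC0 x e'0.
  near=> t; apply: dlx; first by apply/ltW; near: t; exact: nbhs_right_gt.
  by apply/ltW; near: t; exact: nbhs_right_lt.
near=> t.
have t0 : 0 < t by near: t; exact: nbhs_right_gt.
have th : t <= h by apply/ltW; near: t; exact: nbhs_right_lt.
have tr : t < r by near: t; exact: nbhs_right_lt.
have tD : t < e / 4 * nrm al ^+ 2 / D by near: t; apply: nbhs_right_lt; rewrite divr_gt0.
have Tb : bounded_op (fun x => T t x - x).
  exists (M + 1) => x; rewrite mulrDl mul1r (le_trans (nrm_triangleB _ _))// lerD//.
  apply: TM; first exact: ltW.
  by apply: (le_trans th); apply: (le_trans hd); rewrite /d; lra.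
rewrite sub0r normrN ger0_norm ?op_norm_ge0//.
apply: (@le_lt_trans _ _ (e / 2)); last by lra.
apply: op_norm_le => // y y1.
pose y' := al *: y - S y.
have yE : (al ^+ 2) *: y = A h y' + S (S y).
  have -> : A h y' = al *: y' + S y' by exact: AE.
  have -> : S y' = al *: S y - S (S y) by rewrite /y' (linearB S) linearZ.
  by rewrite /y' scalerBr scalerA -expr2 subrKA subrK.
have TE : (al ^+ 2) *: (T t y - y) = (T t (A h y') - A h y') + (T t (S (S y)) - S (S y)).
  by rewrite scalerBr -linearZ /= yE linearD opprD addrACA.
have ny' : nrm y' <= nrm al + B.
  rewrite (le_trans (nrm_triangleB _ _))// lerD//.
    by rewrite nrmZ ler_piMr ?nrm_ge0.
  by apply: (le_trans (SB _)); rewrite ler_piMr// ltW.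
have h1 : nrm (T t (A h y') - A h y') <= e / 4 * nrm al ^+ 2.
  apply: (le_trans (AT t y' (ltW t0) th)).
  apply: (@le_trans _ _ (t * D)); last by apply/ltW; rewrite -ltr_pdivlMr.
  rewrite /D [leRHS]mulrC mulrAC ler_wpM2r ?(ltW t0)//.
  by rewrite ler_wpM2l// divr_ge0 ?mulr_ge0// ltW.
have h2 : nrm (T t (S (S y)) - S (S y)) < e / 4 * nrm al ^+ 2.
  apply: rE => //; first by rewrite /ball /= sub0r normrN gtr0_norm.
  by apply: subset_closure; exists y.
rewrite -(ler_pM2l a2).
have <- : nrm (al ^+ 2 : R[i]) = nrm al ^+ 2 by rewrite !expr2 nrmM.
rewrite -nrmZ TE (le_trans (nrm_triangle _ _))//.
have -> : nrm (al ^+ 2 : R[i]) = nrm al ^+ 2 by rewrite !expr2 nrmM.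
lra.
Unshelve. all: by end_near. Qed.

(** * Partial Walsh transforms on binary strings *)

Section Kernels.
Context (R : realType).

(** Strings grow at the end, so that a string of length [n.+1] is a pair and sums
    over strings can be split by [pair_bigA]. *)
Fixpoint bits (n : nat) : finType :=
  if n is m.+1 then (bits m * bool)%type else unit.

(** The kernel of a tensor product of [2 x 2] matrices, one for each position. *)
Fixpoint ker (f : nat -> bool -> bool -> R) (n : nat) : bits n -> bits n -> R :=
  match n with
  | 0 => fun _ _ => 1
  | m.+1 => fun a b => ker f a.1 b.1 * f m a.2 b.2
  end.

Lemma card_bits n : #|bits n| = (2 ^ n)%N.
Proof. by elim: n => [|n IH]; rewrite ?card_unit// card_prod IH card_bool expnSr. Qed.

Lemma ker_mul f g n (a c : bits n) :
  \sum_b ker f a b * ker g b c =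
  ker (fun p x y => \sum_z f p x z * g p z y) a c.
Proof.
elim: n a c => [|n IH] a c; first by rewrite (big_pred1 tt) ?mul1r// => -[].
rewrite -(pair_bigA _ (fun b z => ker f a.1 b * f n a.2 z * (ker g b c.1 * g n z c.2)))/=.
rewrite -IH mulr_suml; apply: eq_bigr => b _; rewrite mulr_sumr.
by apply: eq_bigr => z _; rewrite mulrACA.
Qed.

Lemma eq_ker f g n (a b : bits n) : (forall p x y, (p < n)%N -> f p x y = g p x y) ->
  ker f a b = ker g a b.
Proof.
elim: n a b => [//|n IH] a b fg /=; rewrite fg//; congr (_ * _).
by apply: IH => p x y pn; apply: fg; exact: ltnW.
Qed.

Lemma ker_sym f n (a b : bits n) : (forall p x y, f p x y = f p y x) ->
  ker f a b = ker f b a.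
Proof. by move=> fs; elim: n a b => [//|n IH] a b /=; rewrite IH fs. Qed.

Lemma norm_ker f n (a b : bits n) : `|ker f a b| = ker (fun p x y => `|f p x y|) a b.
Proof. by elim: n a b => [|n IH] a b /=; rewrite ?normr1// normrM IH. Qed.

Lemma ker_delta (f : nat -> bool -> bool -> R) (m : nat -> R) n (a b : bits n) :
  (forall p x y, f p x y = m p * (x == y)%:R) ->
  ker f a b = (\prod_(0 <= p < n) m p) * (a == b)%:R.
Proof.
move=> fE; elim: n a b => [|n IH] a b /=.
  by rewrite big_geq// mul1r; case: a b => [] [].
rewrite IH fE big_nat_recr//= mulrACA; congr (_ * _).
by case: a b => [a x] [b y] /=; rewrite xpair_eqE -natrM mulnb.
Qed.

Lemma sum_norm_ker f n (a : bits n) : (forall p x, \sum_y `|f p x y| = 1) ->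
  \sum_b `|ker f a b| = 1.
Proof.
move=> f1; elim: n a => [|n IH] a; first by rewrite (big_pred1 tt) ?normr1// => -[].
rewrite -(pair_bigA _ (fun b z => `|ker f a.1 b * f n a.2 z|))/= -(IH a.1).
apply: eq_bigr => b _; under eq_bigr do rewrite normrM.
by rewrite -mulr_sumr f1 mulr1.
Qed.

End Kernels.

Ltac eval_norms := repeat match goal with |- context [Num.norm ?x] =>
  first [rewrite (@ger0_norm _ x); [|by lra] | rewrite (@ler0_norm _ x); [|by lra]] end.

Section Transforms.
Context (R : realType).

Definition sgn (x y : bool) : R := if x && y then -1 else 1.
Definition dlt (x y : bool) : R := (x == y)%:R.

(** Colour classes of positions are residues modulo [12]. [synth c] is the
    normalized Walsh transform in the positions of colour other than [c],
    [analysis c] is its inverse, and [mix c] is the unnormalized Walsh transform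
    in the positions of colour [c]. *)
Definition synth (c p : nat) : bool -> bool -> R :=
  if (p %% 12 == c)%N then dlt else fun x y => 2^-1 * sgn x y.
Definition analysis (c p : nat) : bool -> bool -> R :=
  if (p %% 12 == c)%N then dlt else sgn.
Definition mix (c p : nat) : bool -> bool -> R :=
  if (p %% 12 == c)%N then sgn else dlt.

Lemma synth_sym c p x y : synth c p x y = synth c p y x.
Proof. by rewrite /synth /dlt /sgn; case: ifP => _; rewrite 1?eq_sym 1?andbC. Qed.
Lemma mix_sym c p x y : mix c p x y = mix c p y x.
Proof. by rewrite /mix /dlt /sgn; case: ifP => _; rewrite 1?eq_sym 1?andbC. Qed.

(** The number of strings of length [n] that agree with a given one outside of the
    positions of colour [c]. *)
Definition mult (c n : nat) : R := \prod_(0 <= p < n) (if (p %% 12 == c)%N then 2 else 1).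

Lemma analysis_synth c n (a b : bits n) :
  \sum_q ker (analysis c) a q * ker (synth c) q b = (a == b)%:R.
Proof.
rewrite ker_mul (@ker_delta _ _ (fun=> 1)) ?big1 ?mul1r// => p x y.
rewrite big_bool /analysis /synth /dlt /sgn; case: ifP => _;
  by case: x; case: y => /=; lra.
Qed.

Lemma mix_mix c n (a b : bits n) :
  \sum_k ker (mix c) a k * ker (mix c) k b = mult c n * (a == b)%:R.
Proof.
rewrite ker_mul; apply: ker_delta => p x y.
rewrite big_bool /mix /dlt /sgn; case: ifP => _;
  by case: x; case: y => /=; lra.
Qed.

Lemma norm_mix_analysis c n (k q : bits n) :
  `|\sum_i ker (mix c) k i * ker (analysis c) i q| = 1.
Proof.
rewrite ker_mul norm_ker.
rewrite (_ : ker _ _ _ = ker (fun _ _ _ => 1 : R) k q).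
  by elim: n k q => [//|n IH] k q /=; rewrite IH mulr1.
apply: eq_ker => p x y _; rewrite big_bool /mix /analysis /dlt /sgn.
by case: ifP => _; case: x; case: y => /=; eval_norms; lra.
Qed.

(** The reason for the colours: in the positions of colour [c] the two Walsh
    transforms cancel and leave a unit vector, elsewhere one of them is the
    identity. Thus a sum of [mult c n] basis vectors is no longer than one. *)
Lemma sum_norm_mix_synth c c' n (k : bits n) : c != c' ->
  \sum_q `|\sum_i ker (mix c) k i * ker (synth c') i q| = 1.
Proof.
move=> cc'; under eq_bigr do rewrite ker_mul.
apply: sum_norm_ker => p x; rewrite !big_bool /mix /synth /dlt /sgn.
case: ifP => [/eqP->|_]; first by rewrite (negPf cc'); case: x => /=; eval_norms; lra.
by case: ifP => _; case: x => /=; eval_norms; lra.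
Qed.

Lemma sum_norm_synth c p x : \sum_y `|synth c p x y| = 1.
Proof.
rewrite big_bool /synth /dlt /sgn.
by case: ifP => _; case: x => /=; eval_norms; lra.
Qed.

Lemma norm_analysis_le1 c n (a b : bits n) : `|ker (analysis c) a b| <= 1.
Proof.
rewrite norm_ker; elim: n a b => [//|n IH] a b /=.
apply: mulr_ile1; rewrite ?IH//; first by rewrite -norm_ker.
rewrite /analysis /dlt /sgn; case: ifP => _; case: (a.2); case: (b.2) => /=; eval_norms; lra.
Qed.

Lemma mult_ge c n : (c < 12)%N -> 2 ^+ (n %/ 12) <= mult c n.
Proof.
move=> c12.
have step a : mult c (12 * a.+1) = 2 * mult c (12 * a).
  rewrite /mult (@big_cat_nat _ _ _ (12 * a)%N) ?leq_mul//= mulrC; congr (_ * _).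
  rewrite mulnS addnC -{1}[(12 * a)%N]add0n big_addn addKn.
  under eq_bigr => i _ do rewrite addnC mulnC modnMDl.
  rewrite big_mkord !big_ord_recl big_ord0 /=.
  by do 12?[case: c c12 => [|c] c12; first by rewrite /= ?mulr1 ?mul1r].
have mono i j : (i <= j)%N -> mult c i <= mult c j.
  move=> /subnKC <-; elim: (j - i)%N => [|k IH]; first by rewrite addn0.
  apply: (le_trans IH); rewrite addnS /mult big_nat_recr//= ler_peMr//.
    by apply: prodr_ge0 => p _; case: ifP.
  by case: ifP => // _; rewrite ler1n.
apply: (@le_trans _ _ (mult c (12 * (n %/ 12)))); last by apply: mono; rewrite mulnC leq_divM.
elim: (n %/ 12)%N => [|a IH]; first by rewrite expr0 /mult muln0 big_geq.
by rewrite exprS step ler_wpM2l.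
Qed.

Lemma mult_gt0 c n : 0 < mult c n.
Proof. by apply: prodr_gt0 => p _; case: ifP. Qed.

(** The factor [1/m] gained at block [n] is at most [2 * rate ^+ (2 * n)], since
    [(1 - 1/48)^24 >= 1/2] by Bernoulli's inequality and a
    twelfth of the positions has a given colour. One factor [rate ^+ n] makes the
    series of differences converge, the other makes the vectors tend to [0]. *)
Definition rate : R := 1 - 48^-1.

Lemma rate_ge n : (2 ^+ (n %/ 12))^-1 <= 2 * (rate ^+ n * rate ^+ n).
Proof.
have r0 : 0 <= rate by rewrite /rate; lra.
have r1 : rate <= 1 by rewrite /rate; lra.
have bern k : 1 - k%:R / 48 <= rate ^+ k.
  elim: k => [|k IH]; first by rewrite mul0r subr0 expr0.
  have := ler_wpM2l r0 IH; have k0 : 0 <= k%:R :> R by [].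
  by rewrite exprS -[k.+1%:R]natr1; move: (rate ^+ k) => q; rewrite /rate; lra.
have r24 : 2^-1 <= rate ^+ 24 by have := bern 24; lra.
have -> : rate ^+ n * rate ^+ n = (rate ^+ 24) ^+ (n %/ 12) * rate ^+ (2 * (n %% 12)).
  rewrite -exprM -!exprD; congr (_ ^+ _); rewrite {1 2}(divn_eq n 12); ring.
have h1 : (2 ^+ (n %/ 12))^-1 <= (rate ^+ 24) ^+ (n %/ 12).
  by rewrite -exprVn lerXn2r// nnegrE// exprn_ge0.
have h2 : 2^-1 <= rate ^+ (2 * (n %% 12)).
  apply: (le_trans r24); rewrite ler_wiXn2l// -[24%N]/(2 * 12)%N leq_mul2l/= ltnW//.
  by rewrite ltn_mod.
have h3 : 0 <= (2 ^+ (n %/ 12))^-1 :> R by rewrite invr_ge0 exprn_ge0.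
have h4 := ler_pM h3 _ h1 h2; have {}h4 := h4 (ltac:(lra)); lra.
Qed.

End Transforms.

(** * Complex l1 estimates from spreading models *)

Section ComplexL1.
Context (R : realType) (V : normedModType R[i]) (N : nat) (x : 'I_N -> V).
Hypothesis x1 : forall j, nrm (x j) <= 1.
Hypothesis real_l1 : forall r : 'I_N -> R, (forall j, -1 <= r j <= 1) ->
  \sum_j `|r j| - 64^-1 <= nrm (\sum_j (r j)%:C *: x j).

Lemma nrm_complex_le (a b : R) : 2^-1 <= `|a| -> nrm (a +i* b : R[i]) <= `|a| + b ^+ 2.
Proof.
move=> a2; rewrite /nrm normc_def /=.
have h : 0 <= `|a| + b ^+ 2 by rewrite addr_ge0 ?sqr_ge0.
rewrite -[leRHS]ger0_norm// -sqrtr_sqr; apply: ler_wsqrtr.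
rewrite -[a ^+ 2]real_normK ?num_real//.
have h2 := sqr_ge0 b; have h3 := sqr_ge0 (b ^+ 2).
have := ler_wpM2r h2 a2; rewrite sqrrD; lra.
Qed.

Let real_part_le (c : 'I_N -> R[i]) :
  (forall j, `|complex.Re (c j)| <= 1) -> (forall j, `|complex.Im (c j)| <= 1) ->
  \sum_j `|complex.Re (c j)| <=
  nrm (\sum_j c j *: x j) + 4^-1 * \sum_j `|complex.Im (c j)| + 8^-1.
Proof.
move=> re1 im1.
pose s j : R := if 0 <= complex.Re (c j) then 1 else -1.
pose a j := complex.Re (c j); pose b j := complex.Im (c j).
(* All r j have modulus at least 1/2, where the norm of a complex number grows
   only quadratically with its imaginary part. *)
pose r j := 2^-1 * (s j + 2^-1 * a j).
have rE j : `|r j| = 2^-1 + 4^-1 * `|a j|.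
  by rewrite /r /s -/(a j); case: leP => h;
    [rewrite !ger0_norm|rewrite !ltr0_norm]; lra.
have a01 j : 0 <= `|a j| <= 1 by rewrite normr_ge0 re1.
have rr j : -1 <= r j <= 1.
  by rewrite -ler_norml rE; have /andP[] := a01 j; lra.
have split2 : \sum_j ((2 * r j)%:C : R[i]) *: x j =
    (\sum_j ((2^-1 * s j)%:C *: x j) + (4^-1)%:C *: \sum_j c j *: x j)
    + \sum_j (r j +i* (- (4^-1 * b j))) *: x j.
  rewrite scaler_sumr -!big_split/=; apply: eq_bigr => j _.
  rewrite scalerA -!scalerDl; congr (_ *: _).
  rewrite /r /a /b; case: (c j) => u v /=.
  by apply/eqP; rewrite eq_complex /=; apply/andP; split; apply/eqP; field.
have lo : 2 * (\sum_j `|r j| - 64^-1) <= nrm (\sum_j ((2 * r j)%:C : R[i]) *: x j).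
  under [X in _ <= nrm X]eq_bigr do rewrite (rmorphM (real_complex R)) -scalerA.
  rewrite -scaler_sumr nrmZ nrmC ger0_norm// ler_wpM2l// real_l1//.
have up1 : nrm (\sum_j ((2^-1 * s j)%:C *: x j)) <= \sum_(j < N) 2^-1.
  apply: (le_trans (nrm_sum _ _ _)); apply: ler_sum => j _.
  rewrite nrmZ nrmC -[leRHS]mulr1 ler_pM//; rewrite ?nrm_ge0//.
  by rewrite normrM /s; case: ifP => _; rewrite ?normrN normr1 mulr1 ger0_norm//; lra.
have up2 : nrm (\sum_j (r j +i* (- (4^-1 * b j))) *: x j) <=
    \sum_j (`|r j| + 16^-1 * `|b j|).
  apply: (le_trans (nrm_sum _ _ _)); apply: ler_sum => j _.
  rewrite nrmZ -[leRHS]mulr1 ler_pM ?nrm_ge0//.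
  apply: (le_trans (nrm_complex_le _ _)).
    by rewrite rE; have /andP[] := a01 j; lra.
  rewrite lerD2l sqrrN exprMn -[b j ^+ 2]real_normK ?num_real//.
  have h : 0 <= `|b j| by []. have := ler_wpM2r h (im1 j); rewrite -/(b j) expr2 mul1r; lra.
have := nrm_triangle (\sum_j ((2^-1 * s j)%:C *: x j) + (4^-1)%:C *: \sum_j c j *: x j)
  (\sum_j (r j +i* (- (4^-1 * b j))) *: x j).
rewrite -split2; have := nrm_triangle (\sum_j ((2^-1 * s j)%:C *: x j))
  ((4^-1)%:C *: \sum_j c j *: x j).
rewrite nrmZ nrmC ger0_norm ?invr_ge0//.
have sr : \sum_j `|r j| = \sum_(j < N) 2^-1 + 4^-1 * \sum_j `|a j|.
  by rewrite mulr_sumr -big_split/=; apply: eq_bigr => j _.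
rewrite big_split/= -mulr_sumr in up2.
rewrite -/(a _) -/(b _).
move: up1 up2 lo sr; rewrite /a /b.
move: (\sum_(j < N) 2^-1) (\sum_j `|r j|) (\sum_j `|complex.Re (c j)|) (\sum_j `|complex.Im (c j)|)
  (nrm (\sum_j c j *: x j)) => q1 q2 q3 q4 q5; lra.
Qed.

(** A sequence whose real combinations are almost those of [l1] also dominates
    complex coefficients: a perturbation of size [t] in an imaginary direction
    costs only [O(t^2)], while one in a real direction is felt to first order. *)
Lemma complex_l1 (c : 'I_N -> R[i]) :
  \sum_j nrm (c j) <= 4 * nrm (\sum_j c j *: x j).
Proof.
pose S := \sum_j (`|complex.Re (c j)| + `|complex.Im (c j)|).
have S0 : 0 <= S by apply: sumr_ge0 => j _; rewrite addr_ge0.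
have cS : \sum_j nrm (c j) <= S.
  apply: ler_sum => j _; case: (c j) => a b /=.
  have -> : (a +i* b) = a%:C + 'i * b%:C :> R[i] by simpc.
  apply: (le_trans (@nrm_triangle R R[i]^o _ _)); rewrite nrmM !nrmC.
  by rewrite nrmi mul1r.
apply: (le_trans cS).
have [S00|Sn0] := eqVneq S 0; first by rewrite S00 mulr_ge0// nrm_ge0.
have Sp : 0 < S by rewrite lt_neqAle eq_sym Sn0.
have leS j : `|complex.Re (c j)| + `|complex.Im (c j)| <= S.
  by rewrite /S (bigD1 j)//= lerDl sumr_ge0// => k _; rewrite addr_ge0.
pose d j : R[i] := (S^-1)%:C * c j.
have reS j : `|complex.Re (d j)| = S^-1 * `|complex.Re (c j)|.
  by rewrite /d; case: (c j) => a b /=; rewrite mul0r subr0 normrM ger0_norm ?invr_ge0.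
have imS j : `|complex.Im (d j)| = S^-1 * `|complex.Im (c j)|.
  by rewrite /d; case: (c j) => a b /=; rewrite mul0r addr0 normrM ger0_norm ?invr_ge0.
have re1 j : `|complex.Re (d j)| <= 1.
  by rewrite reS ler_pdivrMl// mulr1 (le_trans _ (leS j))// lerDl.
have im1 j : `|complex.Im (d j)| <= 1.
  by rewrite imS ler_pdivrMl// mulr1 (le_trans _ (leS j))// lerDr.
have h1 := real_part_le re1 im1.
(* Multiplication by - i exchanges the roles of real and imaginary parts. *)
pose d' j : R[i] := - 'i * d j.
have reI j : complex.Re (d' j) = complex.Im (d j).
  by rewrite /d'; case: (d j) => a b /=; ring.
have imI j : complex.Im (d' j) = - complex.Re (d j).
  by rewrite /d'; case: (d j) => a b /=; ring.
have h2 : \sum_j `|complex.Re (d' j)| <=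
    nrm (\sum_j d' j *: x j) + 4^-1 * \sum_j `|complex.Im (d' j)| + 8^-1.
  by apply: real_part_le => j; rewrite ?reI ?imI ?normrN.
have -> : S = S * \sum_j (`|complex.Re (d j)| + `|complex.Im (d j)|).
  under eq_bigr do rewrite reS imS -mulrDr.
  by rewrite -mulr_sumr -/S mulrA divff// mul1r.
have yE : nrm (\sum_j d' j *: x j) = nrm (\sum_j d j *: x j).
  under eq_bigr do rewrite -scalerA.
  rewrite -scaler_sumr nrmZ.
  by rewrite nrmNi mul1r.
have dE : nrm (\sum_j c j *: x j) = S * nrm (\sum_j d j *: x j).
  under [in RHS]eq_bigr do rewrite -scalerA.
  by rewrite -scaler_sumr nrmZ nrmC ger0_norm ?invr_ge0// mulrA divff// mul1r.
rewrite dE mulrCA ler_pM2l//.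
have one : \sum_j `|complex.Re (d j)| + \sum_j `|complex.Im (d j)| = 1.
  rewrite -big_split/=; under eq_bigr do rewrite reS imS -mulrDr.
  by rewrite -mulr_sumr -/S mulVf.
have s1 : \sum_j `|complex.Re (d' j)| = \sum_j `|complex.Im (d j)|.
  by apply: eq_bigr => j _; rewrite reI.
have s2 : \sum_j `|complex.Im (d' j)| = \sum_j `|complex.Re (d j)|.
  by apply: eq_bigr => j _; rewrite imI normrN.
rewrite s1 s2 yE in h2; rewrite big_split/=.
move: h1 h2 one; move: (\sum_j `|complex.Re (d j)|) (\sum_j `|complex.Im (d j)|).
move=> q1 q2; lra.
Qed.

End ComplexL1.

Section SpreadingModels.
Context (R : realType) (V : normedModType R[i]).

Lemma nrm_l1_units (N : nat) (a : 'I_N -> R) :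
  \sum_j `|a j| <= nrm (\sum_(j < N) (a j)%:C *: l1_unit R j).
Proof.
pose v : l1 R := \sum_(j < N) (a j)%:C *: l1_unit R j.
rewrite -[X in _ <= nrm X]/v.
have vE (m : 'I_N) : v m = (a m)%:C.
  have coord : {morph (fun w : l1 R => w m) : x y / x + y} by [].
  rewrite /v (big_morph _ coord (erefl _ : (0 : l1 R) m = 0)).
  rewrite (bigD1 m)//= big1 => [|j jm].
    by rewrite addr0 -[LHS]/((a m)%:C * (m == m :> nat)%:R) eqxx mulr1.
  rewrite -[LHS]/((a j)%:C * (m == j :> nat)%:R).
  by rewrite (_ : (m == j :> nat) = false) ?mulr0//; apply/negbTE; rewrite eq_sym.
have nd : nondecreasing_seq (series (fun k => nrm (v k))).
  by apply/nondecreasing_seqP => k; rewrite seriesSr lerDl nrm_ge0.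
have := nondecreasing_cvgn_le nd (@l1_cvg _ v) N.
rewrite -[limn _]/(complex.Re (l1_norm v)); apply: le_trans.
rewrite /series/= big_mkord; apply: ler_sum => j _; rewrite vE.
by rewrite (nrmC (a j)).
Qed.

Lemma spreading_model_l1 (x : nat -> V) (N : nat) : (forall n, nrm (x n) = 1) ->
  generates_spreading_model x (@l1_unit R) ->
  exists g : 'I_N -> nat,
    forall c : 'I_N -> R[i], \sum_j nrm (c j) <= 4 * nrm (\sum_j c j *: x (g j)).
Proof.
move=> x1 [_ _ sm]; have [|n0 h] := sm N (64^-1); first by rewrite invr_gt0.
exists (fun j => n0 + j)%N; apply: complex_l1 => [j|r r1]; first by rewrite x1.
have := h (fun j : 'I_N => n0 + j)%N _ _ r r1 => /(_ _ _)/ltW.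
rewrite ler_norml => hh.
have {hh} := hh (fun i j => ltac:(by rewrite ltn_add2l)) (fun i => leq_addr _ _).
by have := nrm_l1_units r => h2 /andP[h3 _]; lra.
Qed.

End SpreadingModels.

(** * Kernels of functionals and finite norming sets *)

Section FiniteCodimension.
Context (R : realType) (X : completeNormedModType R[i]).

Lemma dual_kernel (f : dual X) : exists W : closedSubspace X,
  forall x, cs_set W x <-> f x = 0.
Proof.
have sm : submod_closed (fun x : X => x \in [set x | f x = 0]).
  split; first by apply/mem_set; exact: dual0.
  move=> a x y /set_mem/= fx /set_mem/= fy; apply/mem_set => /=.
  by rewrite dualD dualZ fx fy mulr0 addr0.
have cl : closed [set x | f x = 0].
  have [M [M0 fM]] := bounded_op_ge0 (dual_bounded f).
  move=> x /nrm_closedP xA.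
  apply: (@nrm_eq0 R R[i]^o); apply/eqP; rewrite eq_le nrm_ge0 andbT.
  apply/ler_addgt0Pr => e e0; rewrite add0r.
  have [y [fy xy]] := xA (e / M) (divr_gt0 e0 M0).
  have -> : f x = f (x - y) by rewrite dualB fy subr0.
  by apply: (le_trans (fM _)); rewrite mulrC -ler_pdivlMr// ltW.
by exists (ClosedSubspace sm cl).
Qed.

(** If a finite set spans the kernel of [f] in [W], then one more vector, outside
    of the kernel, makes it span [W]. *)
Lemma kernel_infinite_dimensional (W : closedSubspace X) (f : dual X) :
  infinite_dimensional W -> exists W' : closedSubspace X,
    infinite_dimensional W' /\ forall x, cs_set W' x <-> cs_set W x /\ f x = 0.
Proof.
move=> iW.
have [K KE] := dual_kernel f.
have sm : submod_closed (fun x : X => x \in cs_set W `&` cs_set K).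
  split; first by apply/mem_set; split; exact: cs0.
  move=> a x y /set_mem[Wx Kx] /set_mem[Wy Ky]; apply/mem_set.
  by split; exact: csP.
have cl : closed (cs_set W `&` cs_set K) by apply: closedI; exact: cs_closed.
exists (ClosedSubspace sm cl); split; last first.
  by move=> x; split=> -[Wx Kx]; split=> //; apply/KE.
move=> [B [finB spanB]]; apply: iW.
set W' := ClosedSubspace sm cl in B finB spanB.
have [w0 w0P] : exists w0 : W, forall w : W, exists c : R[i],
    f (cs_val (w - c *: w0)) = 0.
  have [[w0 fw0]|allz] := pselect (exists w0 : W, f (cs_val w0) <> 0).
    exists w0 => w; exists (f (cs_val w) / f (cs_val w0)).
    by rewrite cs_valB cs_valZ dualB dualZ divfK ?subrr//; apply/eqP.
  exists 0 => w; exists 0; rewrite scaler0 subr0.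
  by apply: contrapT => h; apply: allz; exists w.
pose j (v : W') : W := cs_mk (proj1 (cs_val_set v : cs_set W (cs_val v) /\ _)).
exists (w0 |` (j @` B)); split.
  by rewrite finite_setU; split; [exact: finite_set1|exact: finite_image].
apply/seteqP; split=> // w _; have [c cw] := w0P w.
have Aw : cs_set W' (cs_val (w - c *: w0)) by split; [exact: cs_val_set|exact/KE].
have : lin_span B (cs_mk Aw) by rewrite spanB.
move=> [n [d [v [Bv vE]]]].
exists n.+1, (fun i => if unlift ord0 i is Some k then d k else c),
  (fun i => if unlift ord0 i is Some k then j (v k) else w0); split.
  by move=> i; case: unliftP => [k _|_]; [right; exists (v k)|left].
rewrite big_ord_recl unlift_none; under eq_bigr do rewrite liftK.
apply: cs_inj; rewrite cs_valD cs_val_sum.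
have -> : \sum_(i < n) cs_val (d i *: j (v i)) = cs_val (\sum_(i < n) d i *: v i).
  by rewrite cs_val_sum.
by rewrite -vE cs_valZ -[cs_val (cs_mk Aw)]/(cs_val (w - c *: w0)) cs_valB cs_valZ addrC subrK.
Qed.

Lemma kernels_infinite_dimensional (W : closedSubspace X) (Phi : seq (dual X)) :
  infinite_dimensional W -> exists W' : closedSubspace X,
    infinite_dimensional W' /\
    forall x, cs_set W' x -> cs_set W x /\ forall f, List.In f Phi -> f x = 0.
Proof.
elim: Phi W => [|f Phi IH] W iW; first by exists W.
have [W1 [iW1 W1E]] := kernel_infinite_dimensional f iW.
have [W2 [iW2 W2E]] := IH W1 iW1; exists W2; split=> // x /W2E[/W1E[Wx fx] h].
by split=> // g /= [<-|]//; exact: h.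
Qed.

End FiniteCodimension.

Section Norming.
Context (R : realType).

Lemma complex_net (K d : R) : 0 < d -> exists (p : nat) (G : 'I_p -> R[i]),
  forall c : R[i], nrm c <= K -> exists t, nrm (c - G t) <= d + d.
Proof.
move=> d0; pose m := Num.bound (`|K| / d).
have mK : `|K| <= m%:R * d.
  by rewrite -ler_pdivrMr//; apply/ltW/Num.Theory.archi_boundP; rewrite divr_ge0// ltW.
(* The net is a square grid of mesh d, shifted by m d to have natural indices. *)
pose q := (2 * m).+1.
have near1 (x : R) : `|x| <= K -> exists k : 'I_q, `|x - (k%:R - m%:R) * d| <= d.
  rewrite ler_norml => /andP[x1 x2]; have Kn := ler_norm K.
  have xm0 : 0 <= (x + m%:R * d) / d by rewrite divr_ge0 ?(ltW d0)//; lra.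
  have := truncn_itv xm0; set k := Num.truncn _ => /andP[k1 k2].
  have kq : (k < q)%N.
    rewrite ltnS -(ler_nat R); apply: (le_trans k1).
    by rewrite ler_pdivrMr// natrM; lra.
  exists (Ordinal kq); rewrite /= ler_norml; rewrite ler_pdivlMr// in k1.
  rewrite ltr_pdivrMr// -[k.+1%:R]natr1 in k2; apply/andP; split; lra.
exists (q * q)%N, (fun t => let p := enum_val (cast_ord (esym (etrans (card_prod 'I_q 'I_q)
  (congr2 muln (card_ord q) (card_ord q)))) t) in
  ((p.1%:R - m%:R) * d) +i* ((p.2%:R - m%:R) * d)).
case=> a b cK.
have aK : `|a| <= K by apply: le_trans cK; exact: (Re_le_nrm (a +i* b)).
have bK : `|b| <= K.
  apply: le_trans cK; have h : complex.Re (- 'i * (a +i* b)) = b by rewrite /=; ring.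
  have := Re_le_nrm (- 'i * (a +i* b)); rewrite h nrmM.
  by rewrite nrmNi mul1r.
have [k1 h1] := near1 a aK; have [k2 h2] := near1 b bK.
set E := etrans _ _; exists (cast_ord E (enum_rank (k1, k2))).
rewrite cast_ordK enum_rankK /=.
set u := _ * d in h1 *; set v := _ * d in h2 *.
have -> : (a +i* b) - (u +i* v) = (a - u)%:C + 'i * (b - v)%:C :> R[i].
  by apply/eqP; rewrite eq_complex /=; apply/andP; split; apply/eqP; ring.
apply: (le_trans (@nrm_triangle R R[i]^o _ _)); rewrite nrmM !nrmC lerD//.
by rewrite nrmi mul1r.
Qed.

(** Mazur's trick: finitely many functionals norm a finite-dimensional subspace up
    to a factor [2], because its unit sphere is totally bounded. *)
Lemma finite_norming_set (X : normedModType R[i]) (T : finType) (g : T -> X) (K : R) :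
  (forall t, nrm (g t) <= 1) ->
  (forall (c : T -> R[i]) t, nrm (c t) <= K * nrm (\sum_t c t *: g t)) ->
  exists Phi : seq (dual X), forall (c : T -> R[i]) (y : X),
    (forall f, List.In f Phi -> f y = 0) ->
    nrm (\sum_t c t *: g t) <= 2 * nrm (\sum_t c t *: g t + y).
Proof.
move=> g1 gK; pose d : R := (8 * (#|T|%:R + 1))^-1.
have T1 : 0 < #|T|%:R + 1 :> R by rewrite ltr_wpDl.
have d0 : 0 < d by rewrite invr_gt0 mulr_gt0.
have [p [G GP]] := complex_net K d0.
pose v (s : {ffun T -> 'I_p}) : X := \sum_t G (s t) *: g t.
have [F FP] := choice (fun s => norming_functional (v s)).
exists [seq F s | s <- enum {: {ffun T -> 'I_p}}] => c y killed.
set x := \sum_t _.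
have [->|x0] := eqVneq x 0; first by rewrite nrm0 mulr_ge0 ?nrm_ge0.
have nx := nrm_gt0 x0.
pose c' t := ((nrm x)^-1)%:C * c t.
have xE : \sum_t c' t *: g t = ((nrm x)^-1)%:C *: x.
  by rewrite scaler_sumr; apply: eq_bigr => t _; rewrite scalerA.
have nx' : nrm (((nrm x)^-1)%:C *: x) = 1.
  by rewrite nrmZ nrmC ger0_norm ?invr_ge0 ?nrm_ge0// mulVf// gt_eqF.
have c'K t : nrm (c' t) <= K by have := gK c' t; rewrite xE nx' mulr1.
have [s sP] := choice (fun t => GP (c' t) (c'K t)).
have h1 : nrm (((nrm x)^-1)%:C *: x - v (finfun s)) <= 4^-1.
  rewrite -xE /v -sumrB; apply: (le_trans (nrm_sum _ _ _)).
  apply: (@le_trans _ _ (\sum_(t : T) (d + d))).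
    apply: ler_sum => t _; rewrite -scalerBl nrmZ -[leRHS]mulr1 ler_pM ?nrm_ge0//.
    by rewrite ffunE.
  rewrite sumr_const -[_ *+ _]mulr_natl /d.
  rewrite -mulr2n -[_ *+ 2]mulr_natl invfM mulrCA mulrA -(ler_pM2r T1) -!mulrA mulVf ?gt_eqF//.
  by rewrite mulr1; have : 0 <= #|T|%:R :> R by []; lra.
have sin : List.In (finfun s) (enum {: {ffun T -> 'I_p}}).
  have : (finfun s) \in enum {: {ffun T -> 'I_p}} by rewrite mem_enum.
  by elim: (enum _) => //= a l IH; rewrite inE => /predU1P[->|/IH]; [left|right].
have Fy := killed _ (List.in_map F _ _ sin); have [Fv Fb] := FP (finfun s).
set w := v _ in h1 Fv; set f := F _ in Fy Fv Fb.
have h2 : nrm (f (((nrm x)^-1)%:C *: x - w)) <= 4^-1 by exact: le_trans (Fb _) h1.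
have h3 : 1 - 4^-1 <= nrm w.
  have := nrm_subr (((nrm x)^-1)%:C *: x) w; rewrite nx'; lra.
have h4 : 2^-1 <= nrm (f (((nrm x)^-1)%:C *: x)).
  set x' := _ *: x in h2 *.
  have := @nrm_triangle R R[i]^o (f (w - x')) (f x').
  have -> : f (w - x') + f x' = (nrm w)%:C by rewrite dualB subrK Fv.
  have -> : nrm (f (w - x') : R[i]^o) = nrm (f (x' - w)).
    by rewrite dualB [in RHS]dualB; exact: (@nrm_distC R R[i]^o).
  rewrite nrmC ger0_norm ?nrm_ge0//; lra.
have h5 : nrm (f x) <= nrm (x + y).
  by have := Fb (x + y); rewrite dualD Fy addr0.
rewrite dualZ nrmM nrmC ger0_norm ?invr_ge0 ?nrm_ge0// in h4.
rewrite ler_pdivlMl// in h4.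
by have := nrm_ge0 x; lra.
Qed.

End Norming.

(** * Uniformly complemented blocks of l1 type *)

Section BlockSums.
Context (R : realType) (X : normedModType R[i]) (N : nat -> nat).

Definition bsum (g : nat -> nat -> X) (c : nat -> nat -> R[i]) (m n : nat) : X :=
  \sum_(m <= k < n) \sum_(0 <= j < N k) c k j *: g k j.

Lemma bsum_cat g c m n p : (m <= n)%N -> (n <= p)%N ->
  bsum g c m p = bsum g c m n + bsum g c n p.
Proof. by move=> mn np; rewrite /bsum (@big_cat_nat _ _ _ n). Qed.

Lemma eq_bsum g g' c m n : (forall k, (m <= k < n)%N -> g k = g' k) ->
  bsum g c m n = bsum g' c m n.
Proof.
move=> gg; apply: eq_big_nat => k /gg gk.
by apply: eq_bigr => j _; rewrite gk.
Qed.

Lemma bsum_linear g a c d n :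
  bsum g (fun k j => a * c k j + d k j) 0 n = a *: bsum g c 0 n + bsum g d 0 n.
Proof.
rewrite /bsum scaler_sumr -big_split/=; apply: eq_bigr => k _.
rewrite scaler_sumr -big_split/=; apply: eq_bigr => j _.
by rewrite scalerDl scalerA.
Qed.

Lemma bsum_widen g c n p : (n <= p)%N ->
  bsum g c 0 n = bsum g (fun k j => if (k < n)%N then c k j else 0) 0 p.
Proof.
move=> np; rewrite [RHS](@bsum_cat _ _ 0%N n p)// [X in _ + X]big_nat_cond big1 ?addr0.
  apply: eq_big_nat => k /andP[_ kn].
  by apply: eq_bigr => j _; rewrite kn.
move=> k; rewrite andbT => /andP[nk _]; rewrite big1// => j _.
by rewrite ltnNge nk scale0r.
Qed.

Lemma finite_norming_blocks (g : nat -> nat -> X) (n : nat) (K : R) :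
  (forall k j, nrm (g k j) <= 1) ->
  (forall c k j, (k < n)%N -> (j < N k)%N -> nrm (c k j) <= K * nrm (bsum g c 0 n)) ->
  exists Phi : seq (dual X), forall c (y : X),
    (forall f, List.In f Phi -> f y = 0) ->
    nrm (bsum g c 0 n) <= 2 * nrm (bsum g c 0 n + y).
Proof.
move=> g1 gK.
pose T : finType := {k : 'I_n & 'I_(N k)}.
have sumE (c : nat -> nat -> R[i]) :
    bsum g c 0 n = \sum_(t : T) c (tag t) (tagged t) *: g (tag t) (tagged t).
  rewrite /bsum big_mkord; under eq_bigr do rewrite big_mkord.
  exact: (@sig_big_dep _ _ _ 'I_n (fun k => 'I_(N k)) predT (fun=> predT)
    (fun k j => c k j *: g k j)).
have lift (c : {k : 'I_n & 'I_(N k)} -> R[i]) : exists d : nat -> nat -> R[i],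
    forall t : {k : 'I_n & 'I_(N k)}, d (tag t) (tagged t) = c t.
  exists (fun k j => if (insub k : option 'I_n) is Some k' then
    if (insub j : option 'I_(N k')) is Some j' then
      c (existT (fun k : 'I_n => 'I_(N k)) k' j') else 0 else 0).
  by case=> k j /=; rewrite !valK.
have [||Phi PhiP] := @finite_norming_set R X T
    (fun t => g (tag t) (tagged t)) K.
- by move=> t; exact: g1.
- move=> c t; have [d dE] := lift c; rewrite -dE.
  under eq_bigr do rewrite -dE.
  by rewrite -(sumE d); apply: gK.
exists Phi => c y /PhiP; rewrite sumE; exact.
Qed.

End BlockSums.

Section Blocks.
Context (R : realType) (X : completeNormedModType R[i]) (Y : set X) (N : nat -> nat).

Hypothesis l1_far_away : forall (Phi : seq (dual X)) (n : nat), exists g : nat -> X,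
  [/\ forall j, Y (g j), forall j, nrm (g j) <= 1,
      forall f j, List.In f Phi -> f (g j) = 0
    & forall c : nat -> R[i],
        \sum_(0 <= j < n) nrm (c j) <= 4 * nrm (\sum_(0 <= j < n) c j *: g j)].

(** Each block is chosen in the kernel of finite norming sets for the spans of all
    initial segments of the earlier blocks. The norm of an initial partial sum is
    then at most twice the norm of the whole sum, so every block is a difference
    of two controlled partial sums. *)
Theorem l1_blocks : exists g : nat -> nat -> X,
  [/\ forall k j, Y (g k j), forall k j, nrm (g k j) <= 1
    & forall c n M, (n < M)%N ->
        \sum_(0 <= j < N n) nrm (c n j) <= 16 * nrm (bsum N g c 0 M)].
Proof.
pose at_ (gs : seq (nat -> X)) k := nth (fun=> 0) gs k.
pose ok (gs : seq (nat -> X)) := forall c k j, (k < size gs)%N -> (j < N k)%N ->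
  nrm (c k j) <= 16 * nrm (bsum N (at_ gs) c 0 (size gs)).
pose norms (gs : seq (nat -> X)) (Phi : seq (dual X)) := forall c y,
  (forall f, List.In f Phi -> f y = 0) ->
  nrm (bsum N (at_ gs) c 0 (size gs)) <= 2 * nrm (bsum N (at_ gs) c 0 (size gs) + y).
have NFex gs : exists Phi, (forall k j, nrm (at_ gs k j) <= 1) -> ok gs -> norms gs Phi.
  have [g1|] := pselect (forall k j, nrm (at_ gs k j) <= 1); last by exists [::].
  have [okg|] := pselect (ok gs); last by exists [::].
  by have [Phi PhiP] := finite_norming_blocks g1 okg; exists Phi.
have [NF NFP] := choice NFex.
have newex gs : exists g : nat -> X,
  [/\ forall j, Y (g j), forall j, nrm (g j) <= 1,
      forall m f j, (m <= size gs)%N -> List.In f (NF (take m gs)) -> f (g j) = 0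
    & forall c : nat -> R[i], \sum_(0 <= j < N (size gs)) nrm (c j) <=
        4 * nrm (\sum_(0 <= j < N (size gs)) c j *: g j)].
  have [g [gY g1 gk gl]] := l1_far_away
    (List.flat_map (fun m => NF (take m gs)) (iota 0 (size gs).+1)) (N (size gs)).
  exists g; split=> // m f j ms fin; apply: gk; apply/List.in_flat_map; exists m; split=> //.
  have : m \in iota 0 (size gs).+1 by rewrite mem_iota.
  by elim: (iota _ _) => //= a l IH; rewrite inE => /predU1P[->|/IH]; [left|right].
have [new newP] := choice newex.
pose L := fix L n := if n is m.+1 then rcons (L m) (new (L m)) else [::].
pose g k := new (L k).
have LS n : L n.+1 = rcons (L n) (new (L n)) by [].
have sizeL n : size (L n) = n by elim: n => // n IH; rewrite LS size_rcons IH.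
have nthL n k : (k < n)%N -> at_ (L n) k = g k.
  elim: n => // n IH; rewrite ltnS leq_eqVlt LS /at_ nth_rcons sizeL.
  by move=> /predU1P[->|kn]; [rewrite ltnn eqxx|rewrite kn -IH].
have takeL n m : (m <= n)%N -> take m (L n) = L m.
  elim: n => [|n IH]; first by rewrite leqn0 => /eqP->.
  rewrite leq_eqVlt => /predU1P[->|mn]; first by rewrite -{1}(sizeL n.+1) take_size.
  by rewrite -IH// LS -cats1 takel_cat// sizeL.
have gY k j : Y (g k j) by have [h _ _ _] := newP (L k); exact: h.
have g1 k j : nrm (g k j) <= 1 by have [_ h _ _] := newP (L k); exact: h.
have gkill m k f j : (m <= k)%N -> List.In f (NF (L m)) -> f (g k j) = 0.
  move=> mk; rewrite -(takeL _ _ mk); have [_ _ h _] := newP (L k).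
  by apply: h; rewrite sizeL.
have gl k (c : nat -> R[i]) :
    \sum_(0 <= j < N k) nrm (c j) <= 4 * nrm (\sum_(0 <= j < N k) c j *: g k j).
  by have [_ _ _ h] := newP (L k); have := h c; rewrite sizeL.
have bL c m : bsum N (at_ (L m)) c 0 m = bsum N g c 0 m.
  by apply: eq_bsum => k /andP[_ km]; exact: nthL.
have proj_of m n c : (m <= n)%N ->
    (forall y, (forall f, List.In f (NF (L m)) -> f y = 0) ->
      nrm (bsum N g c 0 m) <= 2 * nrm (bsum N g c 0 m + y)) ->
    nrm (bsum N g c 0 m) <= 2 * nrm (bsum N g c 0 n).
  move=> mn h; rewrite (bsum_cat _ _ _ (leq0n m) mn); apply: h => f fin.
  rewrite dual_sum big_nat_cond big1// => k; rewrite andbT => /andP[mk _].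
  by rewrite dual_sum big1// => j _; rewrite dualZ (gkill _ _ _ _ mk fin) mulr0.
have coef_of M c n : (n < M)%N ->
    (forall m, (m <= M)%N -> nrm (bsum N g c 0 m) <= 2 * nrm (bsum N g c 0 M)) ->
    \sum_(0 <= j < N n) nrm (c n j) <= 16 * nrm (bsum N g c 0 M).
  move=> nM h; apply: (le_trans (gl n (c n))).
  have -> : \sum_(0 <= j < N n) c n j *: g n j = bsum N g c 0 n.+1 - bsum N g c 0 n.
    by rewrite (bsum_cat _ _ _ (leq0n n) (leqnSn n)) addrAC subrr add0r /bsum big_nat1.
  have := nrm_triangleB (bsum N g c 0 n.+1) (bsum N g c 0 n).
  have := h _ nM; have := h _ (ltnW nM); lra.
(* The norming property of NF (L m) needs coefficient bounds on the first m
   blocks, which come from the same property for smaller m. *)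
have B m : forall c y, (forall f, List.In f (NF (L m)) -> f y = 0) ->
    nrm (bsum N g c 0 m) <= 2 * nrm (bsum N g c 0 m + y).
  elim/ltn_ind: m => m IH c y killed.
  have := NFP (L m); rewrite /norms /ok sizeL.
  move=> /(_ _ _ c y killed); rewrite !bL; apply=> {c y killed} [k j|c k j km jN].
    have [km|mk] := ltnP k m; first by rewrite nthL.
    by rewrite /at_ nth_default ?sizeL// nrm0.
  rewrite bL; apply: le_trans (coef_of m c k km _).
    rewrite (bigD1_seq j) ?mem_index_iota ?iota_uniq//= lerDl sumr_ge0// => i _.
    exact: nrm_ge0.
  move=> m'; rewrite leq_eqVlt => /predU1P[->|m'm].
    by have := nrm_ge0 (bsum N g c 0 m); lra.
  by apply: proj_of => [|y]; [exact: ltnW|exact: IH].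
exists g; split=> // c n M nM; apply: coef_of => // m mM.
by apply: proj_of => // y; exact: B.
Qed.

(** On the span of the blocks every bounded assignment on one block, and zero on
    the others, is the restriction of a functional of controlled norm. *)
Lemma block_functional (g : nat -> nat -> X) (n : nat) (a : nat -> R) :
  (forall c n M, (n < M)%N ->
     \sum_(0 <= j < N n) nrm (c n j) <= 16 * nrm (bsum N g c 0 M)) ->
  (forall j, `|a j| <= 1) ->
  exists f : dual X, (forall v, nrm (f v) <= 16 * nrm v) /\
    forall k j, (j < N k)%N -> f (g k j) = if k == n then (a j)%:C else 0.
Proof.
move=> gl a1.
pose val c M : R[i] := if (n < M)%N then \sum_(0 <= j < N n) c n j * (a j)%:C else 0.
have [||||f [fH fb]] := @hahn_banach R X 16
    [set p | exists c M, p = (bsum N g c 0 M, val c M)].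
- by [].
- exists (fun _ _ => 0), 0%N; rewrite /val ltn0 /bsum big_geq//.
- move=> s _ _ [c [M ->]] [d [M' ->]] /=.
  exists (fun k j => s * (if (k < M)%N then c k j else 0) + (if (k < M')%N then d k j else 0)),
    (maxn M M').
  rewrite bsum_linear -!bsum_widen ?leq_maxl ?leq_maxr//; congr pair.
  rewrite /val leq_max; case: ltnP => nM; case: ltnP => nM' /=.
  + by rewrite mulr_sumr -big_split/=; apply: eq_bigr => j _; rewrite mulrDl mulrA.
  + by rewrite addr0 mulr_sumr; apply: eq_bigr => j _; rewrite addr0 mulrA.
  + by rewrite mulr0 add0r; apply: eq_bigr => j _; rewrite add0r.
  + by rewrite mulr0 addr0.
- move=> _ [c [M ->]] /=; rewrite /val; case: ltnP => nM; last first.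
    by rewrite nrm0 mulr_ge0 ?nrm_ge0.
  apply: le_trans (gl c n M nM); apply: (le_trans (@nrm_sum R R[i]^o _ _ _ _)).
  apply: ler_sum => j _; rewrite nrmM nrmC -[leRHS]mulr1.
  by rewrite ler_pM ?nrm_ge0.
exists f; split=> // k j jN.
pose c k' j' : R[i] := ((k' == k) && (j' == j))%:R.
have gE : bsum N g c 0 k.+1 = g k j.
  rewrite (bsum_cat _ _ _ (leq0n k) (leqnSn k)) /bsum big_nat_cond big1 ?add0r.
    rewrite big_nat1 (bigD1_seq j) ?mem_index_iota ?iota_uniq//= /c !eqxx scale1r.
    by rewrite big1 ?addr0// => i /negPf ->; rewrite andbF scale0r.
  move=> i; rewrite andbT => /andP[_ ik]; rewrite big1// => l _.
  by rewrite /c ltn_eqF// scale0r.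
have := fH (bsum N g c 0 k.+1, val c k.+1); rewrite /= gE => -> //; last by exists c, k.+1; rewrite gE.
rewrite /val /c ltnS; case: leqP => nk; last by rewrite (ltn_eqF nk).
have [kn|kn] := eqVneq k n.
  rewrite -kn (bigD1_seq j) ?mem_index_iota ?iota_uniq//= !eqxx mul1r.
  by rewrite big1 ?addr0// => i /negPf ->; rewrite mul0r.
by rewrite big1// => i _; rewrite mul0r.
Qed.

End Blocks.

(** * A trace criterion for the failure of the CAP *)

Section TraceCriterion.
Context (R : realType).

Lemma null_family_compact (V : normedModType R[i]) (J : nat -> finType)
    (u : forall n, J n -> V) :
  (forall e : R, 0 < e -> exists N, forall n j, (N <= n)%N -> nrm (u n j) < e) ->
  compact [set v | v = 0 \/ exists n j, v = u n j].
Proof.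
move=> u0; set A := [set _ | _]; move=> F FF FA.
have [F0|/existsNP[B /existsNP[U]]] := pselect (cluster F (0 : V)).
  by exists 0; split=> //; left.
move=> /not_implyP[FB /not_implyP[/nbhs_ballP[e /= /posC[-> e0] eU] BU]].
have [N uN] := u0 _ e0.
pose A' := \bigcup_(n in `I_N) [set u n j | j in [set: J n]].
have finA' : finite_set A'.
  by apply: bigcup_finite => // n _; apply: finite_image; exact: finite_finset.
have [s sE] := (finite_seqP A').1 finA'.
have cs : compact [set` s].
  elim: s {sE} => [|x s IH]; first by rewrite classical_sets.set_nil; exact: compact0.
  rewrite (_ : [set` _] = [set x] `|` [set` s]).
    by apply: compactU => //; exact: compact_set1.
  by apply/seteqP; split=> y; rewrite /= inE => /predU1P.
have FA' : F A'.
  apply: filterS2 FA FB => v [->|[n [j ->]]] Bv.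
    exfalso; apply: BU; exists 0; split=> //; apply: eU.
    by rewrite -ball_normE /= subrr normr0 ltcR.
  exists n; last by exists j.
  rewrite /= ltnNge; apply/negP => Nn; apply: BU; exists (u n j); split=> //.
  by apply: eU; rewrite -ball_normE /= sub0r normrN nrmE ltcR uN.
have [|v [vA' vF]] := cs F FF; first by rewrite -sE.
exists v; split=> //; rewrite -sE in vA'; have [n _ [j _ <-]] := vA'.
by right; exists n, j.
Qed.

Context (V : completeNormedModType R[i]) (I : nat -> finType)
  (z : forall n, I n -> V) (zs : forall n, I n -> dual V).

(** The normalized trace of the compression of [T] to the span of the [z_i] of
    level [n], computed with coordinate functionals. *)
Definition mean_trace n (T : V -> V) : R[i] :=
  (#|I n|%:R)^-1 * \sum_(i : I n) zs i (T (z i)).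

Context (J : nat -> finType) (phi : forall n, J n -> dual V)
  (u : forall n, J n -> V) (lam : nat -> R) (C L : R).

Hypotheses (I0 : forall n, (0 < #|I n|)%N) (J0 : forall n, (0 < #|J n|)%N).
Hypothesis C0 : 0 < C.
Hypothesis z_le : forall n (i : I n), nrm (z i) <= C.
Hypothesis zs_le : forall n (i : I n) v, nrm (zs i v) <= C * nrm v.
Hypothesis zs_z : forall n (i : I n), zs i (z i) = 1.
Hypothesis zs_null : forall v (e : R), 0 < e ->
  exists N, forall n (i : I n), (N <= n)%N -> nrm (zs i v) < e.
Hypothesis phi_le : forall n (j : J n) v, nrm (phi j v) <= C * nrm v.
Hypothesis u_null : forall e : R, 0 < e ->
  exists N, forall n (j : J n), (N <= n)%N -> nrm (u j) < e.
Hypothesis lam0 : forall n, 0 <= lam n.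
Hypothesis lam_sum : forall N, \sum_(n < N) lam n <= L.
Hypothesis trace_step : forall n (T : {linear V -> V}),
  mean_trace n.+1 T - mean_trace n T =
  (lam n)%:C * ((#|J n|%:R)^-1 * \sum_(j : J n) phi j (T (u j))).

Lemma nrm_mean_le (K : finType) (f : K -> R[i]) (B : R) : (0 < #|K|)%N ->
  (forall k, nrm (f k) <= B) -> nrm ((#|K|%:R)^-1 * \sum_k f k : R[i]) <= B.
Proof.
move=> K0 fB; rewrite nrmM -(rmorph_nat (real_complex R)) -fmorphV nrmC.
rewrite ger0_norm ?invr_ge0// ler_pdivrMl ?ltr0n//.
apply: (le_trans (@nrm_sum R R[i]^o _ _ _ _)).
apply: (@le_trans _ _ (\sum_(k : K) B)); first by apply: ler_sum => k _; exact: fB.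
by rewrite sumr_const mulr_natl.
Qed.

(** Coordinate functionals that tend to [0] pointwise do so uniformly on the
    compact closure of the image of the unit ball. *)
Lemma mean_trace_compact (K : {linear V -> V}) : compact_op K ->
  forall e : R, 0 < e -> exists n, nrm (mean_trace n K) < e.
Proof.
move=> cK e e0.
have Kz n (i : I n) : closure [set K x | x in [set x : V | nrm x <= 1]]
    (C^-1%:C *: K (z i)).
  apply: subset_closure; exists (C^-1%:C *: z i); last by rewrite linearZ.
  by rewrite /= nrmZ nrmC ger0_norm ?invr_ge0 ?(ltW C0)// ler_pdivrMl// mulr1.
have eC : 0 < e / C / 2 by rewrite !divr_gt0.
(* Pick one offending index in each level, if there is one, to deal with a
   sequence of functionals. *)
have bad n : exists i : I n, (exists i' : I n, e / 2 < nrm (zs i' (K (z i')))) ->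
    e / 2 < nrm (zs i (K (z i))).
  have [[i' hi']|no] := pselect (exists i' : I n, e / 2 < nrm (zs i' (K (z i')))).
    by exists i'.
  by have /card_gt0P[i _] := I0 n; exists i => /no.
pose i n : I n := sval (cid (bad n)).
have [N _ NP] : \forall n \near \oo, forall v,
    closure [set K x | x in [set x : V | nrm x <= 1]] v ->
    nrm (zs (i n) v : R[i]^o) < e / C / 2.
  apply: (@equilipschitz_cvg_compact R V R[i]^o _ _ _ _ _ C cK) => //.
    apply: nearW => n x y; rewrite -dualB.
    exact: zs_le.
  by move=> x d d0; have [N hN] := zs_null x d0; exists N => // n; exact: hN.
exists N; apply: (@le_lt_trans _ _ (e / 2)); last by lra.
apply: nrm_mean_le => // j; rewrite leNgt; apply/negP => ej.
have := svalP (cid (bad N)) (ex_intro _ j ej); rewrite -/(i N).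
apply/negP; rewrite -leNgt.
have := NP N (leqnn N) _ (Kz N (i N)); rewrite dualZ nrmM nrmC.
rewrite ger0_norm ?invr_ge0 ?(ltW C0)// => h.
apply: ltW; rewrite -(ltr_pM2l (_ : 0 < C^-1)) ?invr_gt0//; apply: lt_le_trans h _.
by rewrite mulrA [C^-1 * e]mulrC.
Qed.

(** If [K - 1] is small on the compact set formed by [0], the vectors [u] and the
    first vectors [z], then by [trace_step] all mean traces of [K - 1] are small.
    But they are those of [K] minus [1], and those of a compact [K] tend to [0]. *)
Theorem not_CAP_of_trace : ~ CAP V.
Proof.
move=> cap.
(* The vectors z of level 0 are attached to the null family at n = 0. *)
pose u' n : (J n + I 0%N)%type -> V := fun k =>
  match k with inl j => u j | inr i => if n is 0 then z i else 0 end.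
have cA : compact [set v | v = 0 \/ exists n (j : (J n + I 0%N)%type), v = u' n j].
  apply: (@null_family_compact V (fun n => (J n + I 0%N)%type) u') => e e0.
  have [N hN] := u_null e0; exists N.+1 => n [j|i] Nn; first by apply: hN; exact: ltnW.
  by case: n Nn => // n _; rewrite /= nrm0.
have L0 : 0 <= L by have := lam_sum 0; rewrite big_ord0.
have CL : 0 < C * (1 + L) by rewrite mulr_gt0// ltr_pwDl.
have e0 : 0 < (2 * (C * (1 + L)))^-1 by rewrite invr_gt0 mulr_gt0.
have [K [cK Kid]] := cap _ _ cA e0.
set e := (2 * _)^-1 in e0 Kid.
have [D DE] : exists D : {linear V -> V}, forall x, D x = K x - x.
  by apply: linear_of => c x y; rewrite linearP scalerBr opprD addrACA.
have De v : (v = 0 \/ exists n (j : (J n + I 0%N)%type), v = u' n j) -> nrm (D v) <= e.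
  move=> vA; rewrite -lee_fin; apply/ltW; apply: le_lt_trans Kid.
  by apply: ereal_sup_ubound; exists v => //; rewrite DE.
have Dn n : nrm (mean_trace n D) <= C * e * (1 + \sum_(k < n) lam k).
  elim: n => [|n IH].
    rewrite big_ord0 addr0 mulr1; apply: nrm_mean_le => // i.
    apply: (le_trans (zs_le _ _)); rewrite ler_wpM2l ?(ltW C0)// De//.
    by right; exists 0%N, (inr i).
  rewrite -(subrK (mean_trace n D) (mean_trace n.+1 D)) trace_step.
  apply: (le_trans (@nrm_triangle R R[i]^o _ _)); rewrite big_ord_recr/= addrA mulrDr [leLHS]addrC.
  apply: lerD => //; rewrite nrmM nrmC ger0_norm// [leRHS]mulrC ler_wpM2l//.
  apply: nrm_mean_le => // j; apply: (le_trans (phi_le _ _)).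
  by rewrite ler_wpM2l ?(ltW C0)// De//; right; exists n, (inl j).
have [n nK] := mean_trace_compact cK (ltac:(lra) : 0 < 2^-1 :> R).
have : mean_trace n D = mean_trace n K - 1.
  rewrite /mean_trace -[X in _ - X](@mulVf _ (#|I n|%:R : R[i])); last first.
    by rewrite pnatr_eq0 -lt0n.
  rewrite -mulrBr; congr (_ * _); rewrite -sum1_card natr_sum -sumrB.
  by apply: eq_bigr => i _; rewrite DE dualB zs_z.
move=> h; have := Dn n; rewrite h => h1.
have h2 := @nrm_subr R R[i]^o 1 (mean_trace n K).
rewrite nrm_distC (nrm1 R : nrm (1 : R[i]^o) = 1) in h2.
have h3 : C * e * (1 + \sum_(k < n) lam k) <= C * e * (1 + L).
  by rewrite ler_wpM2l ?mulr_ge0 ?(ltW C0) ?(ltW e0)// lerD2l.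
have h4 : C * e * (1 + L) = 2^-1.
  rewrite mulrAC /e invfM mulrCA divff ?mulr1// gt_eqF//.
lra.
Qed.

End TraceCriterion.

(** * The Szankowski subspace *)

Section LinearIndependence.
Context (R : realType) (V : normedModType R[i]).

(** A finite spanning set of [m] vectors would factor the identity matrix of size
    [m.+1] through dimension [m]. *)
Lemma biorthogonal_infinite_dimensional (v : nat -> V) (f : nat -> dual V) :
  (forall m n, f m (v n) = (m == n)%:R) -> infinite_dimensional V.
Proof.
move=> fv [A [/finite_seqP[s ->] spanA]].
have coords n : exists d : 'I_(size s) -> R[i], v n = \sum_j d j *: s`_j.
  have : lin_span [set` s] (v n) by rewrite spanA.
  move=> [p [c [w [ws ->]]]].
  have idx i : (index (w i) s < size s)%N by rewrite index_mem; exact: ws.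
  exists (fun j => \sum_(i | Ordinal (idx i) == j) c i).
  under [RHS]eq_bigr do rewrite scaler_suml.
  rewrite (exchange_big_dep predT)//=; apply: eq_bigr => i _.
  rewrite (big_pred1 (Ordinal (idx i))); last by move=> j; rewrite /= eq_sym.
  by rewrite /= nth_index//; exact: ws.
have [d dE] := choice coords.
pose D : 'M[R[i]]_((size s).+1, size s) := \matrix_(i, j) d i j.
pose F : 'M[R[i]]_(size s, (size s).+1) := \matrix_(j, k) f k s`_j.
have DF : D *m F = 1%:M.
  apply/matrixP => i k; rewrite !mxE -val_eqE eq_sym -fv dE dual_sum.
  by apply: eq_bigr => j _; rewrite !mxE dualZ.
have := mulmx_max_rank D F; rewrite DF mxrank1 ltnn.
by [].
Qed.

End LinearIndependence.

Section ClosedHull.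
Context (R : realType) (X : completeNormedModType R[i]).

Lemma closed_hull (A : set X) : exists Z : closedSubspace X, A `<=` cs_set Z /\
  forall W : closedSubspace X, A `<=` cs_set W -> cs_set Z `<=` cs_set W.
Proof.
pose S := [set x | forall W : closedSubspace X, A `<=` cs_set W -> cs_set W x].
have sm : submod_closed (fun x : X => x \in S).
  split; first by apply/mem_set => W _; exact: cs0.
  by move=> a x y /set_mem Sx /set_mem Sy; apply/mem_set => W AW; apply: csP; [exact: Sx|exact: Sy].
have cl : closed S.
  move=> x /nrm_closedP xS W AW; apply: (@cs_closed _ _ W); apply/nrm_closedP => e.
  by move=> /xS[y [Sy xy]]; exists y; split=> //; exact: Sy.
by exists (ClosedSubspace sm cl); split=> [x Ax W|W AW x]; exact.
Qed.

End ClosedHull.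

Section Szankowski.
Context (R : realType) (X : completeNormedModType R[i]).
Context (x : forall n, bits n -> bool -> bool -> X).
Hypothesis x1 : forall n (q : bits n) l s, nrm (x q l s) <= 1.
Hypothesis coord : forall n (a : bits n -> bool -> bool -> R),
  (forall q l s, `|a q l s| <= 1) ->
  exists f : dual X, [/\ forall v, nrm (f v) <= 16 * nrm v,
    forall q l s, f (x q l s) = (a q l s)%:C
  & forall k (q : bits k) l s, k != n -> f (x q l s) = 0].

(** The colour of the pair [(l, s)] in block [n]. Its residue modulo [3] is that of
    [n]: neighbouring blocks have different colours, and the last position of a
    string of length [n.+1] never has a colour of block [n.+1]. *)
Definition col (n : nat) (l s : bool) : nat := (n %% 3 + 3 * (2 * l + s))%N.

Lemma col_lt12 n l s : (col n l s < 12)%N.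
Proof.
have := ltn_pmod n (isT : 0 < 3)%N; rewrite /col.
by case: (n %% 3)%N => [|[|[|]]] //; case: l; case: s.
Qed.

Lemma col_eq n l s l' s' : (col n l s == col n l' s') = (l == l') && (s == s').
Proof. by rewrite /col eqn_add2l eqn_mul2l; case: l; case: s; case: l'; case: s'. Qed.

Lemma col_mod n l s : (col n l s %% 3 = n %% 3)%N.
Proof. by rewrite /col addnC mulnC modnMDl modn_mod. Qed.

Lemma mod3S n : (n.+1 %% 3)%N != (n %% 3)%N.
Proof.
rewrite -addn1 -modnDml; have := ltn_pmod n (isT : 0 < 3)%N.
by case: (n %% 3)%N => [|[|[|]]].
Qed.

Lemma col_neqS n l s l' s' : col n.+1 l s != col n l' s'.
Proof.
by apply/eqP => /(congr1 (modn^~ 3)); rewrite !col_mod => /eqP; apply/negP; exact: mod3S.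
Qed.

Lemma col_neq_pos n l s : (n %% 12)%N != col n.+1 l s.
Proof.
apply/eqP => /(congr1 (modn^~ 3)); rewrite col_mod modn_dvdm// => /esym/eqP.
by apply/negP; exact: mod3S.
Qed.

Definition sg (s : bool) : R := if s then -1 else 1.

(** Within the block, the vectors [e l s i] form the transformed basis and
    [es l s i] is the dual basis. *)
Definition e n l s (i : bits n) : X :=
  \sum_q (ker (@synth R (col n l s)) i q)%:C *: x q l s.

(** The second sum lies in block [n.+1], where the string [i] of length [n.+1]
    indexes four basis vectors. *)
Definition z n (i : bits n.+1) : X :=
  \sum_s (sg s)%:C *: e i.2 s i.1 + \sum_l \sum_s @e n.+1 l s i.

Lemma norm_comb n (h : bits n -> R) l s :
  \sum_q `|\sum_i h i * ker (@synth R (col n l s)) i q| <= 1 ->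
  nrm (\sum_i (h i)%:C *: e l s i) <= 1.
Proof.
apply: le_trans.
under eq_bigr do rewrite scaler_sumr; rewrite exchange_big/=.
apply: (le_trans (nrm_sum _ _ _)); apply: ler_sum => q _.
under eq_bigr do rewrite scalerA -(rmorphM (real_complex R)).
rewrite -scaler_suml -rmorph_sum/= nrmZ nrmC -[leRHS]mulr1.
by rewrite ler_pM ?nrm_ge0.
Qed.

Lemma es_subproof n l s (i : bits n) q l' s' :
  `|if (l' == l) && (s' == s) then ker (@analysis R (col n l s)) i q else 0| <= 1.
Proof. by case: ifP => _; [exact: norm_analysis_le1|rewrite normr0]. Qed.

Definition es n l s (i : bits n) : dual X :=
  sval (cid (coord (es_subproof l s i))).

Lemma es_le n l s (i : bits n) v : nrm (es l s i v) <= 16 * nrm v.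
Proof. by rewrite /es; case: (cid _) => f [h _ _] /=; exact: h. Qed.

Lemma es_x n l s (i : bits n) q l' s' : es l s i (x q l' s') =
  (if (l' == l) && (s' == s) then ker (@analysis R (col n l s)) i q else 0)%:C.
Proof. by rewrite /es; case: (cid _) => f [_ h _] /=; exact: h. Qed.

Lemma es_x_far n l s (i : bits n) k (q : bits k) l' s' : k != n ->
  es l s i (x q l' s') = 0.
Proof. by rewrite /es; case: (cid _) => f [_ _ h] /=; exact: h. Qed.

Lemma es_e n l s (i i' : bits n) l' s' :
  es l s i (e l' s' i') = ((l' == l) && (s' == s) && (i == i'))%:R.
Proof.
rewrite /e dual_sum; under eq_bigr do rewrite dualZ es_x.
have [/andP[/eqP-> /eqP->]|ne] /= := boolP ((l' == l) && (s' == s)); last first.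
  by rewrite big1// => q _; rewrite mulr0.
rewrite -(rmorph_nat (real_complex R)) -(analysis_synth R (col n l s)) rmorph_sum.
apply: eq_bigr => q _; rewrite (rmorphM (real_complex R)) mulrC; congr (_%:C * _%:C).
by apply: ker_sym => p a b; exact: synth_sym.
Qed.

Lemma es_e_far n l s (i : bits n) k (q : bits k) l' s' : k != n ->
  es l s i (e l' s' q) = 0.
Proof.
by move=> kn; rewrite /e dual_sum big1// => r _; rewrite dualZ es_x_far// mulr0.
Qed.

Lemma es_z_low n l s (i : bits n) (j : bits n.+1) :
  es l s i (z j) = ((j.2 == l) && (i == j.1))%:R * (sg s)%:C.
Proof.
rewrite /z dualD !dual_sum [X in _ + X]big1 ?addr0; last first.
  by move=> l' _; rewrite dual_sum big1// => s' _; rewrite es_e_far// gtn_eqF.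
rewrite (bigD1 s)//= dualZ es_e eqxx andbT mulrC big1 ?addr0//.
by move=> s' /negPf s's; rewrite dualZ es_e s's andbF mulr0.
Qed.

Lemma es_z_up n l s (i j : bits n.+1) : es l s i (z j) = (i == j)%:R.
Proof.
rewrite /z dualD !dual_sum [X in X + _]big1 ?add0r; last first.
  by move=> s' _; rewrite dualZ es_e_far ?mulr0// ltn_eqF.
rewrite (bigD1 l)//= [X in _ + X]big1 ?addr0; last first.
  move=> l' /negPf l'l; rewrite dual_sum big1// => s' _.
  by rewrite es_e l'l.
rewrite dual_sum (bigD1 s)//= es_e !eqxx big1 ?addr0// => s' /negPf s's.
by rewrite es_e s's andbF.
Qed.

Lemma es_z_far n l s (i : bits n) k (j : bits k.+1) : k != n -> k.+1 != n ->
  es l s i (z j) = 0.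
Proof.
move=> kn kn'; rewrite /z dualD !dual_sum !big1 ?addr0// => [l' _|s' _].
  by rewrite dual_sum big1// => s' _; rewrite es_e_far.
by rewrite dualZ es_e_far// mulr0.
Qed.

(** The coordinate functional of [z i], read on block [n]. *)
Definition zs n (i : bits n.+1) : dual X :=
  (2^-1)%:C *: (\sum_s (sg s)%:C *: es i.2 s i.1).

Lemma zsE n (i : bits n.+1) v :
  zs i v = (2^-1)%:C * (\sum_s (sg s)%:C * es i.2 s i.1 v).
Proof.
rewrite -[LHS]/((2^-1)%:C * (\sum_s (sg s)%:C *: es i.2 s i.1 : dual X) v).
by congr (_ * _); rewrite !big_bool.
Qed.

(** The coordinate functional of [z i], read on block [n.+1]. *)
Definition zt n (i : bits n.+1) : dual X :=
  (4^-1)%:C *: (\sum_l \sum_s es l s i).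

Lemma ztE n (i : bits n.+1) v :
  zt i v = (4^-1)%:C * (\sum_l \sum_s es l s i v).
Proof.
rewrite -[LHS]/((4^-1)%:C * (\sum_l \sum_s es l s i : dual X) v).
by congr (_ * _); rewrite !big_bool.
Qed.

Lemma zs_z n (i j : bits n.+1) : zs i (z j) = (i == j)%:R.
Proof.
rewrite zsE big_bool !es_z_low; case: i j => i a [j b] /=.
rewrite xpair_eqE [in RHS]andbC [a == b]eq_sym.
case: (_ && _); rewrite ?mul0r ?mulr0 ?addr0 ?mulr0// !mul1r /sg.
by rewrite rmorphN rmorph1 mulrNN mulr1 -(natrD _ 1 1) -(rmorph_nat (real_complex R))
  -(rmorphM (real_complex R)) mulVf ?rmorph1// pnatr_eq0.
Qed.

Lemma zs_z_far n k (i : bits n.+1) (j : bits k.+1) : k != n -> zs i (z j) = 0.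
Proof.
move=> kn; rewrite zsE big_bool /=; have [E|E] := eqVneq k.+1 n.
  case: n i kn E => // n i _ [E]; subst k.
  by rewrite !es_z_up /sg rmorphN rmorph1 mulN1r mul1r addNr mulr0.
by rewrite !es_z_far// !mulr0 addr0 mulr0.
Qed.

Lemma zt_z n k (i : bits n.+1) (j : bits k.+1) : zt i (z j) = zs i (z j).
Proof.
rewrite ztE; have [E|kn] := eqVneq k n.
  subst k; rewrite zs_z !big_bool /= !es_z_up; case: (_ == _); last by rewrite !addr0 mulr0.
  rewrite -!natrD -(rmorph_nat (real_complex R)) -(rmorphM (real_complex R)).
  by rewrite mulVf ?rmorph1// pnatr_eq0.
rewrite zs_z_far//; have [E|E] := eqVneq k n.+1.
  subst k; rewrite !big_bool /= !es_z_low /sg !rmorphN !rmorph1.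
  by rewrite !mulrN1 !mulr1 !addNr addr0 mulr0.
by rewrite !big_bool /= !es_z_far// !addr0 mulr0.
Qed.

Lemma zs_le n (i : bits n.+1) v : nrm (zs i v) <= 16 * nrm v.
Proof.
rewrite zsE nrmM nrmC ger0_norm ?invr_ge0// ler_pdivrMl// big_bool.
apply: (le_trans (@nrm_triangle R R[i]^o _ _)).
have h s : nrm ((sg s)%:C * es i.2 s i.1 v) <= 16 * nrm v.
  rewrite nrmM nrmC; apply: le_trans (es_le _ _ _ _).
  by rewrite /sg; case: s; rewrite ?normrN normr1 mul1r.
have := h true; have := h false; lra.
Qed.

Lemma e_le n l s (i : bits n) : nrm (e l s i) <= 1.
Proof.
have -> : e l s i = \sum_j ((i == j)%:R)%:C *: e l s j.
  rewrite (bigD1 i)//= eqxx scale1r big1 ?addr0// => j /negPf ji.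
  by rewrite eq_sym ji scale0r.
apply: norm_comb; under eq_bigr => q _.
  rewrite (bigD1 i)//= eqxx mul1r big1 ?addr0; last first.
    by move=> j /negPf ji; rewrite eq_sym ji mul0r.
  over.
by rewrite (sum_norm_ker _ (@sum_norm_synth R _)).
Qed.

Lemma nrm_sum_bool (F : bool -> X) (B : R) :
  (forall b, nrm (F b) <= B) -> nrm (\sum_b F b) <= 2 * B.
Proof.
move=> FB; rewrite big_bool /=; apply: (le_trans (nrm_triangle _ _)).
by have := FB true; have := FB false; lra.
Qed.

Lemma nrm_sg s v : nrm ((sg s)%:C *: v : X) = nrm v.
Proof. by rewrite nrmZ nrmC /sg; case: s; rewrite ?normrN normr1 mul1r. Qed.

Lemma z_le n (i : bits n.+1) : nrm (z i) <= 6.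
Proof.
have -> : 6 = 2 * 1 + 2 * (2 * 1) :> R by lra.
rewrite /z (le_trans (nrm_triangle _ _))// lerD//; apply: nrm_sum_bool => l.
  by rewrite nrm_sg e_le.
by apply: nrm_sum_bool => s; exact: e_le.
Qed.

(** The vector paired with [es l s i] in the difference of two consecutive mean
    traces; its component along [e l s i] is zero. *)
Definition yv n l s (i : bits n.+1) : X := (sg s)%:C *: z ((i, l) : bits n.+2) - z i.

(** Sorting by blocks, the transformed sum consists of at most ten transformed
    basis sequences of colours other than that of [(l, s)], each of norm at most
    [1] by [sum_norm_mix_synth]. *)
Lemma nrm_mix_yv n l s (k : bits n.+1) :
  nrm (\sum_i (ker (@mix R (col n.+1 l s)) k i)%:C *: yv l s i) <= 10.
Proof.
set c := col n.+1 l s; pose h i : R := ker (@mix R c) k i.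
pose E l' s' := \sum_i (h i)%:C *: @e n.+1 l' s' i.
pose U l' s' := \sum_i (h i)%:C *: @e n.+2 l' s' (i, l).
pose D s' := \sum_i (h i)%:C *: e i.2 s' i.1.
have E1 l' s' : (l, s) != (l', s') -> nrm (E l' s') <= 1.
  move=> ls; apply: norm_comb; rewrite sum_norm_mix_synth//.
  by rewrite /c col_eq -xpair_eqE.
have D1 s' : nrm (D s') <= 1.
  have -> : D s' = \sum_i (ker (@mix R c) k.1 i)%:C *: @e n k.2 s' i.
    rewrite /D -(pair_bigA _ (fun i b => (h (i, b))%:C *: e b s' i))/=.
    apply: eq_bigr => i _; rewrite (bigD1 k.2)//= big1 ?addr0.
      by rewrite /h /= /mix (negPf (col_neq_pos _ _ _)) /dlt eqxx mulr1.
    move=> b bk; rewrite /h /= {2}/mix (negPf (col_neq_pos _ _ _)) /dlt.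
    by rewrite eq_sym (negPf bk) mulr0 scale0r.
  by apply: norm_comb; rewrite sum_norm_mix_synth// col_neqS.
have U1 l' s' : nrm (U l' s') <= 1.
  pose m q := \sum_i h i * ker (@synth R (col n.+2 l' s')) i q.
  have -> : U l' s' = \sum_q \sum_b (m q * @synth R (col n.+2 l' s') n.+1 l b)%:C *:
      x ((q, b) : bits n.+2) l' s'.
    rewrite /U; under eq_bigr do rewrite /e scaler_sumr.
    rewrite exchange_big/= (pair_bigA _ (fun q b => (m q * _)%:C *: x ((q, b) : bits n.+2) l' s'))/=.
    apply: eq_bigr => -[q b] _ /=; rewrite /m mulr_suml rmorph_sum scaler_suml.
    apply: eq_bigr => i _; rewrite scalerA -(rmorphM (real_complex R)).
    by rewrite mulrA.
  apply: (le_trans (nrm_sum _ _ _)).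
  apply: (@le_trans _ _ (\sum_q `|m q|)); last first.
    by rewrite sum_norm_mix_synth// eq_sym col_neqS.
  apply: ler_sum => q _; apply: (le_trans (nrm_sum _ _ _)).
  rewrite -[leRHS]mulr1 -(@sum_norm_synth R (col n.+2 l' s') n.+1 l) mulr_sumr.
  apply: ler_sum => b _; rewrite nrmZ nrmC normrM -[leRHS]mulr1.
  by rewrite ler_pM ?nrm_ge0.
have -> : \sum_i (h i)%:C *: yv l s i =
    - ((E l (~~ s) + E l (~~ s)) + (E (~~ l) s + E (~~ l) (~~ s)))
    + (sg s)%:C *: (\sum_l' \sum_s' U l' s') - \sum_s' (sg s')%:C *: D s'.
  have swap (G : bool -> bits n.+1 -> X) :
      \sum_i (h i)%:C *: \sum_b G b i = \sum_b \sum_i (h i)%:C *: G b i.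
    by under eq_bigr do rewrite scaler_sumr; rewrite exchange_big.
  have swapZ (t : R) (G : bits n.+1 -> X) :
      \sum_i (h i)%:C *: (t%:C *: G i) = t%:C *: \sum_i (h i)%:C *: G i.
    by rewrite scaler_sumr; apply: eq_bigr => i _; rewrite !scalerA mulrC.
  have A1 : \sum_i (h i)%:C *: z ((i, l) : bits n.+2) =
      \sum_s' (sg s')%:C *: E l s' + \sum_l' \sum_s' U l' s'.
    rewrite /z; under eq_bigr do rewrite scalerDr; rewrite big_split/=; congr (_ + _).
      by rewrite swap; apply: eq_bigr => s' _; rewrite swapZ.
    by rewrite swap; apply: eq_bigr => l' _; rewrite swap.
  have A2 : \sum_i (h i)%:C *: z i =
      \sum_s' (sg s')%:C *: D s' + \sum_l' \sum_s' E l' s'.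
    rewrite /z; under eq_bigr do rewrite scalerDr; rewrite big_split/=; congr (_ + _).
      by rewrite swap; apply: eq_bigr => s' _; rewrite swapZ.
    by rewrite swap; apply: eq_bigr => l' _; rewrite swap.
  have -> : \sum_i (h i)%:C *: yv l s i = (sg s)%:C *: \sum_i (h i)%:C *: z ((i, l) : bits n.+2)
      - \sum_i (h i)%:C *: z i.
    rewrite -swapZ -sumrB; apply: eq_bigr => i _; exact: scalerBr.
  (* The coordinate e_(i, l, s) cancels here. *)
  have PQ : (sg s)%:C *: (\sum_s' (sg s')%:C *: E l s') - \sum_l' \sum_s' E l' s' =
      - ((E l (~~ s) + E l (~~ s)) + (E (~~ l) s + E (~~ l) (~~ s))).
    have -> : (sg s)%:C *: (\sum_s' (sg s')%:C *: E l s') = E l s - E l (~~ s).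
      rewrite big_bool /= scalerDr !scalerA /sg -!(rmorphM (real_complex R)).
      by case: s {h c E1 D1 U D swap swapZ A1 A2 U1} E => E /=;
        rewrite ?mulrN1 ?mulr1 ?opprK !rmorphN !rmorph1 ?scaleN1r ?scale1r// addrC.
    have -> : \sum_l' \sum_s' E l' s' = E l s + E l (~~ s) + (E (~~ l) s + E (~~ l) (~~ s)).
      rewrite !big_bool /=; case: l {h c E1 D1 U D swap swapZ A1 A2 U1} E => E /=;
      case: s E => E /=; first [by [] | by rewrite addrC
        | by rewrite [X in X + _]addrC [X in _ + X]addrC
        | by rewrite addrC [X in X + _]addrC [X in _ + X]addrC].
    rewrite opprD addrA [RHS]opprD; congr (_ + _).
    by rewrite opprD addrACA subrr add0r opprD.
  rewrite A1 A2 scalerDr opprD -PQ -!addrA; congr (_ + _).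
  by rewrite [LHS]addrA [LHS]addrC.
have := nrm_triangleB (- ((E l (~~ s) + E l (~~ s)) + (E (~~ l) s + E (~~ l) (~~ s)))
    + (sg s)%:C *: (\sum_l' \sum_s' U l' s')) (\sum_s' (sg s')%:C *: D s').
have := nrm_triangle (- ((E l (~~ s) + E l (~~ s)) + (E (~~ l) s + E (~~ l) (~~ s))))
    ((sg s)%:C *: (\sum_l' \sum_s' U l' s')).
rewrite nrmN nrm_sg.
have a1 : nrm (\sum_l' \sum_s' U l' s') <= 2 * (2 * 1).
  by apply: nrm_sum_bool => l'; apply: nrm_sum_bool => s'; exact: U1.
have a2 : nrm (\sum_s' (sg s')%:C *: D s') <= 2 * 1.
  by apply: nrm_sum_bool => s'; rewrite nrm_sg D1.
have a3 : nrm ((E l (~~ s) + E l (~~ s)) + (E (~~ l) s + E (~~ l) (~~ s))) <= 4.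
  have := nrm_triangle (E l (~~ s) + E l (~~ s)) (E (~~ l) s + E (~~ l) (~~ s)).
  have := nrm_triangle (E l (~~ s)) (E l (~~ s)).
  have := nrm_triangle (E (~~ l) s) (E (~~ l) (~~ s)).
  have := E1 l (~~ s); have := E1 (~~ l) s; have := E1 (~~ l) (~~ s).
  rewrite !xpair_eqE; have nb b : (b == ~~ b) = false by case: b.
  rewrite !nb !andbF /= => /(_ isT) b1 /(_ isT) b2 /(_ isT) b3; lra.
lra.
Qed.

Lemma card_bits_gt0 n : (0 < #|bits n|)%N.
Proof. by rewrite card_bits expn_gt0. Qed.

Lemma x_hull_z (W : closedSubspace X) :
  (forall n (q : bits n) l s, cs_set W (x q l s)) ->
  forall n (i : bits n.+1), cs_set W (z i).
Proof.
move=> Wx; have We n l s (i : bits n) : cs_set W (e l s i).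
  by apply: cs_sum => q _; apply: csZ; exact: Wx.
move=> n i; apply: csD; first by apply: cs_sum => s _; apply: csZ; exact: We.
by apply: cs_sum => l _; apply: cs_sum => s _; exact: We.
Qed.

Section Hull.
Context (Z : closedSubspace X).
Hypothesis Zz : forall n (i : bits n.+1), cs_set Z (z i).
Hypothesis Zmin : forall W : closedSubspace X,
  (forall n (i : bits n.+1), cs_set W (z i)) -> forall v, cs_set Z v -> cs_set W v.

Lemma dual_eq_on_hull (f g : dual X) :
  (forall n (i : bits n.+1), f (z i) = g (z i)) -> forall v, cs_set Z v -> f v = g v.
Proof.
move=> fg v Zv; have [W WE] := dual_kernel (f - g).
have sub u : (f - g : dual X) u = f u - g u by [].
apply/eqP; rewrite -subr_eq0 -sub; apply/eqP/WE; apply: Zmin Zv => n i.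
by apply/WE; rewrite sub fg subrr.
Qed.

Lemma dual_eq_on_hull_x (f g : dual X) :
  (forall n (q : bits n) l s, f (x q l s) = g (x q l s)) ->
  forall v, cs_set Z v -> f v = g v.
Proof.
move=> fg; apply: dual_eq_on_hull => n i; have [W WE] := dual_kernel (f - g).
have sub u : (f - g : dual X) u = f u - g u by [].
apply/eqP; rewrite -subr_eq0 -sub; apply/eqP/WE; apply: x_hull_z => k q l s.
by apply/WE; rewrite sub fg subrr.
Qed.

Lemma zs_null v (d : R) : cs_set Z v -> 0 < d ->
  exists N, forall n (i : bits n.+1), (N <= n)%N -> nrm (zs i v) < d.
Proof.
pose S := [set v | forall d : R, 0 < d ->
  exists N, forall n (i : bits n.+1), (N <= n)%N -> nrm (zs i v) < d].
have sm : submod_closed (fun x : X => x \in S).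
  split; first by apply/mem_set => e e0; exists 0%N => n i _; rewrite dual0 nrm0.
  move=> a u w /set_mem Su /set_mem Sw; apply/mem_set => r r0.
  have a1 : 0 < nrm a + 1 by rewrite ltr_wpDl// nrm_ge0.
  have r2 : 0 < r / 2 by rewrite divr_gt0.
  have [N1 h1] := Su (r / 2 / (nrm a + 1)) (divr_gt0 r2 a1).
  have [N2 h2] := Sw (r / 2) r2.
  exists (maxn N1 N2) => n i; rewrite geq_max => /andP[n1 n2].
  rewrite dualD dualZ (le_lt_trans (@nrm_triangle R R[i]^o _ _))// [ltRHS]splitr.
  rewrite ltr_leD//; last by apply/ltW; exact: h2.
  have := h1 n i n1; rewrite ltr_pdivlMr// => h; apply: le_lt_trans h.
  by rewrite nrmM mulrC ler_wpM2l ?nrm_ge0// lerDl.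
have cl : closed S.
  move=> u /nrm_closedP uS r r0.
  have r2 : 0 < r / 2 by rewrite divr_gt0.
  have r32 : 0 < r / 2 / 16 by rewrite !divr_gt0.
  have [w [Sw uw]] := uS _ r32.
  have [N hN] := Sw _ r2; exists N => n i /(hN n i) h.
  have -> : zs i u = zs i (u - w) + zs i w by rewrite dualB subrK.
  rewrite (le_lt_trans (@nrm_triangle R R[i]^o _ _))// [ltRHS]splitr ler_ltD//.
  by apply: (le_trans (zs_le _ _)); rewrite mulrC -ler_pdivlMr// ltW.
move=> Zv; apply: (Zmin (W := ClosedSubspace sm cl)) Zv _ => k i r r0.
exists k.+1 => n j kn; rewrite zs_z_far ?nrm0//.
by rewrite ltn_eqF.
Qed.

Let zz n (i : bits n.+1) : Z := cs_mk (Zz i).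

Let zzE n (i : bits n.+1) : cs_val (zz i) = z i.
Proof. by []. Qed.

Let restrict (f : dual X) : exists g : dual Z, forall w, g w = f (cs_val w).
Proof.
have [M [_ fM]] := bounded_op_ge0 (dual_bounded f).
apply: (@dual_of R Z M) => [a u v|u]; last exact: fM.
by rewrite cs_valD cs_valZ dualD dualZ.
Qed.

Let res f := sval (cid (restrict f)).
Let resE f w : res f w = f (cs_val w).
Proof. by rewrite /res; case: (cid _). Qed.

Lemma hull_infinite_dimensional : infinite_dimensional Z.
Proof.
have [i0 i0P] : exists i0 : forall n, bits n.+1, True.
  by exists (fun n => (fix b n : bits n := if n is m.+1 then (b m, true) else tt) n.+1).
apply: (@biorthogonal_infinite_dimensional R Z (fun n => zz (i0 n))
  (fun n => res (zs (i0 n)))) => m n.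
rewrite resE zzE; have [->|mn] := eqVneq m n; first by rewrite zs_z eqxx.
by rewrite zs_z_far// eq_sym.
Qed.

Lemma phi_subproof n l s (k : bits n) q l' s' :
  `|if (l' == l) && (s' == s) then
    \sum_i ker (@mix R (col n l s)) k i * ker (@analysis R (col n l s)) i q else 0| <= 1.
Proof. by case: ifP => _; [rewrite norm_mix_analysis|rewrite normr0]. Qed.

(** On the subspace this is the sum over [i] of [ker (mix _) k i] times [es l s i];
    as its values on the block are signs, it is bounded independently of [n]. *)
Definition phi n l s (k : bits n) : dual X := sval (cid (coord (phi_subproof l s k))).

Lemma phi_le n l s (k : bits n) v : nrm (phi l s k v) <= 16 * nrm v.
Proof. by rewrite /phi; case: (cid _) => f [h _ _] /=; exact: h. Qed.

Lemma phiE n l s (k : bits n) v : cs_set Z v ->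
  phi l s k v = \sum_i (ker (@mix R (col n l s)) k i)%:C * es l s i v.
Proof.
pose g : dual X := \sum_i (ker (@mix R (col n l s)) k i)%:C *: es l s i.
have gE u : g u = \sum_i (ker (@mix R (col n l s)) k i)%:C * es l s i u.
  have coordm : {morph (fun f : dual X => f u : R[i]) : f1 f2 / f1 + f2} by [].
  by rewrite /g (big_morph _ coordm (erefl : (0 : dual X) u = 0)).
rewrite -gE; move: v; apply: dual_eq_on_hull_x => p q l' s'; rewrite gE /phi.
case: (cid _) => f [_ fx ffar] /=; have [pn|pn] := eqVneq p n.
  subst p; rewrite fx; under eq_bigr do rewrite es_x -(rmorphM (real_complex R)).
  rewrite -rmorph_sum/=; congr (_%:C); case: ifP => _ //.
  by rewrite big1// => i _; rewrite mulr0.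
by rewrite ffar// big1// => i _; rewrite es_x_far// mulr0.
Qed.

(** Inverting the partial Walsh transform turns the sum of [m] rank-one terms into
    [1/m] times a sum of [m] terms that are no larger: the gain of the
    construction. *)
Lemma mix_sum n l s (G : bits n -> X) : (forall i, cs_set Z (G i)) ->
  \sum_i es l s i (G i) = ((mult R (col n l s) n)^-1)%:C *
    \sum_k phi l s k (\sum_i (ker (@mix R (col n l s)) k i)%:C *: G i).
Proof.
move=> ZG; set c := col n l s; set m := mult R c n.
have m0 : m != 0 by rewrite gt_eqF// mult_gt0.
have -> : \sum_k phi l s k (\sum_i (ker (@mix R c) k i)%:C *: G i) =
    \sum_j \sum_i (m * (j == i)%:R)%:C * es l s j (G i).
  under eq_bigr => k _.
    rewrite phiE; last by apply: cs_sum => i _; apply: csZ; exact: ZG.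
    under eq_bigr do rewrite dual_sum mulr_sumr.
    over.
  rewrite exchange_big/=; apply: eq_bigr => j _; rewrite exchange_big/=.
  apply: eq_bigr => i _; rewrite -mix_mix rmorph_sum mulr_suml.
  apply: eq_bigr => k _; rewrite dualZ mulrA -(rmorphM (real_complex R)).
  by rewrite [ker _ j k](@ker_sym _ _ _ j k)// => p a b; exact: mix_sym.
rewrite mulr_sumr; apply: eq_bigr => j _.
rewrite (bigD1 j)//= [X in _ * (_ + X)]big1; last first.
  by move=> i /negPf ij; rewrite eq_sym ij mulr0 rmorph0 mul0r.
by rewrite addr0 eqxx mulr1 mulrA -(rmorphM (real_complex R)) mulVf// rmorph1 mul1r.
Qed.

Theorem hull_not_CAP : ~ CAP Z.
Proof.
pose I n : finType := bits n.+1.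
pose J n : finType := (bits n.+1 * (bool * bool))%type.
pose m n (j : J n) : R := mult R (col n.+1 j.2.1 j.2.2) n.+1.
have m0 n (j : J n) : 0 < m n j by exact: mult_gt0.
have r0 : 0 < rate R by rewrite /rate; lra.
have r1 : rate R < 1 by rewrite /rate; lra.
pose yz n l s (i : bits n.+1) : Z := (sg s)%:C *: zz ((i, l) : bits n.+2) - zz i.
have yzE n l s (i : bits n.+1) : cs_val (yz n l s i) = yv l s i.
  by rewrite /yz cs_valB cs_valZ !zzE.
pose w n (j : J n) : Z := \sum_i (ker (@mix R (col n.+1 j.2.1 j.2.2)) j.1 i)%:C *:
  yz n j.2.1 j.2.2 i.
have wE n (j : J n) : cs_val (w n j) =
    \sum_i (ker (@mix R (col n.+1 j.2.1 j.2.2)) j.1 i)%:C *: yv j.2.1 j.2.2 i.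
  by rewrite cs_val_sum; apply: eq_bigr => i _; rewrite cs_valZ yzE.
pose u n (j : J n) : Z := ((m n j)^-1 / rate R ^+ n)%:C *: w n j.
have rate_pow n : 0 < rate R ^+ n by rewrite exprn_gt0.
have uu n (j : J n) : nrm (u n j) <= 20 * rate R ^+ n.
  rewrite /u nrmZ nrmC gtr0_norm ?divr_gt0 ?invr_gt0//.
  have h1 : nrm (w n j) <= 10 by rewrite -nrm_cs wE nrm_mix_yv.
  have h2 : (m n j)^-1 <= 2 * (rate R ^+ n * rate R ^+ n).
    apply: (@le_trans _ _ (2 ^+ (n.+1 %/ 12))^-1).
      by rewrite lef_pV2 ?posrE ?exprn_gt0// mult_ge// col_lt12.
    have h : rate R ^+ n.+1 <= rate R ^+ n by rewrite exprS ler_piMl// ltW.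
    apply: (le_trans (rate_ge R n.+1)); rewrite ler_wpM2l//.
    exact: (ler_pM (ltW (rate_pow _)) (ltW (rate_pow _)) h h).
  have h3 : (m n j)^-1 / rate R ^+ n <= 2 * rate R ^+ n.
    by rewrite ler_pdivrMr// -mulrA.
  have h4 : 0 <= (m n j)^-1 / rate R ^+ n by rewrite ltW// divr_gt0 ?invr_gt0.
  have := ler_pM h4 (nrm_ge0 _) h3 h1; lra.
apply: (@not_CAP_of_trace R Z I (fun n i => zz i) (fun n i => res (zs i)) J
  (fun n j => res (phi j.2.1 j.2.2 j.1)) u (fun n => rate R ^+ n) 16 48) => //.
- by move=> n; exact: card_bits_gt0.
- by move=> n; rewrite /J card_prod muln_gt0 card_bits_gt0 card_prod card_bool.
- by move=> n i; rewrite -nrm_cs zzE; apply: le_trans (z_le i) _; lra.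
- by move=> n i v; rewrite resE; exact: zs_le.
- by move=> n i; rewrite resE zzE zs_z eqxx.
- move=> v d d0; have [N hN] := zs_null (cs_val_set v) d0.
  by exists N => n i Nn; rewrite resE; exact: hN.
- by move=> n j v; rewrite resE; exact: phi_le.
- move=> d d0.
  have : (fun n => 20 * rate R ^+ n) @ \oo --> 20 * (0 : R).
    by apply: cvgMr; apply: cvg_expr; rewrite ger0_norm ?ltW.
  rewrite mulr0 => /cvgrPdist_lt/(_ d d0)[N _ hN]; exists N => n j /hN.
  rewrite /= sub0r normrN ger0_norm ?mulr_ge0 ?ltW//.
  by apply: le_lt_trans; exact: uu.
- by move=> n; rewrite ltW.
- move=> N; have : (1 - rate R) * \sum_(n < N) rate R ^+ n = 1 - rate R ^+ N.
    elim: N => [|N IH]; first by rewrite big_ord0 mulr0 expr0 subrr.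
    by rewrite big_ord_recr/= mulrDr IH exprS; ring.
  have := rate_pow N; rewrite /rate; lra.
move=> n T.
have ZT v : cs_set Z (cs_val (T v)) by exact: cs_val_set.
have TZ c v : T (c *: v) = c *: T v by rewrite linearZ.
have cardV p : (#|bits p|%:R : R[i])^-1 = ((2 ^+ p : R)^-1)%:C.
  by rewrite card_bits natrX fmorphV rmorphXn rmorph_nat.
have b2 : @mean_trace R Z I (fun n i => zz i) (fun n i => res (zs i)) n.+1 T =
    ((2 ^+ n.+3)^-1)%:C * \sum_l \sum_s \sum_(i : bits n.+1)
      es l s i (cs_val (T ((sg s)%:C *: zz ((i, l) : bits n.+2)))).
  have -> : ((2 ^+ n.+3)^-1)%:C = ((2 ^+ n.+2 : R)^-1)%:C * (2^-1)%:C.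
    by rewrite -(rmorphM (real_complex R)) -invfM exprSr.
  rewrite /mean_trace cardV -mulrA.
  congr (_ * _); rewrite mulr_sumr.
  have -> : \sum_(i : bits n.+2) res (zs i) (T (zz i)) = \sum_(i : bits n.+1) \sum_l
      res (zs ((i, l) : bits n.+2)) (T (zz ((i, l) : bits n.+2))).
    by rewrite pair_bigA; apply: eq_bigr => -[].
  rewrite exchange_big/=; apply: eq_bigr => l _; rewrite exchange_big/= mulr_sumr.
  apply: eq_bigr => i _; rewrite resE zsE; congr (_ * _).
  by apply: eq_bigr => s _; rewrite TZ cs_valZ dualZ.
have b1 : @mean_trace R Z I (fun n i => zz i) (fun n i => res (zs i)) n T =
    ((2 ^+ n.+3)^-1)%:C * \sum_l \sum_s \sum_(i : bits n.+1) es l s i (cs_val (T (zz i))).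
  have -> : ((2 ^+ n.+3)^-1)%:C = ((2 ^+ n.+1 : R)^-1)%:C * (4^-1)%:C.
    rewrite -(rmorphM (real_complex R)) -invfM; congr (_^-1)%:C.
    by rewrite !exprS; ring.
  rewrite /mean_trace cardV -mulrA.
  congr (_ * _); under [in RHS]eq_bigr do rewrite exchange_big/=.
  rewrite exchange_big/= mulr_sumr; apply: eq_bigr => i _; rewrite resE -ztE.
  by apply: dual_eq_on_hull (ZT _) => k j; rewrite zt_z.
rewrite b1 b2 -mulrBr -sumrB.
have cJ : (#|J n|%:R : R[i])^-1 = ((2 ^+ n.+3 : R)^-1)%:C.
  rewrite -cardV [#|bits n.+3|]card_bits /J card_prod [#|bits n.+1|]card_bits.
  rewrite card_prod !card_bool; congr (_%:R^-1).
  by rewrite mulnC -mulnA -!expnS.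
rewrite cJ mulrCA; congr (_ * _); rewrite mulr_sumr.
have -> : \sum_(j : J n) (rate R ^+ n)%:C * res (phi j.2.1 j.2.2 j.1) (T (u n j)) =
    \sum_l \sum_s \sum_(k : bits n.+1)
      (rate R ^+ n)%:C * res (phi l s k) (T (u n (k, (l, s)))).
  rewrite pair_bigA exchange_big pair_bigA.
  by apply: eq_bigr => -[k [l s]].
apply: eq_bigr => l _; rewrite -sumrB; apply: eq_bigr => s _; rewrite -sumrB.
transitivity (\sum_(i : bits n.+1) es l s i (cs_val (T (yz n l s i)))).
  by apply: eq_bigr => i _; rewrite -dualB -cs_valB -linearB.
rewrite mix_sum => [|i]; last exact: ZT.
rewrite mulr_sumr; apply: eq_bigr => k _; rewrite resE /u TZ cs_valZ dualZ mulrA.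
rewrite -(rmorphM (real_complex R)) mulrCA divff ?gt_eqF// mulr1; congr (_ * phi _ _ _ _).
rewrite /w linear_sum cs_val_sum; apply: eq_bigr => i _.
by rewrite TZ cs_valZ.
Qed.

End Hull.

End Szankowski.

(** * Lotz subspaces of the Argyros-Motakis spaces *)

Section LotzSubspaces.
Context (R : realType) (X : completeNormedModType R[i]).
Hypothesis AM : AM_subspace_properties X.

Lemma AM_scalar_plus_square_compact (Z : closedSubspace X) :
  infinite_dimensional Z -> scalar_plus_square_compact Z.
Proof.
move=> /AM[_ dec comp] T /dec[al [S [Sss TE]]]; exists al, S; split=> //.
- by case: Sss.
- exact: comp.
Qed.

Lemma AM_l1_far_away (Y : closedSubspace X) : infinite_dimensional Y ->
  forall (Phi : seq (dual X)) (n : nat), exists g : nat -> X,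
  [/\ forall j, cs_set Y (g j), forall j, nrm (g j) <= 1,
      forall f j, List.In f Phi -> f (g j) = 0
    & forall c : nat -> R[i],
        \sum_(0 <= j < n) nrm (c j) <= 4 * nrm (\sum_(0 <= j < n) c j *: g j)].
Proof.
move=> iY Phi n; have [W [iW WE]] := kernels_infinite_dimensional Phi iY.
have [[x [x1 sm]] _ _] := AM iW.
have [k kP] := spreading_model_l1 n x1 sm.
pose g j : X := if (insub j : option 'I_n) is Some j' then cs_val (x (k j')) else 0.
exists g; split.
- move=> j; rewrite /g; case: insub => [j'|]; last exact: cs0.
  by have [] := WE _ (cs_val_set (x (k j'))).
- move=> j; rewrite /g; case: insub => [j'|]; last by rewrite nrm0.
  by rewrite nrm_cs x1.
- move=> f j fPhi; rewrite /g; case: insub => [j'|]; last exact: dual0.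
  by have [_ h] := WE _ (cs_val_set (x (k j'))); exact: h.
move=> c; rewrite !big_mkord; have := kP (fun j => c j); rewrite -nrm_cs cs_val_sum.
rewrite (_ : \sum_(i < n) cs_val _ = \sum_(j < n) c j *: g j)//.
by apply: eq_bigr => j _; rewrite cs_valZ /g valK.
Qed.

(** The Szankowski subspace built on l1 blocks inside [Y]. *)
Theorem exists_lotz_subspace (Y : closedSubspace X) : infinite_dimensional Y ->
  exists Z : closedSubspace X,
    [/\ cs_set Z `<=` cs_set Y, infinite_dimensional Z, lotz Z & ~ CAP Z].
Proof.
move=> iY.
pose J n : finType := (bits n * (bool * bool))%type.
have [g [gY g1 gl]] := l1_blocks (fun n => #|J n|) (AM_l1_far_away iY).
pose x n (q : bits n) (l s : bool) : X := g n (enum_rank ((q, (l, s)) : J n)).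
have x1 n (q : bits n) l s : nrm (x n q l s) <= 1 by exact: g1.
have coord n (a : bits n -> bool -> bool -> R) : (forall q l s, `|a q l s| <= 1) ->
  exists f : dual X, [/\ forall v, nrm (f v) <= 16 * nrm v,
    forall q l s, f (x n q l s) = (a q l s)%:C
  & forall k (q : bits k) l s, k != n -> f (x k q l s) = 0].
  move=> a1.
  pose b j : R := if (insub j : option 'I_#|J n|) is Some r then
    let t : J n := enum_val r in a t.1 t.2.1 t.2.2 else 0.
  have [|f [fb fg]] := @block_functional R X (fun n => #|J n|) g n b (fun c n M => gl c n M).
    by move=> j; rewrite /b; case: insub => [r|]; rewrite ?normr0//; exact: a1.
  exists f; split=> // [q l s|k q l s kn]; rewrite /x fg ?ltn_ord//.
    by rewrite eqxx /b valK enum_rankK.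
  by rewrite (negPf kn).
have [Z [Zz Zmin]] := closed_hull [set v | exists n (i : bits n.+1), v = z x i].
have {}Zz n (i : bits n.+1) : cs_set Z (z x i) by apply: Zz; exists n, i.
have {}Zmin (W : closedSubspace X) : (forall n (i : bits n.+1), cs_set W (z x i)) ->
    forall v, cs_set Z v -> cs_set W v.
  by move=> Wz; apply: Zmin => _ [n [i ->]]; exact: Wz.
have iZ : infinite_dimensional Z by exact: (hull_infinite_dimensional coord Zz).
have nZ : ~ CAP Z by exact: (hull_not_CAP x1 coord Zz Zmin).
exists Z; split=> //.
- by apply: Zmin => n i; apply: x_hull_z => k q l s; exact: gY.
- by apply: lotz_of_not_CAP => //; exact: AM_scalar_plus_square_compact.
Qed.

Theorem AM_lotz_saturated : lotz_saturated X.
Proof.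
move=> Y iY; have [Z [ZY iZ lZ _]] := exists_lotz_subspace iY.
have [f fE] := cs_val_linear Y.
have fN y : nrm (f y) = nrm y by rewrite fE nrm_cs.
have [Z' Z'E] := preimage_closedSubspace Z (isometry_continuous fN).
have ZZ' : isometric Z Z'.
  apply: isometric_sym; apply: (isometric_subspaces fN) => [y|x Zx].
    by rewrite Z'E.
  exists (cs_mk (ZY _ Zx)); split; last by rewrite fE.
  by rewrite Z'E fE.
exists Z'; split; first exact: infinite_dimensional_isometric ZZ' iZ.
exact: lotz_isometric ZZ' lZ.
Qed.

Theorem AM_exists_lotz_subspace : infinite_dimensional X ->
  exists Z : closedSubspace X, [/\ infinite_dimensional Z, lotz Z & ~ CAP Z].
Proof.
move=> iX; have [Y [YT _]] := closed_hull (@setT X).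
have iY : infinite_dimensional Y.
  apply: infinite_dimensional_isometric iX; apply: isometric_sym.
  have [f fE] := cs_val_linear Y.
  have [|h hE] := @linear_of R X Y (fun x => cs_mk (YT x Logic.I)).
    by move=> a x y; apply: cs_inj; rewrite cs_valD cs_valZ.
  exists f, h; split=> [y|x|y]; last by rewrite fE nrm_cs.
    by apply: cs_inj; rewrite hE fE.
  by rewrite fE hE.
by have [Z [_ iZ lZ nZ]] := exists_lotz_subspace iY; exists Z.
Qed.

End LotzSubspaces.

Theorem theorem5p10 (R : realType) (A : Type)
    (admitted : set (set (seq A)))
    (XT : set (seq A) -> completeNormedModType R[i])
    (XU : completeNormedModType R[i])
    (admitted_wf : forall T, admitted T -> well_founded_tree T)
    (XT_AM : forall T, admitted T -> AM_tree_space (XT T))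
    (XU_AM : AM_universal_space XU) :
  [/\ forall T, admitted T -> lotz_saturated (XT T) /\ ~ lotz (XT T),
      lotz_saturated XU /\ ~ lotz XU,
      forall T, admitted T ->
        exists Z : closedSubspace (XT T),
          [/\ infinite_dimensional Z, separable Z, reflexive_space Z,
              hereditarily_indecomposable Z & lotz Z] /\ ~ CAP Z
    & exists Z : closedSubspace XU,
        [/\ infinite_dimensional Z, separable Z, hereditarily_indecomposable Z,
            lotz Z & no_reflexive_subspace Z] /\ ~ CAP Z].
Proof.
have [[iU sU hU [b [basisU _]] nU] amU] := XU_AM.
split=> [T /XT_AM[[_ _ _ _ [e basis]] am]||T /XT_AM[[iX sX rX hX _] am]|].
- by split; [exact: AM_lotz_saturated|exact: schauder_basis_not_lotz basis].
- by split; [exact: AM_lotz_saturated|exact: schauder_basis_not_lotz basisU].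
- have [Z [iZ lZ nZ]] := AM_exists_lotz_subspace am iX.
  exists Z; split=> //; split=> //.
  + exact: separable_closed_subspace.
  + exact: reflexive_closed_subspace.
  + exact: hereditarily_indecomposable_closed_subspace.
- have [Z [iZ lZ nZ]] := AM_exists_lotz_subspace amU iU.
  exists Z; split=> //; split=> //.
  + exact: separable_closed_subspace.
  + exact: hereditarily_indecomposable_closed_subspace.
  + exact: no_reflexive_closed_subspace.
Qed.
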